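(* Let $(X_i,Y_i)$, $i=1,\dots,n$, be $n$ independent copies of a couple of random variables $(X,Y)\in\mathbb{R}^d\times\mathbb{R}$, let $R(\theta)=\mathbb{E}[(Y-\langle\theta,X\rangle)^2]$, let $\theta_*\in\arg\min_{\theta\in\mathbb{R}^d}R(\theta)$, and let $\kappa_1,\kappa_2$ be the kurtosis coefficients defined in the context. Consider the bound $$\mu=\sqrt{\frac{2\bigl[(\sqrt{\kappa_1}+\sqrt{\kappa_2})^2-1\bigr]\bigl[\log(\epsilon^{-1})+0.73(d+1)\bigr]}{n}}+6.81\bigl(\sqrt{\kappa_1}+\sqrt{\kappa_2}\bigr)\sqrt{\frac{2(d+1)}{n}} .$$ There exists a robust quadratic estimator $\breve N(\theta,\xi)$ such that for any estimator $\widehat\theta\in\arg\min_{\theta\in\mathbb{R}^d}\breve N(\theta,1)$, for any $\epsilon>0$ and $n\in\mathbb{N}$ satisfying $$n>\Biggl[20\bigl(\sqrt{\kappa_1}+\sqrt{\kappa_2}\bigr)\sqrt{d+1}+\Bigl(\frac52+\frac1{2\bigl[(\sqrt{\kappa_1}+\sqrt{\kappa_2})^2-1\bigr]}\Bigr)\Bigl(2\bigl[(\sqrt{\kappa_1}+\sqrt{\kappa_2})^2-1\bigr]\bigl[\log(\epsilon^{-1})+0.73(d+1)\bigr]\Bigr)^{1/2}\Biggr]^2=\mathbf{O}\Bigl((\kappa_1+\kappa_2)\bigl[d+\log(\epsilon^{-1})\bigr]\Bigr),$$ with probability at least $1-2\epsilon$, $$R(\widehat\theta)-R(\theta_* )\le\frac{\delta^2}{(1-\delta)^2}R(\theta_*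 ),$$ where $$\delta=\frac{2\mu}{1-4\mu},\qquad\delta^2=\Bigl(\frac{2\mu}{1-4\mu}\Bigr)^2=\mathbf{O}\Bigl(\frac{(\kappa_1+\kappa_2)[d+\log(\epsilon^{-1})]}{n}\Bigr).$$
   Context: $\kappa_1=\sup\{\mathbb{E}(\langle\theta,X\rangle^4):\theta\in\mathbb{R}^d,\ \mathbb{E}(\langle\theta,X\rangle^2)\le1\}$; $\kappa_2=\dfrac{\mathbb{E}[(Y-\langle\theta_*,X\rangle)^4]}{\mathbb{E}[(Y-\langle\theta_*,X\rangle)^2]^2}$ if $\mathbb{E}[(Y-\langle\theta_*,X\rangle)^2]>0$ and $\kappa_2=0$ otherwise. $A=\mathbf{O}(B)$ means that there is a numerical constant $c$ such that $A\le cB$. $R(\widehat\theta)$ is the function $R$ evaluated at the random point $\widehat\theta$. $\breve N$ is a quadratic form in $(\theta,\xi)\in\mathbb{R}^{d+1}$ estimating $N(\theta,\xi)=\mathbb{E}[(\xi Y-\langle\theta,X\rangle)^2]$, given by a robust estimate of the Gram matrix of $(X,-Y)$, constructed as follows. Let $Z_i=(X_i,-Y_i)\in\mathbb{R}^{D}$ with $D=d+1$, and $K=(\sqrt{\kappa_1}+\sqrt{\kappa_2})^2$. Let $\psi(x)=\log2$ for $x\ge1$, $\psi(x)=-\log(1-x+x^2/2)$ for $0\le x\le1$, $\psi(x)=-\psi(-x)$ for $x\le0$. Put $\lambda=\sqrt{\frac{2}{(K-1)n}[\log(\epsilon^{-1})+0.73D]}$ and, for $t\in\mathbb{R}^D$,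 $\widehat N(t)=\inf\{\rho>0:\sum_{i=1}^n\psi[\lambda(\rho^{-1}\langle t,Z_i\rangle^2-1)]\le0\}$. Let $\delta_0=\mu/(1-2\mu)$, $V=\operatorname{span}\{Z_1,\dots,Z_n\}$, $\mathbb{S}_D$ the unit sphere of $\mathbb{R}^D$, $(e_1,\dots,e_D)$ an orthonormal basis of $\mathbb{R}^D$, $\widehat\lambda_{\min}=\inf\{\widehat N(t):t\in V\cap\mathbb{S}_D\}$; choose $0<\rho\le\delta_0^2\widehat\lambda_{\min}/(2\sum_i\widehat N(e_i))$ and a finite set $\Theta_\rho\subset V\cap\mathbb{S}_D$ such that every point of $V\cap\mathbb{S}_D$ is at distance at most $\rho$ from $\Theta_\rho$. Let $\widehat G$ minimize $\operatorname{Tr}(H^2)$ among symmetric $H\in\mathbb{R}^{D\times D}$ with $\operatorname{Im}(H)\subset V$ and $(1-\delta_0)\widehat N(t)\le t^\top Ht\le(1+\delta_0)\widehat N(t)$ for all $t\in\Theta_\rho$. Then $\breve N(\theta,\xi)=t^\top\widehat G\,t$ with $t=(\theta,\xi)$.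
   Formalization: The risk bound and the O() for δ² are stated under 4μ<1 and δ<1 (the printed condition on n does not ensure these and the claim can then fail); the first O() is stated for κ1,κ2>0 or (√κ1+√κ2)²≥2; both O() are for ε≤1. *)

(* Defs.v *)
From HB Require Import structures.
From mathcomp Require Import all_boot all_order all_algebra.
From mathcomp Require Import all_classical all_reals all_analysis.
Set Implicit Arguments.
Unset Strict Implicit.
Unset Printing Implicit Defensive.
Import Order.TTheory GRing.Theory Num.Theory.
Import numFieldNormedType.Exports.
Local Open Scope classical_set_scope.
Local Open Scope ring_scope.

Section Euclidean.
Context {R : realType}.

Definition dotv D (u v : 'rV[R]_D) : R := \sum_(j < D) u 0 j * v 0 j.

(* The norm that the library puts on 'rV[R]_D is the sup norm. *)
Definition enorm D (u : 'rV[R]_D) : R := Num.sqrt (dotv u u).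

Definition qform D (H : 'M[R]_D) (t : 'rV[R]_D) : R := (t *m H *m t^T) 0 0.

Definition orthonormal_basis D (e : 'I_D -> 'rV[R]_D) : Prop :=
  forall i j, dotv (e i) (e j) = (i == j)%:R.

End Euclidean.

Section Constants.
Context {R : realType}.

Definition kurt (k1 k2 : R) : R := (Num.sqrt k1 + Num.sqrt k2) ^+ 2.

Definition confidence (eps : R) (D : nat) : R :=
  ln eps^-1 + 73 / 100 * D%:R.

Definition mu_bound (K eps : R) (n D : nat) : R :=
  Num.sqrt (2 * (K - 1) * confidence eps D / n%:R) +
  681 / 100 * Num.sqrt K * Num.sqrt (2 * D%:R / n%:R).

Definition delta_bound (K eps : R) (n D : nat) : R :=
  let mu := mu_bound K eps n D in 2 * mu / (1 - 4 * mu).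

Definition sample_threshold (K eps : R) (D : nat) : R :=
  (20 * Num.sqrt K * Num.sqrt D%:R +
   (5 / 2 + 1 / (2 * (K - 1))) *
     Num.sqrt (2 * (K - 1) * confidence eps D)) ^+ 2.

End Constants.

(* The i-th observation is the i-th row of the sample Z : 'M[R]_(n, D), so the
   span V of the observations is the row space of Z. *)
Section RobustGram.
Context {R : realType}.

Definition psi (x : R) : R :=
  let psi0 y := if 1 <= y then ln 2 else - ln (1 - y + y ^+ 2 / 2) in
  if 0 <= x then psi0 x else - psi0 (- x).

Definition scale (K eps : R) (n D : nat) : R :=
  Num.sqrt (2 / ((K - 1) * n%:R) * confidence eps D).

Context (K eps : R) (n D : nat) (Z : 'M[R]_(n, D)).

Definition Nhat (t : 'rV[R]_D) : R :=
  inf [set rho : R | 0 < rho /\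
    \sum_(i < n)
      psi (scale K eps n D * (rho^-1 * dotv t (row i Z) ^+ 2 - 1)) <= 0].

Definition span_sphere : set 'rV[R]_D :=
  [set t | (t <= Z)%MS /\ enorm t = 1].

Definition lambda_min_hat : R := inf (Nhat @` span_sphere).

Definition delta0 : R :=
  let mu := mu_bound K eps n D in mu / (1 - 2 * mu).

(* The image of H is spanned by its columns, that is, by the rows of H^T. *)
Definition gram_candidate (Theta : seq 'rV[R]_D) (H : 'M[R]_D) : Prop :=
  [/\ H^T = H, (H^T <= Z)%MS &
      forall t, t \in Theta ->
        (1 - delta0) * Nhat t <= qform H t <= (1 + delta0) * Nhat t].

Definition robust_gram (G : 'M[R]_D) : Prop :=
  exists (e : 'I_D -> 'rV[R]_D) (rho : R) (Theta : seq 'rV[R]_D),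
    [/\ orthonormal_basis e,
        0 < rho <= delta0 ^+ 2 * lambda_min_hat / (2 * \sum_(i < D) Nhat (e i)),
        (forall t, t \in Theta -> span_sphere t),
        (forall t, span_sphere t -> exists2 s, s \in Theta & enorm (t - s) <= rho)
      & gram_candidate Theta G /\
        forall H, gram_candidate Theta H -> \tr (G *m G) <= \tr (H *m H)].

End RobustGram.

(* There are samples on which the construction cannot be carried out (for
   instance when lambda_min_hat = 0): the estimator is unconstrained there. *)
Definition robust_gram_estimator {R : realType} (K eps : R) (n D : nat)
    (Ghat : 'M[R]_(n, D) -> 'M[R]_D) : Prop :=
  forall Z, (exists G, robust_gram K eps Z G) -> robust_gram K eps Z (Ghat Z).

(* The vector (theta, xi) of R^(d+1). *)
Definition join_vec {R : realType} d (theta : 'rV[R]_d) (xi : R) :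
  'rV[R]_(d + 1) := row_mx theta xi%:M.

Definition Nbreve {R : realType} d (G : 'M[R]_(d + 1))
    (theta : 'rV[R]_d) (xi : R) : R := qform G (join_vec theta xi).

Definition argmin {R : realType} {S : Type} (f : S -> R) : set S :=
  [set x | forall y, f x <= f y].

Section Model.
Context {R : realType} {dsp : measure_display} {T : measurableType dsp}.
Context (P : probability T R).

Definition obs d (X : T -> 'rV[R]_d) (Y : T -> R) (w : T) : 'rV[R]_(d + 1) :=
  join_vec (X w) (- Y w).

(* Tuples carry the product sigma-algebra in the library, row vectors carry
   none. *)
Definition coords D (Z : T -> 'rV[R]_D) (w : T) : D.-tuple R :=
  [tuple Z w 0 j | j < D].

Definition random_vector D (Z : T -> 'rV[R]_D) : Prop :=
  measurable_fun [set: T] (coords Z).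

Definition same_law D (Z Z' : T -> 'rV[R]_D) : Prop :=
  forall B : set (D.-tuple R), measurable B ->
    P (coords Z @^-1` B) = P (coords Z' @^-1` B).

(* Subfamilies are covered, since B i may be the full space. *)
Definition independent n D (Zs : 'I_n -> T -> 'rV[R]_D) : Prop :=
  forall B : 'I_n -> set (D.-tuple R), (forall i, measurable (B i)) ->
    P (\bigcap_(i in [set: 'I_n]) (coords (Zs i) @^-1` B i)) =
    (\prod_(i < n) P (coords (Zs i) @^-1` B i))%E.

Definition iid_copies n d (X : T -> 'rV[R]_d) (Y : T -> R)
    (Xs : 'I_n -> T -> 'rV[R]_d) (Ys : 'I_n -> T -> R) : Prop :=
  [/\ forall i, random_vector (obs (Xs i) (Ys i)),
      forall i, same_law (obs (Xs i) (Ys i)) (obs X Y)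
    & independent (fun i => obs (Xs i) (Ys i))].

Definition sample n d (Xs : 'I_n -> T -> 'rV[R]_d) (Ys : 'I_n -> T -> R)
    (w : T) : 'M[R]_(n, d + 1) := \matrix_(i < n) obs (Xs i) (Ys i) w.

Definition moment (k : nat) (U : T -> R) : \bar R :=
  expectation P (fun w => U w ^+ k).

Definition finite_second_moments d (X : T -> 'rV[R]_d) (Y : T -> R) : Prop :=
  (forall j, (moment 2 (fun w => X w 0%R j) < +oo)%E) /\
  (moment 2 Y < +oo)%E.

Definition residual d (X : T -> 'rV[R]_d) (Y : T -> R) (theta : 'rV[R]_d)
  (w : T) : R := Y w - dotv theta (X w).

Definition risk d (X : T -> 'rV[R]_d) (Y : T -> R) (theta : 'rV[R]_d) : R :=
  fine (moment 2 (residual X Y theta)).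

Definition kappa1 d (X : T -> 'rV[R]_d) : \bar R :=
  ereal_sup [set moment 4 (fun w => dotv theta (X w)) | theta in
    [set theta : 'rV[R]_d | (moment 2 (fun w => dotv theta (X w)) <= 1)%E]].

Definition kappa2 d (X : T -> 'rV[R]_d) (Y : T -> R) (theta : 'rV[R]_d)
    : \bar R :=
  let m2 := moment 2 (residual X Y theta) in
  let m4 := moment 4 (residual X Y theta) in
  if (0 < m2)%E then (m4 / m2 ^+ 2)%E else 0%E.

(* Inner probability, as no measurability of the estimators is assumed. *)
Definition with_probability_at_least (p : R) (Q : T -> Prop) : Prop :=
  exists A : set T,
    [/\ measurable A, (p%:E <= P A)%E & forall w, A w -> Q w].

End Model.

(* Main.v *)
Require Import Defs.
From HB Require Import structures.
From mathcomp Require Import all_boot all_order all_algebra.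
From mathcomp Require Import all_classical all_reals all_analysis measurable_realfun.
From mathcomp Require Import ring lra.
Import Order.TTheory GRing.Theory Num.Theory.
Import numFieldNormedType.Exports HBNNSimple.
Local Open Scope classical_set_scope.
Local Open Scope ring_scope.
Set Implicit Arguments.
Unset Strict Implicit.
Unset Printing Implicit Defensive.

(** Write Z = (X, -Y) and t = (theta, xi). Then N(t) = E <t, Z>^2 is a quadratic
    form with Gram matrix G, and the risk is its restriction to xi = 1. Everything
    follows from one event of probability at least 1 - 2 eps on which
      (1 - delta0) Nhat t <= N(t) <= (1 + delta0) Nhat t    for all t at once.

    The event, [gram_two_sided]. As psi is nondecreasing, Nhat t is located by the
    sign of sum_i psi (lambda (x <t, Z_i>^2 - 1)) at the two points x at which
    x N(t) = 1 - delta0 and x N(t) = 1 + delta0; since psi is odd, both signs are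
    upper bounds. A bound that is uniform in t comes from the PAC-Bayes method
    [pac_bayes]: the parameter is perturbed by a Gaussian vector, and moving the
    centre of the perturbation to t costs beta |t|^2 / 2. To insert the
    perturbation inside psi, which is neither convex nor concave, [psi_le_integral_ln]
    compares psi with the Gaussian average of the logarithm of [smooth_weight], a
    quadratic polynomial in the perturbed score plus a multiple of the
    variance that the perturbation creates. The expectation of that weight only
    involves second and fourth moments, that is, the kurtosis, which gives
    [whitened_deviation]. The Gram matrix is reduced to the identity by [whitening];
    in the directions that G annihilates, the sample vanishes almost surely.
    [calibrated_bound] checks that the numerical constants close the argument.

    The kurtosis, [obs_kurtosis]. At the risk minimizer the residual is orthogonal
    to the linear forms in X, so N splits as a sum of two second moments,
    and a weighted convexity inequality for (u + v)^4 bounds E <t, Z>^4 by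
    (sqrt kappa1 + sqrt kappa2)^2 N(t)^2.

    From the net to all directions, [robust_gram_accuracy]. On the event, G itself
    meets the constraints imposed on the estimator. By minimality the Frobenius norm
    of the estimator is at most that of G, hence at most tr G and at most
    (1 + delta0) sum_i Nhat e_i. Both forms are then so regular on the unit sphere
    of V that the constraints on a net of mesh rho control the estimator everywhere
    on V, with relative error delta; on the orthogonal of V both forms vanish.

    From the form to the risk, [regression_excess_risk]. With thetahat
    and theta0 the two minimizers, let h = (thetahat - theta0, 0) and
    u = (thetahat, 1). The two normal equations give
    N(h) = (B - B')(h, u), with B and B' the bilinear forms of G and of its
    estimator. By [form_perturbation] the right-hand side is at most
    delta sqrt (N(h) N(u)), where N(u) = N(h) + R and R is the least risk.
    Solving for N(h), which is the excess risk, gives the claim. *)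

(** * Integrals determined by indicators *)

(** Both sides are limits along the same simple function approximations of [f], so
    agreement on indicators suffices. With weights this one principle covers
    densities, equality in law and independence. *)
Lemma eq_weighted_integral (R : realType) d d1 d2 (T : measurableType d)
    (T1 : measurableType d1) (T2 : measurableType d2)
    (m1 : {measure set T1 -> \bar R}) (m2 : {measure set T2 -> \bar R})
    (p1 : T1 -> T) (p2 : T2 -> T) (w1 : T1 -> R) (w2 : T2 -> R) :
  measurable_fun setT p1 -> measurable_fun setT p2 ->
  measurable_fun setT w1 -> measurable_fun setT w2 ->
  (forall x, 0 <= w1 x) -> (forall x, 0 <= w2 x) ->
  (forall A, measurable A ->
    (\int[m1]_x (\1_A (p1 x) * w1 x)%:E = \int[m2]_x (\1_A (p2 x) * w2 x)%:E)%E) ->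
  forall f : T -> \bar R, measurable_fun setT f -> (forall x, (0 <= f x)%E) ->
  (\int[m1]_x (f (p1 x) * (w1 x)%:E) = \int[m2]_x (f (p2 x) * (w2 x)%:E))%E.
Proof.
move=> mp1 mp2 mw1 mw2 w10 w20 H f mf f0.
pose f_ := nnsfun_approx measurableT mf.
have E d' (T' : measurableType d') (m : {measure set T' -> \bar R})
    (p : T' -> T) (w : T' -> R) :
  measurable_fun setT p -> measurable_fun setT w -> (forall x, 0 <= w x) ->
  (\int[m]_x (f (p x) * (w x)%:E) = limn (fun n =>
     \sum_(r \in range (f_ n)) (r%:E * \int[m]_x (\1_(f_ n @^-1` [set r]) (p x) * w x)%:E)))%E.
  move=> mp mw w0.
  have mind n r : measurable_fun setT
      (fun x => \1_(f_ n @^-1` [set r]) (p x) * w x).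
    apply: measurable_funM => //.
    by apply: measurableT_comp => //; exact: measurable_indic.
  have step n : (\int[m]_x ((f_ n (p x))%:E * (w x)%:E) =
     \sum_(r \in range (f_ n)) (r%:E * \int[m]_x (\1_(f_ n @^-1` [set r]) (p x) * w x)%:E))%E.
    transitivity (\int[m]_x (\sum_(r \in range (f_ n))
        (r%:E * (\1_(f_ n @^-1` [set r]) (p x) * w x)%:E)))%E.
      apply: eq_integral => x _.
      rewrite (fimfunE (f_ n)) -fsumEFin// ge0_mule_fsuml; last first.
        by move=> r; exact: nnfun_muleindic_ge0.
      by apply: eq_fsbigr => r _; rewrite -!EFinM mulrA.
    have pos r x : (0 <= r%:E * (\1_(f_ n @^-1` [set r]) (p x) * w x)%:E)%E.
      rewrite EFinM muleA mule_ge0 ?lee_fin//; exact: nnfun_muleindic_ge0.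
    rewrite ge0_integral_fsum//; last first.
      move=> r; apply: emeasurable_funM => //; exact/measurable_EFinP.
    apply: eq_fsbigr => r /[!inE] -[x _ <-].
    rewrite -ge0_integralZl_EFin//.
    + by move=> y _; rewrite lee_fin mulr_ge0.
    + exact/measurable_EFinP.
  transitivity (limn (fun n => \int[m]_x ((f_ n (p x))%:E * (w x)%:E)))%E; last first.
    by congr (limn _); apply/funext => n; exact: step.
  rewrite -monotone_convergence//.
  - apply: eq_integral => x _; apply/esym/cvg_lim => //.
    by apply: cvgeZr => //; exact: cvg_nnsfun_approx.
  - move=> n; apply: emeasurable_funM => //; apply/measurable_EFinP => //.
    exact: measurableT_comp.
  - by move=> n x _; apply: mule_ge0 => //; rewrite lee_fin.
  - move=> x _ a b ab; apply: lee_wpmul2r; rewrite lee_fin//.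
    by have /lefP := nd_nnsfun_approx measurableT mf ab; exact.
rewrite (E _ _ m1 p1 w1)// (E _ _ m2 p2 w2)//.
congr (limn _); apply/funext => n; apply: eq_fsbigr => r _.
by rewrite H.
Qed.

(** * The standard normal law on the line *)

Lemma ge0_lebesgue_integral_shift (R : realType) (t : R) (f : R -> \bar R) :
  measurable_fun [set: R] f -> (forall x, (0 <= f x)%E) ->
  (\int[lebesgue_measure]_x f (x + t)%R = \int[lebesgue_measure]_x f x)%E.
Proof.
move=> mf f0.
pose s : measurableTypeR R -> measurableTypeR R := fun x => x + t.
have ms : measurable_fun setT s by apply: measurable_funD.
have := ge0_integral_pushforward ms lebesgue_measure measurableT mf
  (fun x _ => f0 x).
rewrite preimage_setT => <-.
apply: eq_measure_integral => A mA _ /=.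
apply/esym.
have := @lebesgue_measure_unique R (pushforward lebesgue_measure s).
apply => //= _ [[a b]] _ <-.
rewrite /pushforward.
have -> : s @^-1` `]a, b] = `]a - t, b - t]%classic.
  by apply/seteqP; split => x /=; rewrite !in_itv/= /s ltrBlDr lerBrDr.
rewrite !lebesgue_measure_itv/= !lte_fin ltrD2r.
by case: ifP => // _; rewrite -!EFinD; congr EFin; ring.
Qed.

Notation stdnormal R := (normal_prob (0 : R) 1).

Lemma normal_pdf01E (R : realType) (x : R) :
  normal_pdf 0 1 x = (normal_peak 1) * expR (- (x ^+ 2 / 2)).
Proof.
rewrite normal_pdfE ?oner_eq0// /normal_fun subr0 expr1n mulNr.
by congr (_ * expR _); rewrite mulr2n.
Qed.

Lemma ge0_integral_stdnormal (R : realType) (f : R -> \bar R) :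
  measurable_fun [set: R] f -> (forall x, (0 <= f x)%E) ->
  (\int[stdnormal R]_x f x =
   \int[lebesgue_measure]_x (f x * (normal_pdf 0 1 x)%:E))%E.
Proof.
move=> mf f0.
have := @eq_weighted_integral R _ _ _ (measurableTypeR R) (measurableTypeR R)
  (measurableTypeR R) (stdnormal R) lebesgue_measure id id (cst 1) (normal_pdf 0 1).
move=> /(_ (@measurable_id _ _ _) (@measurable_id _ _ _) (@measurable_cst _ _ _ _ _ _)
   (measurable_normal_pdf _ _) (fun=> ler01) (normal_pdf_ge0 _ _)).
move=> /(_ _ f mf f0) <-; first by apply: eq_integral => x _; rewrite mule1.
move=> A mA /=.
under eq_integral do rewrite mulr1.
rewrite integral_indic// setIT /= /normal_prob [LHS]integral_mkcond /=.
apply: eq_integral => x _; rewrite patchE indicE.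
by case: ifP; rewrite ?mul1r ?mul0r.
Qed.

(** The Cameron-Martin formula in dimension one: a translation of Lebesgue measure,
    then completing the square in the density. *)
Lemma stdnormal_shift (R : realType) (t : R) (f : R -> \bar R) :
  measurable_fun [set: R] f -> (forall x, (0 <= f x)%E) ->
  (\int[stdnormal R]_x (f (x + t)%R * (expR (- (t * x) - t ^+ 2 / 2))%:E) =
   \int[stdnormal R]_x f x)%E.
Proof.
move=> mf f0.
have me : measurable_fun [set: R] (fun x => expR (- (t * x) - t ^+ 2 / 2)).
  apply: measurableT_comp => //; apply: measurable_funB => //.
  by apply: measurableT_comp => //; exact: measurable_funM.
have mfs : measurable_fun [set: R] (fun x => f (x + t)).
  by apply: measurableT_comp => //; exact: measurable_funD.
rewrite !ge0_integral_stdnormal//; last 2 first.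
- by apply: emeasurable_funM => //; exact/measurable_EFinP.
- by move=> x; rewrite mule_ge0 ?lee_fin ?expR_ge0.
rewrite -[RHS](ge0_lebesgue_integral_shift t); last 2 first.
- by apply: emeasurable_funM => //; apply/measurable_EFinP; exact: measurable_normal_pdf.
- by move=> x; rewrite mule_ge0// lee_fin normal_pdf_ge0.
apply: eq_integral => x _; rewrite -muleA -EFinM; congr (_ * _%:E)%E.
rewrite !normal_pdf01E mulrCA -expRD; congr (_ * expR _).
by field.
Qed.

Lemma stdnormal_opp (R : realType) (f : R -> \bar R) :
  measurable_fun [set: R] f -> (forall x, (0 <= f x)%E) ->
  (\int[stdnormal R]_x f (- x)%R = \int[stdnormal R]_x f x)%E.
Proof.
move=> mf f0.
have mN : measurable_fun setT (-%R : measurableTypeR R -> measurableTypeR R) by [].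
rewrite !ge0_integral_stdnormal//; last first.
  by apply: measurableT_comp.
have mg : measurable_fun [set: measurableTypeR R] (fun x => (f x * (normal_pdf 0 1 x)%:E)%E).
  by apply: emeasurable_funM => //; apply/measurable_EFinP; exact: measurable_normal_pdf.
have := ge0_integral_pushforward mN lebesgue_measure measurableT mg.
rewrite preimage_setT => /(_ _)/esym H.
transitivity (\int[lebesgue_measure]_(x in setT) (((fun x => (f x * (normal_pdf 0 1 x)%:E)%E)
    \o -%R) x))%E.
  by apply: eq_integral => x _ /=; rewrite !normal_pdf01E sqrrN.
rewrite H; last by move=> x _; rewrite mule_ge0// lee_fin normal_pdf_ge0.
by apply: eq_measure_integral => A mA _; exact: lebesgue_measureN.
Qed.

Lemma derivable_oo_LRcontinuousT (R : realType) (F : R -> R) a b :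
  (forall x, derivable F x 1) -> derivable_oo_LRcontinuous F a b.
Proof.
move=> dF; have cF x : F y @[y --> x] --> F x.
  by have /derivable1_diffP/differentiable_continuous := dF x.
split => [x _||]; first exact: dF.
- exact: cvg_at_right_filter.
- exact: cvg_at_left_filter.
Qed.

(** The exponential series gives exp (x^2 / 2) >= (x^2 / 2)^(k+1) / (k+1)!, so the
    sequence is O(1 / n). *)
Lemma cvgn_exprn_gauss (R : realType) (k : nat) :
  (n.+1%:R ^+ k * expR (- (n.+1%:R ^+ 2 / 2)) : R) @[n --> \oo] --> (0 : R).
Proof.
pose C : R := 2 ^+ k.+1 * k.+1`!%:R.
have C0 : 0 < C by rewrite mulr_gt0 ?exprn_gt0// ltr0n fact_gt0.
have lim : (C * n.+1%:R^-1 : R) @[n --> \oo] --> (0 : R).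
  by rewrite -(mulr0 C); apply: cvgMr; exact: cvg_harmonic.
have le n : (n.+1%:R ^+ k * expR (- (n.+1%:R ^+ 2 / 2)) : R) <= C * n.+1%:R^-1.
  set x : R := n.+1%:R.
  have x0 : 0 < x by rewrite ltr0n.
  have x1 : 1 <= x by rewrite ler1n.
  rewrite ler_pdivlMr// mulrAC -exprSr expRN ler_pdivrMr ?expR_gt0//.
  have := expR_ge1Dxn k (x := x ^+ 2 / 2) (divr_ge0 (sqr_ge0 _) (ler0n _ _)).
  move=> h; have {}h : (x ^+ 2 / 2) ^+ k.+1 / k.+1`!%:R <= expR (x ^+ 2 / 2).
    by apply: le_trans h; rewrite lerDr.
  rewrite -(ler_pM2l C0) in h; apply: le_trans h.
  have -> : C * ((x ^+ 2 / 2) ^+ k.+1 / k.+1`!%:R) = x ^+ (2 * k.+1).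
    have F0 : (k.+1`!%:R : R) != 0 by rewrite pnatr_eq0 -lt0n fact_gt0.
    have P0 : (2 ^+ k.+1 : R) != 0 by rewrite expf_neq0// pnatr_eq0.
    rewrite /C expr_div_n -exprM; move: F0 P0.
    move: (k.+1`!%:R : R) (2 ^+ k.+1 : R) (x ^+ (2 * k.+1)) => F P X F0 P0.
    by field; rewrite F0.
  by rewrite ler_weXn2l// mul2n -addnn leq_addr.
apply: (squeeze_cvgr _ (cvg_cst (0 : R)) lim).
by apply: nearW => n; rewrite mulr_ge0 ?expR_ge0 ?exprn_ge0//=.
Qed.

Lemma is_derive_exprn (R : realType) k (x : R) :
  is_derive x 1 (fun x : R => x ^+ k) (k%:R * x ^+ k.-1).
Proof.
have -> : (fun x : R => x ^+ k) = (id : R -> R) ^+ k.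
  by apply/funext => y; rewrite exprfctE.
have := @is_deriveX _ _ id k x 1 _ (is_derive_id x (1 : R)).
by rewrite /GRing.scale /= mulr1.
Qed.

(** Integration by parts on [-n, n], x p(x) being the opposite of the derivative of
    the density p; the boundary terms vanish in the limit. *)
Lemma stdnormal_moment_step (R : realType) (k : nat) (c : R) : ~~ odd k ->
  (\int[stdnormal R]_x (x ^+ k)%:E = c%:E)%E ->
  (\int[stdnormal R]_x (x ^+ k.+2)%:E = (k.+1%:R * c)%:E)%E.
Proof.
move=> ek.
pose p (x : R) : R := normal_pdf 0 1 x.
have pE : p = fun x => normal_peak 1 * expR (- (x ^+ 2 / 2)).
  by apply/funext => x; exact: normal_pdf01E.
have ev m (x : R) : ~~ odd m -> 0 <= x ^+ m by move=> em; rewrite exprn_even_ge0.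
have dp (x : R) : is_derive x 1 p (- (x * p x)).
  rewrite pE; apply: is_derive_eq.
  by rewrite /GRing.scale /=; field.
have mX m : measurable_fun [set: R] (fun x : R => (x ^+ m * p x)%:E).
  apply/measurable_EFinP; apply: measurable_funM => //.
  exact: measurable_normal_pdf.
have p0 x : 0 <= p x by exact: normal_pdf_ge0.
have IE m : ~~ odd m -> (\int[stdnormal R]_x (x ^+ m)%:E =
   \int[lebesgue_measure]_x (x ^+ m * p x)%:E)%E.
  move=> em; rewrite ge0_integral_stdnormal//.
  - exact/measurable_EFinP.
  - by move=> x; rewrite lee_fin ev.
pose I n : set R := `[- n.+1%:R, n.+1%:R]%classic.
have lim m : ~~ odd m ->
    (\int[lebesgue_measure]_(x in I n) (x ^+ m * p x)%:E)%E
    @[n --> \oo] --> (\int[stdnormal R]_x (x ^+ m)%:E)%E.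
  move=> em; rewrite IE//.
  have -> : [set: R] = \bigcup_n I n.
    apply/seteqP; split => // x _.
    exists (Num.bound `|x|) => //=; rewrite /I/=; rewrite in_itv/= -ler_norml.
    by rewrite (le_trans (ltW (archi_boundP (normr_ge0 x))))// ler_nat.
  apply: ge0_nondecreasing_set_cvg_integral.
  - apply/nondecreasing_seqP => n; rewrite subsetEset /I => x /=.
    rewrite !in_itv/= -!ler_norml => /le_trans; apply.
    by rewrite ler_nat.
  - by move=> n; exact: measurable_itv.
  - by move=> n; apply: measurable_funTS; exact: mX.
  - by move=> n x _; rewrite lee_fin mulr_ge0// ev.
move=> Ik; have lk := lim k ek; rewrite Ik in lk.
have ibp n : (\int[lebesgue_measure]_(x in I n) (x ^+ k.+2 * p x)%:E =
   k.+1%:R%:E * \int[lebesgue_measure]_(x in I n) (x ^+ k * p x)%:E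
   - (2 * normal_peak 1 * (n.+1%:R ^+ k.+1 * expR (- (n.+1%:R ^+ 2 / 2))))%:E)%E.
  have cont (f df : R -> R) : (forall x : R, is_derive x 1 f (df x)) ->
      {within I n, continuous f}.
    move=> df'; apply: continuous_subspaceT => x.
    by have /(_ x)/@ex_derive/derivable1_diffP/differentiable_continuous := df'.
  have := @integration_by_parts R (fun x => x ^+ k.+1) p (fun x => k.+1%:R * x ^+ k)
    (fun x => - (x * p x)) (- n.+1%:R) n.+1%:R.
  rewrite -/(I n).
  have nn : - n.+1%:R < n.+1%:R :> R.
    by rewrite (@lt_trans _ _ 0)// ?oppr_lt0 ltr0n.
  have dX x := @is_derive_exprn R k.+1 x.
  have dXX (x : R) : is_derive x 1 (fun x : R => k.+1%:R * x ^+ k)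
      (k.+1%:R * (k%:R * x ^+ k.-1)).
    exact: (is_deriveZ _ (is_derive_exprn k x)).
  move=> /(_ nn (cont _ _ dXX)).
  move=> /(_ (derivable_oo_LRcontinuousT _ _ (fun x => @ex_derive _ _ _ _ _ _ _ (dX x)))).
  have e1 (f df : R -> R) D : (forall x : R, is_derive x 1 f (df x)) ->
      {in D, f^`()%classic =1 df}.
    by move=> h x _; rewrite derive1E; exact: (@derive_val _ _ _ _ _ _ _ (h x)).
  move=> /(_ (e1 _ _ _ _ dX)).
  have cg : {within I n, continuous (fun x => - (x * p x))}.
    apply: (cont _ (fun x => - (x * - (x * p x) + p x))) => x.
    by apply: is_derive_eq; rewrite /GRing.scale /=; ring.
  move=> /(_ cg (derivable_oo_LRcontinuousT _ _ (fun x => @ex_derive _ _ _ _ _ _ _ (dp x)))).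
  move=> /(_ (e1 _ _ _ _ dp)).
  have -> : (\int[lebesgue_measure]_(x in I n) (x ^+ k.+1 * - (x * p x))%:E =
     - \int[lebesgue_measure]_(x in I n) (x ^+ k.+2 * p x)%:E)%E.
    rewrite -integral_ge0N; last first.
      by move=> x _; rewrite lee_fin mulr_ge0// ev//= negbK.
    by apply: eq_integral => x _; rewrite -EFinN; congr EFin; rewrite !exprS; ring.
  have -> : (\int[lebesgue_measure]_(x in I n) (k.+1%:R * x ^+ k * p x)%:E =
     k.+1%:R%:E * \int[lebesgue_measure]_(x in I n) (x ^+ k * p x)%:E)%E.
    rewrite -ge0_integralZl_EFin//.
    - by apply: eq_integral => x _; rewrite -EFinM mulrA.
    - exact: measurable_itv.
    - by move=> x _; rewrite lee_fin mulr_ge0// ev.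
    - by apply: measurable_funTS; exact: mX.
  move=> /(congr1 (fun z => - z)%E); rewrite oppeK => ->.
  rewrite oppeD ?fin_num_adde_defr// oppeK addeC; congr (_ + _)%E.
  rewrite -EFinN; congr (- _)%:E; rewrite /p !normal_pdf01E.
  rewrite sqrrN exprNn -signr_odd /= ek /=.
  by ring.
have lk2 : (\int[lebesgue_measure]_(x in I n) (x ^+ k.+2 * p x)%:E)%E
    @[n --> \oo] --> (k.+1%:R * c)%:E.
  under eq_fun do rewrite ibp.
  rewrite -[(_ * c)%:E]sube0.
  apply: cvgeB => //.
    by rewrite EFinM; apply: cvgeZl.
  apply/cvg_EFin; first exact: nearW.
  rewrite -[0](mulr0 (2 * normal_peak 1)) /=.
  by apply: cvgMr; exact: cvgn_exprn_gauss.
apply: (cvg_unique _ (lim k.+2 _) lk2) => //; by rewrite /= negbK.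
Qed.

(** * Standard Gaussian vectors *)

Lemma integral_cst_prob (R : realType) d (T : measurableType d)
    (P : probability T R) (c : R) : (\int[P]_x c%:E = c%:E)%E.
Proof. by rewrite -[RHS](expectation_cst P) unlock. Qed.

(** Lets Gaussian vectors be built one coordinate at a time: the product measure is
    used only through its iterated integrals. *)
Lemma image_product_probability (R : realType) d1 d2 d3 (T1 : measurableType d1)
    (T2 : measurableType d2) (T3 : measurableType d3)
    (P1 : probability T1 R) (P2 : probability T2 R) (phi : T1 * T2 -> T3) :
  measurable_fun setT phi ->
  exists Q : probability T3 R, forall f : T3 -> \bar R,
    measurable_fun setT f -> (forall z, (0 <= f z)%E) ->
    (\int[Q]_z f z = \int[P1]_x \int[P2]_y f (phi (x, y)))%E.
Proof.
move=> mphi.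
have p1 : (P1 \x P2)%E setT = 1%E.
  transitivity (P1 setT * P2 setT)%E; last by rewrite !probability_setT mule1.
  by rewrite -product_measure1E// setXTT.
pose Q0 : probability (T1 * T2)%type R :=
  HB.pack (P1 \x P2)%E (Measure_isProbability.Build _ _ _ (P1 \x P2)%E p1).
pose X : {mfun (T1 * T2)%type >-> T3} :=
  HB.pack phi (isMeasurableFun.Build _ _ _ _ phi mphi).
exists (distribution Q0 X) => f mf f0.
rewrite ge0_integral_distribution//.
have mfp : measurable_fun setT (f \o phi) by exact: measurableT_comp.
exact: (fubini_tonelli1 (f \o phi) mfp (fun z => f0 _)).
Qed.

(** Tuples carry the product sigma-algebra and rows the linear structure; this map and
    [tuple_of_row] pass from one to the other. *)
Definition row_of_tuple (R : realType) r (v : r.-tuple R) : 'rV[R]_r :=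
  \row_j tnth v j.

Definition tuple_of_row (R : realType) r (v : 'rV[R]_r) : r.-tuple R :=
  [tuple v 0 j | j < r].

Lemma row_of_tupleK (R : realType) r :
  cancel (@row_of_tuple R r) (@tuple_of_row R r).
Proof. by move=> v; apply: eq_from_tnth => i; rewrite tnth_mktuple mxE. Qed.

Lemma tuple_of_rowK (R : realType) r :
  cancel (@tuple_of_row R r) (@row_of_tuple R r).
Proof. by move=> v; apply/rowP => i; rewrite mxE tnth_mktuple. Qed.

Lemma measurable_fun_tuple_of_row (R : realType) d (T : measurableType d) r
    (f : T -> 'rV[R]_r) :
  measurable_fun setT (fun x => tuple_of_row (f x)) <->
  forall j, measurable_fun setT (fun x => f x 0 j).
Proof.
split=> [/measurable_fun_tnthP h j|h].
  by have := h j; congr (measurable_fun _ _); apply/funext => x /=; rewrite tnth_mktuple.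
apply/measurable_fun_tnthP => j; have := h j.
by congr (measurable_fun _ _); apply/funext => x /=; rewrite tnth_mktuple.
Qed.

Lemma measurable_dotv (R : realType) d (T : measurableType d) r
    (f g : T -> 'rV[R]_r) :
  (forall j, measurable_fun setT (fun x => f x 0 j)) ->
  (forall j, measurable_fun setT (fun x => g x 0 j)) ->
  measurable_fun setT (fun x => dotv (f x) (g x)).
Proof.
by move=> mf mg; apply: measurable_sum => j; apply: measurable_funM.
Qed.

Lemma measurable_row_of_tuple (R : realType) r j :
  measurable_fun setT (fun v : r.-tuple R => row_of_tuple v 0 j).
Proof.
have := @measurable_tnth _ R r j.
by congr (measurable_fun _ _); apply/funext => v; rewrite mxE.
Qed.

Lemma dotv0l (R : realType) r (v : 'rV[R]_r) : dotv 0 v = 0.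
Proof. by rewrite /dotv big1// => j _; rewrite mxE mul0r. Qed.

Lemma dotvC (R : realType) r (u v : 'rV[R]_r) : dotv u v = dotv v u.
Proof. by apply: eq_bigr => j _; rewrite mulrC. Qed.

Lemma dotvDl (R : realType) r (u v w : 'rV[R]_r) :
  dotv (u + v) w = dotv u w + dotv v w.
Proof. by rewrite -big_split; apply: eq_bigr => j _; rewrite mxE mulrDl. Qed.

Lemma dotvZl (R : realType) r a (u w : 'rV[R]_r) : dotv (a *: u) w = a * dotv u w.
Proof. by rewrite /dotv mulr_sumr; apply: eq_bigr => j _; rewrite mxE mulrA. Qed.

Lemma dotvDr (R : realType) r (u v w : 'rV[R]_r) :
  dotv w (u + v) = dotv w u + dotv w v.
Proof. by rewrite dotvC dotvDl !(dotvC w). Qed.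

Lemma dotvZr (R : realType) r a (u w : 'rV[R]_r) : dotv u (a *: w) = a * dotv u w.
Proof. by rewrite dotvC dotvZl dotvC. Qed.

Lemma dotvNl (R : realType) r (u w : 'rV[R]_r) : dotv (- u) w = - dotv u w.
Proof. by rewrite -scaleN1r dotvZl mulN1r. Qed.

Lemma dotvNr (R : realType) r (u w : 'rV[R]_r) : dotv w (- u) = - dotv w u.
Proof. by rewrite dotvC dotvNl dotvC. Qed.

Lemma dotv_ge0 (R : realType) r (v : 'rV[R]_r) : 0 <= dotv v v.
Proof. by apply: sumr_ge0 => j _; rewrite -expr2 sqr_ge0. Qed.

Lemma dotv_recl (R : realType) r (u v : 'rV[R]_r.+1) :
  dotv u v = u 0 0 * v 0 0 +
    dotv (\row_j u 0 (lift ord0 j)) (\row_j v 0 (lift ord0 j)).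
Proof. by rewrite /dotv big_ord_recl; congr (_ + _); apply: eq_bigr => j _; rewrite !mxE. Qed.

Lemma dotv_delta (R : realType) r (u : 'rV[R]_r) j : dotv u (delta_mx 0 j) = u 0 j.
Proof.
rewrite /dotv (bigD1 j)//= mxE !eqxx mulr1 big1 ?addr0// => k kj.
by rewrite mxE (negbTE kj) andbF mulr0.
Qed.

Lemma row_of_tuple_cons (R : realType) r x (v : r.-tuple R) :
  \row_j row_of_tuple [tuple of x :: v] 0 (lift ord0 j) = row_of_tuple v.
Proof. by apply/rowP => j; rewrite !mxE tnthS. Qed.

Lemma row_of_tuple_cons0 (R : realType) r x (v : r.-tuple R) :
  row_of_tuple [tuple of x :: v] 0 0 = x.
Proof. by rewrite mxE tnth0. Qed.

(** A standard Gaussian vector through the four properties used below: the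
    Cameron-Martin formula, symmetry, and the second and fourth moments of its
    linear forms. *)
Definition standard_gaussian (R : realType) r (g : probability (r.-tuple R) R) :=
  [/\ forall (t : 'rV[R]_r) (f : r.-tuple R -> \bar R), measurable_fun setT f ->
        (forall v, (0 <= f v)%E) ->
        (\int[g]_v (f (tuple_of_row (row_of_tuple v + t)) *
           (expR (- dotv t (row_of_tuple v) - dotv t t / 2))%:E) =
         \int[g]_v f v)%E,
      forall f : r.-tuple R -> \bar R, measurable_fun setT f ->
        (forall v, (0 <= f v)%E) ->
        (\int[g]_v f (tuple_of_row (- row_of_tuple v)) = \int[g]_v f v)%E,
      forall y, (\int[g]_v (dotv y (row_of_tuple v) ^+ 2)%:E = (dotv y y)%:E)%E
    & forall y, (\int[g]_v (dotv y (row_of_tuple v) ^+ 4)%:E =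
        (3 * dotv y y ^+ 2)%:E)%E].

Lemma integral_tuple0 (R : realType) (f : 0.-tuple R -> \bar R) :
  (forall v, (0 <= f v)%E) ->
  (\int[dirac ([tuple] : 0.-tuple R)]_v f v = f [tuple])%E.
Proof.
move=> f0.
have -> : f = cst (f [tuple]) by apply/funext => v; rewrite tuple0.
by rewrite integral_cst//= diracT mule1.
Qed.

Lemma stdnormal_moment (R : realType) :
  (\int[stdnormal R]_x (x ^+ 2)%:E = (1 : R)%:E)%E /\
  (\int[stdnormal R]_x (x ^+ 4)%:E = (3 : R)%:E)%E.
Proof.
have m0 : (\int[stdnormal R]_x (x ^+ 0)%:E = 1%:E)%E.
  under eq_integral do rewrite expr0.
  rewrite integral_cst// mul1e.
  exact: (@probability_setT _ _ _ (stdnormal R : probability _ R)).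
have m2 := stdnormal_moment_step (isT : ~~ odd 0) m0.
have m4 := stdnormal_moment_step (isT : ~~ odd 2) m2.
by split; rewrite ?m2 ?m4; congr EFin; rewrite ?mulr1.
Qed.

Lemma ge0_integral_lin2 (R : realType) d (T : measurableType d)
    (P : probability T R) (f g : T -> R) (c0 c1 c2 A B : R) :
  measurable_fun setT f -> measurable_fun setT g ->
  (forall x, 0 <= f x) -> (forall x, 0 <= g x) ->
  0 <= c0 -> 0 <= c1 -> 0 <= c2 ->
  (\int[P]_x (f x)%:E = A%:E)%E -> (\int[P]_x (g x)%:E = B%:E)%E ->
  (\int[P]_x (c0 + c1 * f x + c2 * g x)%:E = (c0 + c1 * A + c2 * B)%:E)%E.
Proof.
move=> mf mg f0 g0 c00 c10 c20 fA gB.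
under eq_integral do rewrite !EFinD.
rewrite ge0_integralD//; last 4 first.
- by move=> x _; rewrite -EFinD lee_fin addr_ge0// mulr_ge0.
- apply/measurable_EFinP; apply: measurable_funD => //.
  exact: measurable_funM.
- by move=> x _; rewrite lee_fin mulr_ge0.
- by apply/measurable_EFinP; exact: measurable_funM.
rewrite ge0_integralD//; last 2 first.
- by move=> x _; rewrite lee_fin mulr_ge0.
- by apply/measurable_EFinP; exact: measurable_funM.
rewrite integral_cst_prob.
under eq_integral do rewrite EFinM.
rewrite ge0_integralZl_EFin//; [|by move=> x _; rewrite lee_fin|exact/measurable_EFinP].
rewrite fA; under eq_integral do rewrite EFinM.
rewrite ge0_integralZl_EFin//; [|by move=> x _; rewrite lee_fin|exact/measurable_EFinP].
by rewrite gB.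
Qed.

(** Symmetrization under a map [N] that preserves the integral of [F]; for
    nonnegative [F] it also gives finiteness. *)
Lemma integral_even_part (R : realType) d (T : measurableType d)
    (m : {measure set T -> \bar R}) (F : T -> \bar R) (N : T -> T) (G : T -> R) (c : R) :
  measurable_fun setT F -> measurable_fun setT (F \o N) -> (forall x, (0 <= F x)%E) ->
  (\int[m]_x F (N x) = \int[m]_x F x)%E ->
  (forall x, (F x + F (N x) = (2 * G x)%:E)%E) ->
  (\int[m]_x (2 * G x)%:E = (2 * c)%:E)%E -> (\int[m]_x F x = c%:E)%E.
Proof.
move=> mF mFN F0 FN FG Gc.
have : (2%:E * \int[m]_x F x = (2 * c)%:E)%E.
  rewrite -Gc -[(2%:E)]/((1 + 1)%:E) EFinD ge0_muleDl ?lee_fin// mul1e.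
  rewrite -[in X in (_ + X)%E]FN -ge0_integralD//.
  by apply: eq_integral => x _; rewrite FG.
have : (0 <= \int[m]_x F x)%E by exact: integral_ge0.
case: (\int[m]_x F x)%E => [z||]//.
- by move=> _; rewrite -EFinM => -[] /(mulfI _) ->//; rewrite pnatr_eq0.
- by move=> _; rewrite gt0_muley// lte_fin.
Qed.

Lemma stdnormal_even_part (R : realType) (F : R -> \bar R) (G : R -> R) (c : R) :
  measurable_fun setT F -> (forall x, (0 <= F x)%E) ->
  (forall x, (F x + F (- x)%R = (2 * G x)%:E)%E) -> (forall x, 0 <= G x) ->
  measurable_fun setT G ->
  (\int[stdnormal R]_x (G x)%:E = c%:E)%E -> (\int[stdnormal R]_x F x = c%:E)%E.
Proof.
move=> mF F0 FG G0 mG Gc.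
apply: (@integral_even_part R _ (measurableTypeR R) (stdnormal R) F -%R G c) => //.
- exact: measurableT_comp.
- exact: stdnormal_opp.
under eq_integral do rewrite EFinM.
rewrite ge0_integralZl_EFin//; [|by move=> x _; rewrite lee_fin|exact/measurable_EFinP].
by rewrite Gc -EFinM.
Qed.

(** Induction on the dimension, an independent normal coordinate being added in front.
    For the moments, the sum of the values at x and at -x only keeps the even powers
    of the remaining linear form. *)
Lemma exists_standard_gaussian (R : realType) r :
  exists g : probability (r.-tuple R) R, standard_gaussian g.
Proof.
elim: r => [|r [g [shift opp m2 m4]]].
  exists (dirac ([tuple] : 0.-tuple R)); split.
  - move=> t f mf f0; rewrite !integral_tuple0//; last first.
      by move=> v; rewrite mule_ge0// lee_fin expR_ge0.
    by rewrite /dotv !big_ord0 oppr0 mul0r subr0 expR0 mule1; congr f; exact: tuple0.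
  - by move=> f mf f0; rewrite !integral_tuple0//; congr f; exact: tuple0.
  - by move=> y; rewrite integral_tuple0 /dotv ?big_ord0 ?expr0n// => v; rewrite lee_fin sqr_ge0.
  - move=> y; rewrite integral_tuple0 /dotv ?big_ord0 ?expr0n ?mulr0// => v.
    by rewrite lee_fin exprn_even_ge0.
pose phi (z : R * r.-tuple R) : r.+1.-tuple R := [tuple of z.1 :: z.2].
have mphi : measurable_fun setT phi by apply: measurable_cons.
have [h hE] := image_product_probability (stdnormal R) g mphi.
have mc x : measurable_fun setT (fun v => phi (x, v)).
  by apply: measurableT_comp.
have mF0 (f : r.+1.-tuple R -> \bar R) : measurable_fun setT f -> (forall v, (0 <= f v)%E) ->
    measurable_fun setT (fun x => \int[g]_v f (phi (x, v)))%E /\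
    forall x, (0 <= \int[g]_v f (phi (x, v)))%E.
  move=> mf f0; split; last by move=> x; apply: integral_ge0 => v _.
  exact: (measurable_fun_fubini_tonelli_F (m2 := g) (f \o phi)
    (measurableT_comp mf mphi) (fun z => f0 _)).
have mdotX k (m : nat) (z : 'rV[R]_k) :
    measurable_fun setT (fun v => (dotv z (row_of_tuple v) ^+ m)%:E).
  apply/measurable_EFinP/measurable_funX; apply: measurable_dotv => // j.
  exact: measurable_row_of_tuple.
have S4ge0 k (z : 'rV[R]_k) v : 0 <= dotv z (row_of_tuple v) ^+ 4.
  by rewrite exprn_even_ge0.
have X4ge0 (x : R) : 0 <= x ^+ 4 by rewrite exprn_even_ge0.
have mom (y : 'rV[R]_r.+1) (m : nat) (p0 p1 p2 : R -> R) (q0 q1 q2 : R) :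
    let a := y 0 0 in let y' := \row_j y 0 (lift ord0 j) in
    ~~ odd m -> (forall x, 0 <= p0 x) -> (forall x, 0 <= p1 x) -> (forall x, 0 <= p2 x) ->
    0 <= q0 -> 0 <= q1 -> 0 <= q2 ->
    (forall x s, (a * x + s) ^+ m + (a * - x + s) ^+ m = p0 x + p1 x * s ^+ 2 + p2 x * s ^+ 4) ->
    (forall x, p0 x + p1 x * dotv y' y' + p2 x * (3 * dotv y' y' ^+ 2) =
       2 * (q0 + q1 * x ^+ 2 + q2 * x ^+ 4)) ->
    (\int[h]_v (dotv y (row_of_tuple v) ^+ m)%:E = (q0 + q1 * 1 + q2 * 3)%:E)%E.
  move=> a y' em p00 p10 p20 q00 q10 q20 pE qE.
  have dE x v : dotv y (row_of_tuple (phi (x, v))) = a * x + dotv y' (row_of_tuple v).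
    by rewrite dotv_recl row_of_tuple_cons row_of_tuple_cons0.
  have pos k (z : 'rV[R]_k) v : (0 <= (dotv z (row_of_tuple v) ^+ m)%:E)%E.
    by rewrite lee_fin exprn_even_ge0.
  have mS k : measurable_fun setT (fun v => dotv y' (row_of_tuple v) ^+ k).
    by apply/measurable_EFinP; exact: (mdotX r k y').
  pose G x := q0 + q1 * x ^+ 2 + q2 * x ^+ 4.
  rewrite hE; [|exact: mdotX|exact: pos].
  apply: (stdnormal_even_part (G := G)) => //.
  - apply: (measurable_fun_fubini_tonelli_F (m2 := g)
      (fun z => (dotv y (row_of_tuple (phi z)) ^+ m)%:E)) => //.
    exact: (measurableT_comp (mdotX _ _ _) mphi).
  - by move=> x; apply: integral_ge0 => v _; exact: pos.
  - move=> x; rewrite -ge0_integralD//; last 2 first.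
    + exact: (measurableT_comp (mdotX _ _ _) (mc _)).
    + exact: (measurableT_comp (mdotX _ _ _) (mc _)).
    rewrite /G -qE -(ge0_integral_lin2 (mS 2) (mS 4) (fun=> sqr_ge0 _) (S4ge0 _ _)
       (p00 x) (p10 x) (p20 x) (m2 y') (m4 y')).
    by apply: eq_integral => v _; rewrite -EFinD !dE pE.
  - by move=> x; rewrite /G; have := mulr_ge0 q10 (sqr_ge0 x); have := mulr_ge0 q20 (X4ge0 x); lra.
  - by do ?apply: measurable_funD => //; do ?apply: measurable_funM => //.
  have [n2 n4] := stdnormal_moment R.
  have := ge0_integral_lin2 (P := stdnormal R) (A := 1) (B := 3)
    (@exprn_measurable R setT 2) (@exprn_measurable R setT 4)
    (fun=> sqr_ge0 _) X4ge0 q00 q10 q20 n2 n4.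
  by move=> <-; apply: eq_integral.
exists h; split; [clear mom|clear mom| |].
- move=> t f mf f0.
  pose t0 := t 0 0; pose t' := \row_j t 0 (lift ord0 j).
  have mfs : measurable_fun setT (fun v => f (tuple_of_row (row_of_tuple v + t))).
    apply: measurableT_comp => //; apply/measurable_fun_tuple_of_row => j.
    under eq_fun do rewrite mxE.
    by apply: measurable_funD => //; exact: measurable_row_of_tuple.
  have me : measurable_fun setT (fun v : r.+1.-tuple R =>
     (expR (- dotv t (row_of_tuple v) - dotv t t / 2))%:E).
    apply/measurable_EFinP; apply: measurableT_comp => //.
    apply: measurable_funB => //; apply: measurableT_comp => //.
    by apply: measurable_dotv => // j; exact: measurable_row_of_tuple.
  rewrite !hE//; last 2 first.
  + exact: emeasurable_funM.
  + by move=> v; rewrite mule_ge0// lee_fin expR_ge0.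
  have mfx x : measurable_fun setT (fun v => f (phi (x, v))) by apply: measurableT_comp.
  pose F x := (\int[g]_v f (phi (x, v)))%E.
  have [mF F0] : measurable_fun setT F /\ forall x, (0 <= F x)%E by exact: mF0.
  rewrite -/F -(stdnormal_shift t0 mF F0).
  apply: eq_integral => x _.
  rewrite /F -(shift t' (fun v => f (phi (x + t0, v))))//.
  rewrite -ge0_integralZr//; last 2 first.
  + apply: emeasurable_funM.
      apply: (measurableT_comp (mfx (x + t0))).
      apply/measurable_fun_tuple_of_row => j.
      under eq_fun do rewrite mxE.
      by apply: measurable_funD => //; exact: measurable_row_of_tuple.
    apply/measurable_EFinP; apply: measurableT_comp => //.
    apply: measurable_funB => //; apply: measurableT_comp => //.
    by apply: measurable_dotv => // j; exact: measurable_row_of_tuple.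
  + by move=> v _; rewrite mule_ge0// lee_fin expR_ge0.
  apply: eq_integral => v _; rewrite -muleA -EFinM -expRD; congr (f _ * (expR _)%:E)%E.
    apply: eq_from_tnth => j; rewrite tnth_mktuple !mxE.
    case: (unliftP ord0 j) => [i ->|->]; last by rewrite /phi /= !tnth0.
    by rewrite /phi /= !tnthS tnth_mktuple !mxE.
  rewrite !dotv_recl row_of_tuple_cons row_of_tuple_cons0.
  by rewrite -/t0 -/t' /=; field.
- move=> f mf f0.
  have mfs : measurable_fun setT (fun v => f (tuple_of_row (- row_of_tuple v))).
    apply: measurableT_comp => //; apply/measurable_fun_tuple_of_row => j.
    under eq_fun do rewrite mxE.
    by apply: measurableT_comp => //; exact: measurable_row_of_tuple.
  have mfx x : measurable_fun setT (fun v => f (phi (x, v))) by apply: measurableT_comp.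
  pose F x := (\int[g]_v f (phi (x, v)))%E.
  have [mF F0] : measurable_fun setT F /\ forall x, (0 <= F x)%E by exact: mF0.
  rewrite !hE// -/F -(stdnormal_opp mF F0).
  apply: eq_integral => x _; rewrite /F -(opp (fun v => f (phi (- x, v))))//.
  apply: eq_integral => v _; congr f.
  apply: eq_from_tnth => j; rewrite tnth_mktuple !mxE.
  case: (unliftP ord0 j) => [i ->|->]; last by rewrite /phi /= !tnth0.
  by rewrite /phi /= !tnthS tnth_mktuple !mxE.
- move=> y; have s0 := dotv_ge0 (\row_j y 0 (lift ord0 j)).
  rewrite (mom y 2 (fun x => 2 * (y 0 0 ^+ 2 * x ^+ 2)) (fun=> 2) (fun=> 0)
    (dotv (\row_j y 0 (lift ord0 j)) (\row_j y 0 (lift ord0 j))) (y 0 0 ^+ 2) 0)//=.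
  + by congr EFin; rewrite [RHS]dotv_recl mul0r mulr1 addr0 addrC expr2.
  + by move=> x; have := mulr_ge0 (sqr_ge0 (y 0 0)) (sqr_ge0 x); lra.
  + exact: sqr_ge0.
  + by move=> x s; ring.
  + by move=> x; ring.
- move=> y; have s0 := dotv_ge0 (\row_j y 0 (lift ord0 j)).
  rewrite (mom y 4 (fun x => 2 * (y 0 0 ^+ 4 * x ^+ 4)) (fun x => 12 * (y 0 0 ^+ 2 * x ^+ 2))
    (fun=> 2) (3 * dotv (\row_j y 0 (lift ord0 j)) (\row_j y 0 (lift ord0 j)) ^+ 2)
    (6 * y 0 0 ^+ 2 * dotv (\row_j y 0 (lift ord0 j)) (\row_j y 0 (lift ord0 j)))
    (y 0 0 ^+ 4))//=.
  + congr EFin; rewrite [dotv y y]dotv_recl; move: (dotv _ _) (y 0 0) => D x.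
    by ring.
  + by move=> x; have := mulr_ge0 (X4ge0 (y 0 0)) (X4ge0 x); lra.
  + by move=> x; have := mulr_ge0 (sqr_ge0 (y 0 0)) (sqr_ge0 x); lra.
  + by rewrite mulr_ge0// sqr_ge0.
  + by have := mulr_ge0 (sqr_ge0 (y 0 0)) s0; lra.
  + by move=> x s; ring.
  + by move=> x; ring.
Qed.

(** * The influence function psi *)

(** The quadratic truncation of the exponential, whose logarithm dominates psi. *)
Notation cat_exp u := (1 + u + u ^+ 2 / 2).

Lemma cat_exp_gt0 (R : realType) (u : R) : 0 < cat_exp u.
Proof. nra. Qed.

Lemma psi0 (R : realType) : psi (0 : R) = 0.
Proof. by rewrite /psi lexx ler10 subr0 expr0n mul0r addr0 ln1 oppr0. Qed.

Lemma psi_opp (R : realType) (u : R) : psi (- u) = - psi u.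
Proof.
have [u0|u0|->] := ltrgtP u 0; last by rewrite oppr0 psi0 oppr0.
  by rewrite /psi /= oppr_ge0 (ltW u0) (lt_geF u0) !opprK.
by rewrite /psi /= oppr_ge0 (ltW u0) (lt_geF u0) !opprK.
Qed.

Lemma psi_ge0E (R : realType) (u : R) : 0 <= u ->
  psi u = if 1 <= u then ln 2 else - ln (1 - u + u ^+ 2 / 2).
Proof. by rewrite /psi => ->. Qed.

Lemma psi_le_ln2 (R : realType) (u : R) : psi u <= ln 2.
Proof.
have l2 : 0 <= ln (2 : R) by rewrite ln_ge0// ler1n.
rewrite /psi; case: ifPn => u0; last rewrite -ltNge in u0.
  case: ifPn => // u1; rewrite -ltNge in u1.
  rewrite lerNl -lnV ?posrE// ler_ln ?posrE//; nra.
apply: le_trans l2; rewrite oppr_le0; case: ifPn => [_|u1]; first by rewrite ln_ge0// ler1n.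
rewrite -ltNge in u1; rewrite oppr_ge0 ln_le0//; nra.
Qed.

Lemma psi_le_ln_exp (R : realType) (u : R) : psi u <= ln (cat_exp u).
Proof.
rewrite /psi; case: ifPn => u0; last rewrite -ltNge in u0.
  case: ifPn => u1; first by rewrite ler_ln ?posrE//; nra.
  rewrite -ltNge in u1.
  rewrite -lnV ?posrE; last nra.
  rewrite ler_ln ?posrE ?invr_gt0//; [|nra..].
  rewrite -[_^-1]mul1r ler_pdivrMr; nra.
case: ifPn => u1.
  by rewrite -lnV ?posrE// ler_ln ?posrE//; nra.
by rewrite opprK opprK sqrrN.
Qed.

Lemma psi_nondecreasing (R : realType) (u v : R) : u <= v -> psi u <= psi v.
Proof.
have pos (x y : R) : 0 <= x -> x <= y -> psi x <= psi y.
  move=> x0 xy; rewrite psi_ge0E//.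
  have y0 := le_trans x0 xy; rewrite psi_ge0E//.
  case: ifPn => x1; case: ifPn => y1 //.
  - by rewrite (le_trans x1 xy) in y1.
  - have := psi_le_ln2 x; by rewrite psi_ge0E// (negbTE x1).
  rewrite -!ltNge in x1 y1.
  rewrite lerN2 ler_ln ?posrE; nra.
have p0 (x : R) : 0 <= x -> 0 <= psi x.
  move=> x0; have := pos 0 x (lexx _) x0; apply: le_trans.
  by rewrite psi0.
move=> uv; have [u0|u0] := leP 0 u; first exact: pos.
have [v0|v0] := leP 0 v.
  apply: le_trans (p0 _ v0).
  by rewrite -[u]opprK psi_opp oppr_le0 p0// oppr_ge0 ltW.
rewrite -[u]opprK -[v]opprK !(psi_opp (- _)) lerN2 pos//.
  by rewrite oppr_ge0 ltW.
by rewrite lerN2.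
Qed.

(** The second derivative of ln (1 + x + x^2 / 2) is at least -1/2, so adding x^2 / 4
    makes this function convex, hence above its tangents. *)
Lemma ln_exp_tangent (R : realType) (u z : R) :
  ln (cat_exp u) + (1 + u) / cat_exp u * (z - u) - (z - u) ^+ 2 / 4
    <= ln (cat_exp z).
Proof.
pose f (x : R) := ln (cat_exp x) + x ^+ 2 / 4.
pose df (x : R) := (1 + x) / cat_exp x + x / 2.
have dfE (x : R) : is_derive x 1 f (df x).
  have e0 := cat_exp_gt0 x.
  have d1 : is_derive x 1 (fun x : R => cat_exp x) (1 + x).
    by apply: is_derive_eq; rewrite /GRing.scale /=; field.
  have d2 := is_derive1_ln e0.
  have d3 := @is_derive1_comp _ (@ln R) (fun x : R => cat_exp x) x _ _ d2 d1.
  have d4 : is_derive x 1 (fun x : R => x ^+ 2 / 4) (x / 2).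
    by apply: is_derive_eq; rewrite /GRing.scale /=; field.
  have := is_deriveD d3 d4.
  by rewrite /df /f [in X in is_derive _ _ _ X](mulrC _^-1).
have cf (x : R) : f y @[y --> x] --> f x.
  by have /(_ x)/@ex_derive/derivable1_diffP/differentiable_continuous := dfE.
have mono (x y : R) : x <= y -> df x <= df y.
  move=> xy; rewrite -subr_ge0 /df.
  have ex := cat_exp_gt0 x; have ey := cat_exp_gt0 y.
  have -> : (1 + y) / cat_exp y + y / 2 - ((1 + x) / cat_exp x + x / 2) =
    (y - x) * ((4 * (1 - (1 + x) * (1 + y)) +
       (1 + (1 + x) ^+ 2) * (1 + (1 + y) ^+ 2)) / (8 * (cat_exp x * cat_exp y))).
    by field; rewrite !gt_eqF//; nra.
  apply: mulr_ge0; first by rewrite subr_ge0.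
  apply: divr_ge0; last by rewrite mulr_ge0// mulr_ge0 ?ltW.
  set a := 1 + x; set b := 1 + y.
  have -> : 4 * (1 - a * b) + (1 + a ^+ 2) * (1 + b ^+ 2) =
    (a * b - 1) ^+ 2 + (a - b) ^+ 2 + 4 by ring.
  by rewrite addr_ge0// addr_ge0// sqr_ge0.
have key : f u + df u * (z - u) <= f z.
  have [zu|uz|<-] := ltgtP z u; last by rewrite subrr mulr0 addr0.
  - have [c] := MVT zu (fun x _ => dfE x) (continuous_subspaceT cf).
    rewrite in_itv/= => /andP[zc cu] e.
    have := mono _ _ (ltW cu) => h.
    have : df c * (u - z) <= df u * (u - z).
      by rewrite ler_wpM2r// subr_ge0 ltW.
    rewrite -e; lra.
  - have [c] := MVT uz (fun x _ => dfE x) (continuous_subspaceT cf).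
    rewrite in_itv/= => /andP[uc cz] e.
    have := mono _ _ (ltW uc) => h.
    have : df u * (z - u) <= df c * (z - u).
      by rewrite ler_wpM2r// subr_ge0 ltW.
    rewrite -e; lra.
move: key; rewrite /f /df.
set A := ln _; set B := ln _; set p := (1 + u) / cat_exp u.
have -> : (p + u / 2) * (z - u) = p * (z - u) + u * (z - u) / 2 by field.
move=> h; nra.
Qed.

Lemma expR1_lt4 (R : realType) : expR 1 <= (4 : R).
Proof.
have h : expR (1 / 2 : R) <= 2.
  have := expR_ge1Dx (- (1 / 2) : R); rewrite expRN.
  have e0 := expR_gt0 (1 / 2 : R); set e := expR _ in e0 *.
  rewrite -(ler_pM2r e0) mulVf ?gt_eqF//; lra.
rewrite (_ : 1 = 1 / 2 + 1 / 2 :> R); last by field.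
by rewrite expRD; have := expR_gt0 (1 / 2 : R); nra.
Qed.

Lemma ln2_le1 (R : realType) : ln 2 <= (1 : R).
Proof. by have := @le_ln1Dx R 1; rewrite -[1 + 1]/(2 : R) => -> //; lra. Qed.

(** By convexity exp (2 q) <= 1 + (e^2 - 1) q on [0, 1], and e^2 <= 16. *)
Lemma ln1D15_ge (R : realType) (q : R) : 0 <= q <= 1 -> 2 * q <= ln (1 + 15 * q).
Proof.
move=> /andP[q0 q1].
rewrite -[2 * q]expRK ler_ln ?posrE ?expR_gt0//; last lra.
have qi : (0 <= q) && (q <= 1) by rewrite q0.
have := @convex_expR R (Itv01 q0 q1) 2 0.
rewrite !convRE /= mulr0 addr0 expR0 mulr1 [q * 2]mulrC /unstable.onem.
move=> h; apply: (le_trans h).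
have e2 : expR (2 : R) <= 16.
  rewrite (_ : 2 = 1 + 1 :> R)// expRD.
  by have := expR1_lt4 R; have := expR_gt0 (1 : R); nra.
nra.
Qed.

(** The left-hand side is the maximum over d of psi u + p d - d^2 / 4, where
    p = (1 + u) / (1 + u + u^2 / 2): the tangent bound of [ln_exp_tangent] with psi u
    in place of the logarithm stays below ln 5. This is what allows a correction
    term inside the logarithm of [smooth_weight]. *)
Lemma psi_cap (R : realType) (u : R) :
  psi u + ((1 + u) / cat_exp u) ^+ 2 <= ln 5.
Proof.
have e0 := cat_exp_gt0 u.
have l5 : ln (5 : R) = ln 2 + ln (5 / 2).
  by rewrite -lnM ?posrE//; congr ln; field.
have l52 : 4 / 5 <= ln (5 / 2 : R).
  rewrite -[4 / 5]expRK ler_ln ?posrE ?expR_gt0//.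
  have -> : 4 / 5 = (8%:R : R) * (1 / 10) by field.
  rewrite expRM_natl.
  have : expR (1 / 10 : R) <= 10 / 9.
    have := expR_ge1Dx (- (1 / 10) : R); rewrite expRN.
    have e1 := expR_gt0 (1 / 10 : R); set e := expR _ in e1 *.
    rewrite -(ler_pM2r e1) mulVf ?gt_eqF//; lra.
  move=> /(lerXn2r 8); rewrite !nnegrE expR_ge0 => /(_ isT) h.
  by apply: le_trans (h _) _; lra.
have p1 : ((1 + u) / cat_exp u) ^+ 2 <= 1.
  rewrite expr_div_n ler_pdivrMr ?exprn_gt0// mul1r -subr_ge0.
  by rewrite (_ : _ - _ = (u * (u + 2) / 2) ^+ 2) ?sqr_ge0//; field.
have l2 : 1 / 2 <= ln (2 : R).
  rewrite -[1 / 2]expRK ler_ln ?posrE ?expR_gt0//.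
  have := expR_ge1Dx (- (1 / 2) : R); rewrite expRN.
  have e1 := expR_gt0 (1 / 2 : R); set e := expR _ in e1 *.
  rewrite -(ler_pM2r e1) mulVf ?gt_eqF//; lra.
have [u0|u0] := ltP u 0.
  have : psi u <= 0 by rewrite -(@psi0 R); apply: psi_nondecreasing; exact: ltW.
  lra.
have [u1|u1] := leP 1 u.
  have : ((1 + u) / cat_exp u) ^+ 2 <= 4 / 5.
    rewrite expr_div_n ler_pdivrMr ?exprn_gt0//; nra.
  have := psi_le_ln2 u; lra.
rewrite psi_ge0E// (lt_geF u1).
set y := 1 - u + u ^+ 2 / 2.
have y0 : 0 < y by rewrite /y; nra.
have hl : - ln y <= ln 2 + (1 / (2 * y) - 1).
  have := @le_ln1Dx R (1 / (2 * y) - 1).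
  rewrite (_ : 1 + _ = 1 / (2 * y)) => [h|]; last by ring.
  have {}h : ln (1 / (2 * y)) <= 1 / (2 * y) - 1.
    apply: h; have h2 : 0 < 1 / (2 * y) by rewrite divr_gt0// mulr_gt0.
    lra.
  rewrite ln_div ?posrE ?mulr_gt0// ln1 sub0r lnM ?posrE// in h; lra.
suff : 1 / (2 * y) + ((1 + u) / cat_exp u) ^+ 2 <= 9 / 5 by lra.
(* On [0, 1] two affine bounds of opposite slope replace the two summands; the
   slope 16/25 is chosen so that both hold. *)
have a1 : 1 / (2 * y) <= 1 / 2 + 16 / 25 * u.
  rewrite ler_pdivrMr ?mulr_gt0// /y.
  have : 0 <= u * (28 / 100 - 78 / 100 * u + 64 / 100 * u ^+ 2).
    rewrite mulr_ge0//; have := sqr_ge0 (u - 39 / 64); lra.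
  lra.
have a2 : ((1 + u) / cat_exp u) ^+ 2 <= 13 / 10 - 16 / 25 * u.
  rewrite expr_div_n ler_pdivrMr ?exprn_gt0//.
  have u2 : 0 <= u ^+ 2 by exact: sqr_ge0.
  have u4 : u ^+ 4 <= u ^+ 2 by rewrite ler_wiXn2l// ltW.
  have u5 : u ^+ 5 <= 1 by rewrite exprn_ile1// ltW.
  have u3 : 0 <= u ^+ 3 by exact: exprn_ge0.
  lra.
lra.
Qed.

(** * Gaussian smoothing of psi *)

(** The score sg * lam * (m^2 - 1) at a perturbed point w = m + s, where s is
    Gaussian with variance [s2]; subtracting [s2] makes its mean equal to the
    unperturbed score. *)
Definition centred_score (R : realType) (sg lam s2 w : R) : R :=
  sg * lam * (w ^+ 2 - s2 - 1).

(** At w = m this is the average over the perturbation of the quadratic loss in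
    [ln_exp_tangent]. *)
Definition excess (R : realType) (lam s2 w : R) : R :=
  lam ^+ 2 * s2 * (w ^+ 2 + s2 / 2).

(** The factor 75/2 is 5 times 15/2: where the bound on the first summand is at
    most 5, the second contributes at least a factor 1 + (15/2) excess, and a pair of
    symmetric points yields the factor 1 + 15 excess that [ln1D15_ge] turns into
    2 excess. *)
Definition smooth_weight (R : realType) (sg lam s2 w : R) : R :=
  cat_exp (centred_score sg lam s2 w) + 75 / 2 * excess lam s2 w.

Lemma excess_ge0 (R : realType) (lam s2 w : R) : 0 <= s2 -> 0 <= excess lam s2 w.
Proof.
move=> s0; have h1 := sqr_ge0 lam; have h2 := sqr_ge0 w.
by apply: mulr_ge0; [exact: mulr_ge0 | lra].
Qed.

Lemma cat_exp_ge (R : realType) (u : R) : 1 / 2 <= cat_exp u.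
Proof. have := sqr_ge0 (1 + u); lra. Qed.

Lemma smooth_weight_ge (R : realType) (sg lam s2 w : R) : 0 <= s2 ->
  1 / 2 <= smooth_weight sg lam s2 w.
Proof.
by move=> /(excess_ge0 lam w); have := cat_exp_ge (centred_score sg lam s2 w);
  rewrite /smooth_weight; lra.
Qed.

Lemma measurable_smooth_weight (R : realType) d (T : measurableType d)
    (sg lam : R) (f g : T -> R) :
  measurable_fun setT f -> measurable_fun setT g ->
  measurable_fun setT (fun x => smooth_weight sg lam (f x) (g x)).
Proof.
move=> mf mg.
have mz : measurable_fun setT (fun x => centred_score sg lam (f x) (g x)).
  apply: measurable_funM => //; apply: measurable_funB => //.
  by apply: measurable_funB => //; exact: measurable_funX.
rewrite /smooth_weight; apply: measurable_funD.
  apply: measurable_funD; first exact: measurable_funD.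
  by apply: measurable_funM => //; exact: measurable_funX.
apply: measurable_funM => //; apply: measurable_funM; first exact: measurable_funM.
apply: measurable_funD; first exact: measurable_funX.
exact: measurable_funM.
Qed.

Lemma ln_smooth_weight_ge (R : realType) (sg lam s2 w c : R) : 0 <= s2 ->
  c <= ln (cat_exp (centred_score sg lam s2 w)) -> c <= ln 5 ->
  c + ln (1 + 15 / 2 * excess lam s2 w) <= ln (smooth_weight sg lam s2 w).
Proof.
move=> s0 c1 c2; have e0 := excess_ge0 lam w s0.
have z0 := cat_exp_gt0 (centred_score sg lam s2 w).
have w0 := smooth_weight_ge sg lam w s0.
rewrite -[c]expRK -lnM ?posrE ?expR_gt0//; last lra.
rewrite ler_ln ?posrE; last 2 first.
- by rewrite mulr_gt0 ?expR_gt0//; lra.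
- lra.
have h1 : expR c <= cat_exp (centred_score sg lam s2 w).
  by rewrite -[leRHS]lnK ?posrE// ler_expR.
have h2 : expR c <= 5 by rewrite -[leRHS]lnK ?posrE// ler_expR.
rewrite /smooth_weight mulrDr mulr1 lerD// mulrA ler_wpM2r//; lra.
Qed.

Lemma ln_excess_pair (R : realType) (lam s2 m t : R) : 0 <= s2 ->
  ln (1 + 15 * excess lam s2 m) <=
  ln (1 + 15 / 2 * excess lam s2 (m + t)) + ln (1 + 15 / 2 * excess lam s2 (m - t)).
Proof.
move=> s0.
have e1 := excess_ge0 lam (m + t) s0; have e2 := excess_ge0 lam (m - t) s0.
have e3 := excess_ge0 lam m s0.
rewrite -lnM ?posrE; [|lra..].
rewrite ler_ln ?posrE; [|lra|rewrite mulr_gt0//; lra].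
have : 2 * excess lam s2 m <= excess lam s2 (m + t) + excess lam s2 (m - t).
  rewrite -subr_ge0 /excess.
  rewrite (_ : _ - _ = 2 * (lam ^+ 2 * s2 * t ^+ 2)); last by ring.
  have h1 := sqr_ge0 lam; have h2 := sqr_ge0 t.
  by apply: mulr_ge0 => //; apply: mulr_ge0 => //; exact: mulr_ge0.
have := mulr_ge0 e1 e2; lra.
Qed.

Section PairBounds.
Context (R : realType) (sg lam s2 m t : R) (s0 : 0 <= s2).
Let F w := ln (smooth_weight sg lam s2 w).
Let u := sg * lam * (m ^+ 2 - 1).

(** The crude bound, for perturbations so large that the tangent bound is too weak:
    the quadratic polynomial is at least 1/2. *)
Lemma ln_smooth_pair_ge :
  - (2 * ln 2) + ln (1 + 15 * excess lam s2 m) <= F (m + t) + F (m - t).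
Proof.
have b w : - ln 2 + ln (1 + 15 / 2 * excess lam s2 w) <= F w.
  apply: ln_smooth_weight_ge => //.
    rewrite -lnV ?posrE// ler_ln ?posrE ?invr_gt0 ?cat_exp_gt0//.
    by have := cat_exp_ge (centred_score sg lam s2 w); lra.
  have : 0 <= ln (2 : R) by rewrite ln_ge0// ler1n.
  have : 0 <= ln (5 : R) by rewrite ln_ge0// ler1n.
  lra.
have := b (m + t); have := b (m - t); have := ln_excess_pair lam m t s0; lra.
Qed.

(** [ln_exp_tangent] at the two points; the terms that are odd in t cancel in the
    sum, and the last logarithm is there to compensate the loss of the quadratic term. *)
Lemma ln_smooth_pair_tangent :
  2 * psi u + (1 + u) / cat_exp u * (2 * (sg * lam) * (t ^+ 2 - s2))
   - (sg * lam) ^+ 2 * (8 * m ^+ 2 * t ^+ 2 + 2 * (t ^+ 2 - s2) ^+ 2) / 4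
   + ln (1 + 15 * excess lam s2 m) <= F (m + t) + F (m - t).
Proof.
set p := (1 + u) / cat_exp u.
have b w : psi u + p * (centred_score sg lam s2 w - u)
    - (centred_score sg lam s2 w - u) ^+ 2 / 4
    + ln (1 + 15 / 2 * excess lam s2 w) <= F w.
  apply: ln_smooth_weight_ge => //.
    by have := ln_exp_tangent u (centred_score sg lam s2 w);
      have := psi_le_ln_exp u; rewrite -/p; lra.
  have := psi_cap u; rewrite -/p; set d := _ - u.
  have := sqr_ge0 (p - d / 2); lra.
have := b (m + t); have := b (m - t); have := ln_excess_pair lam m t s0.
rewrite /centred_score.
have -> : sg * lam * ((m + t) ^+ 2 - s2 - 1) - u =
  sg * lam * (2 * m * t + t ^+ 2 - s2) by rewrite /u; ring.
have -> : sg * lam * ((m - t) ^+ 2 - s2 - 1) - u =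
  sg * lam * (- (2 * m * t) + t ^+ 2 - s2) by rewrite /u; ring.
lra.
Qed.

End PairBounds.

Section GaussianSmoothing.
Context (R : realType) (r : nat) (g : probability (r.-tuple R) R)
  (gg : standard_gaussian g) (y : 'rV[R]_r).
Let S (v : r.-tuple R) : R := dotv y (row_of_tuple v).
Let s2 := dotv y y.
Let s20 : 0 <= s2 := dotv_ge0 y.

Lemma measurable_gaussian_dot : measurable_fun setT S.
Proof. by apply: measurable_dotv => // j; exact: measurable_row_of_tuple. Qed.
Let mS := measurable_gaussian_dot.

Let iS2 : g.-integrable setT (fun v => (S v ^+ 2)%:E).
Proof.
have [_ _ m2 _] := gg.
apply/integrableP; split; first exact/measurable_EFinP/measurable_funX.
under eq_integral do rewrite gee0_abs ?lee_fin ?sqr_ge0//.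
by rewrite m2 ltry.
Qed.

Let iS4 : g.-integrable setT (fun v => (S v ^+ 4)%:E).
Proof.
have [_ _ _ m4] := gg.
apply/integrableP; split; first exact/measurable_EFinP/measurable_funX.
under eq_integral do rewrite gee0_abs ?lee_fin ?exprn_even_ge0//.
by rewrite m4 ltry.
Qed.

Lemma gaussian_even_poly a b c :
  g.-integrable setT (fun v => (a + b * S v ^+ 2 + c * S v ^+ 4)%:E) /\
  (\int[g]_v (a + b * S v ^+ 2 + c * S v ^+ 4)%:E = (a + b * s2 + c * (3 * s2 ^+ 2))%:E)%E.
Proof.
have [_ _ m2 m4] := gg.
have ic : g.-integrable setT (fun=> a%:E) by exact: finite_measure_integrable_cst.
have ib : g.-integrable setT (fun v => (b%:E * (S v ^+ 2)%:E)%E) by exact: integrableZl.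
have id' : g.-integrable setT (fun v => (c%:E * (S v ^+ 4)%:E)%E) by exact: integrableZl.
have -> : (fun v => (a + b * S v ^+ 2 + c * S v ^+ 4)%:E) =
  ((cst a%:E \+ (fun v => b%:E * (S v ^+ 2)%:E)) \+ (fun v => c%:E * (S v ^+ 4)%:E))%E.
  by apply/funext => v; rewrite /= !EFinD !EFinM.
have i2 := integrableD measurableT ic ib.
split; first exact: integrableD.
rewrite integralD// integralD// integral_cst_prob !integralZl//.
by rewrite m2 m4 -!EFinM -!EFinD.
Qed.

(** [integral_even_part] when the even part is a polynomial of degree four in one
    linear form. *)
Lemma gaussian_even_part (f : r.-tuple R -> R) a b c :
  measurable_fun setT f -> (forall v, 0 <= f v) ->
  (forall v, f v + f (tuple_of_row (- row_of_tuple v)) =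
     2 * (a + b * S v ^+ 2 + c * S v ^+ 4)) ->
  (\int[g]_v (f v)%:E = (a + b * s2 + c * (3 * s2 ^+ 2))%:E)%E.
Proof.
move=> mf f0 fE; have [_ opp _ _] := gg.
have mfE : measurable_fun setT (EFin \o f) by exact/measurable_EFinP.
have fo := opp _ mfE (fun v => f0 v).
have mfo : measurable_fun setT (fun v => (f (tuple_of_row (- row_of_tuple v)))%:E).
  apply: measurableT_comp mfE _; apply/measurable_fun_tuple_of_row => j.
  under eq_fun do rewrite mxE.
  by apply: measurableT_comp => //; exact: measurable_row_of_tuple.
have [_ pE] := gaussian_even_poly (2 * a) (2 * b) (2 * c).
apply: (integral_even_part (G := fun v => a + b * S v ^+ 2 + c * S v ^+ 4) mfE mfo _ fo).
- by move=> v; rewrite lee_fin.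
- by move=> v; rewrite /= -EFinD fE.
rewrite (_ : 2 * _ = 2 * a + 2 * b * s2 + 2 * c * (3 * s2 ^+ 2)); last by ring.
by rewrite -pE; apply: eq_integral => v _; congr EFin; ring.
Qed.

Context (sg lam m : R) (sg2 : sg ^+ 2 = 1).
Let F v := smooth_weight sg lam s2 (m + S v).
Let u := sg * lam * (m ^+ 2 - 1).

Lemma measurable_smooth_gaussian : measurable_fun setT F.
Proof.
by apply: measurable_smooth_weight => //; exact: measurable_funD.
Qed.

Lemma integral_smooth_weight :
  (\int[g]_v (F v)%:E = (1 + u + lam ^+ 2 * (m ^+ 2 - 1) ^+ 2 / 2 +
      79 / 2 * (lam ^+ 2 * (m ^+ 2 * s2)) + 229 / 4 * (lam ^+ 2 * s2 ^+ 2))%:E)%E.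
Proof.
have dN v : S (tuple_of_row (- row_of_tuple v)) = - S v.
  by rewrite /S tuple_of_rowK dotvNr.
rewrite (gaussian_even_part (a := 1 + sg * lam * (m ^+ 2 - s2 - 1)
     + lam ^+ 2 * (m ^+ 2 - s2 - 1) ^+ 2 / 2
     + 75 / 2 * (lam ^+ 2 * s2 * (m ^+ 2 + s2 / 2)))
   (b := sg * lam + lam ^+ 2 * (3 * m ^+ 2 - s2 - 1) + 75 / 2 * (lam ^+ 2 * s2))
   (c := lam ^+ 2 / 2)).
- by congr EFin; rewrite /u; field.
- exact: measurable_smooth_gaussian.
- by move=> v; apply: le_trans (smooth_weight_ge _ _ _ s20); rewrite divr_ge0.
- move=> v; rewrite /F dN /smooth_weight /excess /centred_score.
  by rewrite !exprMn sg2; field.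
Qed.

Lemma integrable_smooth_weight : g.-integrable setT (EFin \o F).
Proof.
have F0 v : 0 <= F v.
  by apply: le_trans (smooth_weight_ge _ _ _ s20); rewrite divr_ge0.
apply/integrableP; split.
  by apply/measurable_EFinP; exact: measurable_smooth_gaussian.
under eq_integral do rewrite gee0_abs ?lee_fin//.
by rewrite integral_smooth_weight ltry.
Qed.

Lemma integrable_ln_smooth_weight : g.-integrable setT (EFin \o (@ln R \o F)).
Proof.
have i1 := integrable_smooth_weight.
have i2 : g.-integrable setT (fun=> (1 : R)%:E) by exact: finite_measure_integrable_cst.
apply: le_integrable (integrableD measurableT i1 i2) => //.
  apply/measurable_EFinP; apply: measurableT_comp; first exact: measurable_ln.
  exact: measurable_smooth_gaussian.
move=> v _ /=.
have F0 := smooth_weight_ge sg lam (m + S v) s20; rewrite -/(F v) in F0.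
rewrite lee_fin [leRHS]ger0_norm; last lra.
rewrite ler_norml; apply/andP; split.
  have : - 1 <= ln (F v); last lra.
  apply: (@le_trans _ _ (- ln 2)); first by rewrite lerN2 ln2_le1.
  rewrite -lnV ?posrE// ler_ln ?posrE ?invr_gt0//; lra.
have := @le_ln1Dx R (F v - 1); rewrite (_ : 1 + _ = F v); last by ring.
by move=> h; have : ln (F v) <= F v - 1; [apply: h; lra | lra].
Qed.

(** After symmetrization one integrates the pair bounds, which are even polynomials
    in the perturbation. If the excess is at most 1 the tangent bound applies, and
    its loss 2 excess is recovered by [ln1D15_ge]; if it exceeds 1, then
    1 + 15 excess >= 2^4 makes the crude bound reach ln 2 >= psi. *)
Lemma psi_le_integral_ln : psi u <= \int[g]_v ln (F v).
Proof.
have [_ opp _ _] := gg.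
have iL := integrable_ln_smooth_weight.
have mL : measurable_fun setT (@ln R \o F) by have /measurable_int/measurable_EFinP := iL.
have dN v : S (tuple_of_row (- row_of_tuple v)) = - S v.
  by rewrite /S tuple_of_rowK dotvNr.
pose f v := ln (F v) + ln 2.
have f0 v : 0 <= f v.
  have F0 := smooth_weight_ge sg lam (m + S v) s20; rewrite -/(F v) in F0.
  rewrite /f -lnM ?posrE//; last lra.
  apply: ln_ge0; lra.
have mfE : measurable_fun setT (fun v => (f v)%:E).
  by apply/measurable_EFinP; apply: measurable_funD.
have fo := opp _ mfE f0.
have mN : measurable_fun setT (fun v : r.-tuple R => tuple_of_row (- row_of_tuple v)).
  apply/measurable_fun_tuple_of_row => j.
  under eq_fun do rewrite mxE.
  by apply: measurableT_comp => //; exact: measurable_row_of_tuple.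
have i2 : g.-integrable setT (fun=> (ln (2 : R))%:E) by exact: finite_measure_integrable_cst.
have ifE : g.-integrable setT (fun v => (f v)%:E) by exact: (integrableD measurableT iL i2).
have ifo : g.-integrable setT (fun v => (f (tuple_of_row (- row_of_tuple v)))%:E).
  apply/integrableP; split; first exact: (measurableT_comp mfE mN).
  under eq_integral do rewrite gee0_abs ?lee_fin//.
  rewrite fo.
  move/integrableP : ifE => [_].
  by under eq_integral do rewrite gee0_abs ?lee_fin//.
have key a b c : (forall v, a + b * S v ^+ 2 + c * S v ^+ 4 <=
     ln (smooth_weight sg lam s2 (m + S v)) + ln (smooth_weight sg lam s2 (m - S v))) ->
   a + b * s2 + c * (3 * s2 ^+ 2) <= 2 * \int[g]_v ln (F v).
  move=> h.
  have [ip pE] := gaussian_even_poly (a + 2 * ln 2) b c.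
  have le : (\int[g]_v (a + 2 * ln 2 + b * S v ^+ 2 + c * S v ^+ 4)%:E <=
     \int[g]_v ((f v)%:E + (f (tuple_of_row (- row_of_tuple v)))%:E))%E.
    apply: le_integral => //; first exact: integrableD.
    move=> v _; rewrite -EFinD lee_fin /f /F dN; have := h v; lra.
  rewrite pE integralD// fo in le.
  have iE : (\int[g]_v (f v)%:E = (\int[g]_v ln (F v) + ln 2)%:E)%E.
    rewrite /f; under eq_integral do rewrite EFinD.
    rewrite integralD// integral_cst_prob EFinD; congr (_ + _)%E.
    by rewrite /Rintegral fineK//; exact: integrable_fin_num.
  rewrite iE -EFinD lee_fin in le; lra.
set q := excess lam s2 m.
have q0 : 0 <= q by exact: excess_ge0.
have [q1|q1] := leP q 1.
  have lq : 2 * q <= ln (1 + 15 * q) by apply: ln1D15_ge; rewrite q0.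
  set p := (1 + u) / cat_exp u.
  have := key (2 * psi u - 2 * p * (sg * lam) * s2 - lam ^+ 2 * s2 ^+ 2 / 2 + 2 * q)
    (2 * p * (sg * lam) - lam ^+ 2 * (2 * m ^+ 2 - s2)) (- (lam ^+ 2 / 2)).
  have e1 : lam ^+ 2 = (sg * lam) ^+ 2 by rewrite exprMn sg2 mul1r.
  move=> /(_ _) h.
  have : 2 * psi u <= 2 * \int[g]_v ln (F v); last lra.
  apply: le_trans (h _).
    by rewrite /q /excess le_eqVlt; apply/orP; left; apply/eqP; field.
  move=> v; apply: le_trans (ln_smooth_pair_tangent sg lam m (S v) s20).
  rewrite -/u -/p -/q e1 -subr_ge0; move: lq; rewrite -subr_ge0 => lq.
  by apply: le_trans lq _; rewrite le_eqVlt; apply/orP; left; apply/eqP; field.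
have lq : 4 * ln 2 <= ln (1 + 15 * q).
  rewrite (_ : 4 * ln 2 = ln (2 ^+ 4)); last by rewrite lnXn//; ring.
  rewrite ler_ln ?posrE//; lra.
have := key (2 * ln 2) 0 0.
rewrite !mul0r !addr0 => h.
have := psi_le_ln2 u.
have : 2 * ln 2 <= 2 * \int[g]_v ln (F v); last lra.
apply: h => v; rewrite !mul0r !addr0.
by have := ln_smooth_pair_ge sg lam m (S v) s20; rewrite -/q; lra.
Qed.

End GaussianSmoothing.

(** * Independence and equality in law *)

Lemma integral_indic_preimage (R : realType) d d' (T : measurableType d)
    (V : measurableType d') (m : {measure set T -> \bar R}) (Y : T -> V) A :
  measurable_fun setT Y -> measurable A ->
  (\int[m]_w (\1_A (Y w))%:E = m (Y @^-1` A))%E.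
Proof.
move=> mY mA; have mYA : measurable (Y @^-1` A).
  by rewrite -[_ @^-1` _]setTI; exact: mY.
transitivity (\int[m]_w (\1_(Y @^-1` A) w)%:E)%E => //.
by rewrite integral_indic// setIT.
Qed.

Section IndependentProduct.
Context (R : realType) d d' (T : measurableType d) (V : measurableType d')
  (P : probability T R) (n : nat) (Y : 'I_n -> T -> V).
Hypothesis mY : forall i, measurable_fun setT (Y i).
Hypothesis indepY : forall B : 'I_n -> set V, (forall i, measurable (B i)) ->
  P (\bigcap_(i in [set: 'I_n]) (Y i @^-1` B i)) =
  (\prod_(i < n) P (Y i @^-1` B i))%E.

Let measurable_prodY (f : 'I_n -> V -> R) (Q : pred 'I_n) :
  (forall i, measurable_fun setT (f i)) ->
  measurable_fun setT (fun w => \prod_(i < n | Q i) f i (Y i w)).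
Proof.
move=> mf; under eq_fun do rewrite big_mkcond /=.
apply: measurable_prod => i _; case: (Q i) => //.
exact: measurableT_comp.
Qed.

(** Induction on the number of factors that are not yet indicators: for indicators
    this is the product rule, and [eq_weighted_integral] replaces one indicator by a
    nonnegative function, the other factors being the weight. *)
Lemma integral_prod_independent (f : 'I_n -> V -> R) (e : 'I_n -> R) :
  (forall i, measurable_fun setT (f i)) -> (forall i x, 0 <= f i x) ->
  (forall i, (\int[P]_w (f i (Y i w))%:E = (e i)%:E)%E) ->
  (\int[P]_w (\prod_(i < n) f i (Y i w))%:E = (\prod_(i < n) e i)%:E)%E.
Proof.
have mpre i B : measurable B -> measurable (Y i @^-1` B).
  by move=> mB; rewrite -[_ @^-1` _]setTI; exact: mY.
suff main k : (k <= n)%N -> forall (f : 'I_n -> V -> R) (e : 'I_n -> R), (forall i, measurable_fun setT (f i)) ->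
    (forall i x, 0 <= f i x) ->
    (forall i : 'I_n, (k <= i)%N -> exists2 B, measurable B & f i = \1_B) ->
    (forall i, (\int[P]_w (f i (Y i w))%:E = (e i)%:E)%E) ->
  (\int[P]_w (\prod_(i < n) f i (Y i w))%:E = (\prod_(i < n) e i)%:E)%E.
  move=> mf f0 fe; apply: (main n) => // i.
  by rewrite leqNgt ltn_ord.
elim: k => [|k ih] kn {}f {}e mf f0 find fe.
  have /choice[B HB] : forall i, exists B, measurable B /\ f i = \1_B.
    by move=> i; have [B mB ->] := find i (leq0n _); exists B.
  have mB i : measurable (B i) by have [] := HB i.
  have eE i : (e i)%:E = P (Y i @^-1` B i).
    by rewrite -fe (proj2 (HB i)) integral_indic_preimage.
  transitivity (\int[P]_w (\1_(\bigcap_(i in [set: 'I_n]) (Y i @^-1` B i)) w)%:E)%E.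
    apply: eq_integral => w _; congr EFin.
    have [all|] := pselect (forall i, B i (Y i w)).
      rewrite indicE mem_set; last by move=> i _; exact: all.
      by rewrite big1// => i _; rewrite (proj2 (HB i)) indicE mem_set.
    move=> /existsNP[i Ni].
    rewrite indicE memNset; last by move=> /(_ i I).
    by rewrite (bigD1 i)//= (proj2 (HB i)) indicE memNset// mul0r.
  transitivity (P (\bigcap_(i in [set: 'I_n]) (Y i @^-1` B i))).
    rewrite integral_indic//; first by rewrite setIT.
    by apply: fin_bigcap_measurable => // i _; exact: mpre.
  by rewrite indepY// -prodEFin; apply: eq_bigr => i _; exact/esym/eE.
pose ik := Ordinal kn.
pose c := \prod_(i < n | i != ik) e i.
have e0 i : 0 <= e i.
  by rewrite -lee_fin -fe; apply: integral_ge0 => w _; rewrite lee_fin.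
have c0 : 0 <= c by apply: prodr_ge0.
have step : (\int[P]_w ((f ik (Y ik w))%:E * (\prod_(i < n | i != ik) f i (Y i w))%:E)
   = \int[P]_w ((f ik (Y ik w))%:E * c%:E))%E.
  apply: (@eq_weighted_integral R _ _ _ V T T P P (Y ik) (Y ik)
    (fun w => \prod_(i < n | i != ik) f i (Y i w)) (cst c) _ _ _ _ _ _ _ (EFin \o f ik)) => //.
  - exact: measurable_prodY.
  - by move=> w; apply: prodr_ge0.
  - move=> A mA.
    pose f' i := if i == ik then \1_A else f i.
    pose e' i := if i == ik then fine (P (Y ik @^-1` A)) else e i.
    have PA : (\int[P]_w (\1_A (Y ik w))%:E = (fine (P (Y ik @^-1` A)))%:E)%E.
      rewrite fineK ?fin_num_measure//; last exact: mpre.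
      exact: integral_indic_preimage.
    have nk i : i != ik -> f' i = f i /\ e' i = e i.
      by move=> /negbTE h; rewrite /f' /e' h.
    have eE : \prod_(i < n) e' i = fine (P (Y ik @^-1` A)) * c.
      rewrite (bigD1 ik)//= {1}/e' eqxx; congr (_ * _).
      by apply: eq_bigr => i /nk[].
    have fE w : \prod_(i < n) f' i (Y i w) =
        \1_A (Y ik w) * \prod_(i < n | i != ik) f i (Y i w).
      rewrite (bigD1 ik)//= {1}/f' eqxx; congr (_ * _).
      by apply: eq_bigr => i /nk[-> _].
    transitivity (\int[P]_w (\prod_(i < n) f' i (Y i w))%:E)%E.
      by apply: eq_integral => w _; rewrite fE.
    rewrite (ih (ltnW kn) f' e') ?eE.
    + rewrite EFinM muleC -PA -ge0_integralZl_EFin//.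
      * by apply: eq_integral => w _; rewrite EFinM muleC.
      * apply/measurable_EFinP.
        exact: (measurableT_comp (measurable_indic (D := setT) mA) (mY _)).
    + by move=> i; rewrite /f'; case: ifP.
    + by move=> i x; rewrite /f'; case: ifP.
    + move=> i; rewrite leq_eqVlt => /predU1P[ki|ki].
        have -> : i = ik by apply: val_inj.
        by exists A; rewrite // /f' eqxx.
      rewrite /f'; case: ifP => [_|_]; last exact: find.
      by exists A.
    + by move=> i; rewrite /f' /e'; case: ifPn => [/eqP ->|_].
  - exact/measurable_EFinP.
  - by move=> x; rewrite lee_fin.
transitivity (\int[P]_w ((f ik (Y ik w))%:E * (\prod_(i < n | i != ik) f i (Y i w))%:E))%E.
  by apply: eq_integral => w _; rewrite (bigD1 ik).
rewrite step (bigD1 ik)//= EFinM -fe -ge0_integralZr//.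
- by apply/measurable_EFinP; exact: measurableT_comp.
- by move=> w _; rewrite lee_fin.
Qed.

End IndependentProduct.

Lemma ge0_integral_same_law (R : realType) d d' (T : measurableType d)
    (V : measurableType d') (P : probability T R) (Y Y' : T -> V) (f : V -> \bar R) :
  measurable_fun setT Y -> measurable_fun setT Y' ->
  (forall B, measurable B -> P (Y @^-1` B) = P (Y' @^-1` B)) ->
  measurable_fun setT f -> (forall x, (0 <= f x)%E) ->
  (\int[P]_w f (Y w) = \int[P]_w f (Y' w))%E.
Proof.
move=> mY mY' law mf f0.
have := @eq_weighted_integral R _ _ _ V T T P P Y Y' (cst 1) (cst 1) mY mY'
  (@measurable_cst _ _ _ _ _ _) (@measurable_cst _ _ _ _ _ _)
  (fun=> ler01) (fun=> ler01) _ f mf f0.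
have e Z : (\int[P]_w f (Z w) = \int[P]_x (f (Z x) * (cst (1 : R) x)%:E))%E.
  by apply: eq_integral => w _; rewrite mule1.
rewrite !e; apply=> A mA.
have e1 Z : measurable_fun setT Z ->
    (\int[P]_x (\1_A (Z x) * cst 1 x)%:E = P (Z @^-1` A))%E.
  move=> mZ; under eq_integral do rewrite mulr1.
  exact: integral_indic_preimage.
by rewrite !e1// law.
Qed.

(** * Second and fourth moments *)

(** Convexity of the square with weights p / (p + q) and q / (p + q). *)
Lemma sqr_sum_weighted (R : realFieldType) (a b p q : R) : 0 < p -> 0 < q ->
  (a + b) ^+ 2 <= (p + q) * (a ^+ 2 / p + b ^+ 2 / q).
Proof.
move=> p0 q0; rewrite -subr_ge0.
have -> : (p + q) * (a ^+ 2 / p + b ^+ 2 / q) - (a + b) ^+ 2 = (a * q - b * p) ^+ 2 / (p * q).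
  by field; rewrite !gt_eqF.
by rewrite divr_ge0 ?sqr_ge0// mulr_ge0 ?ltW.
Qed.

Section Moments.
Context (R : realType) (d : measure_display) (T : measurableType d).
Context (P : probability T R).
Implicit Types U V : T -> R.

Lemma momentE k U : moment P k U = (\int[P]_w (U w ^+ k)%:E)%E.
Proof. by rewrite /moment unlock. Qed.

Lemma even_moment_ge0 k U : (0 <= moment P k.*2 U)%E.
Proof.
by rewrite momentE; apply: integral_ge0 => w _; rewrite lee_fin -mul2n exprM exprn_ge0 ?sqr_ge0.
Qed.

Lemma moment_ae_eq k U V : measurable_fun setT U -> measurable_fun setT V ->
  ae_eq P setT U V -> moment P k U = moment P k V.
Proof.
move=> mU mV [A [mA PA sub]]; rewrite !momentE; apply: ae_eq_integral => //.
- exact/measurable_EFinP/measurable_funX.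
- exact/measurable_EFinP/measurable_funX.
- by exists A; split => // w /= h; apply: sub => /= h'; apply: h => _; rewrite h'.
Qed.

Lemma even_moment_eq0 k U : measurable_fun setT U -> moment P k.+1.*2 U = 0%E ->
  ae_eq P setT U (cst 0).
Proof.
move=> mU; rewrite momentE => U0.
have Uk w : 0 <= U w ^+ k.+1.*2 by rewrite -mul2n exprM exprn_ge0 ?sqr_ge0.
have : ae_eq P setT (fun w => (U w ^+ k.+1.*2)%:E) (cst 0%E).
  apply/ae_eq_integral_abs => //; first exact/measurable_EFinP/measurable_funX.
  by under eq_integral do rewrite gee0_abs ?lee_fin//.
move=> [A [mA PA sub]]; exists A; split => // w /= h; apply: sub => /= h'; apply: h => _.
by have [/eqP] := h' I; rewrite expf_eq0 /= => /eqP.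
Qed.

Lemma even_moment0 k U : measurable_fun setT U -> ae_eq P setT U (cst 0) ->
  moment P k.+1 U = 0%E.
Proof.
move=> mU U0; rewrite (@moment_ae_eq _ U (cst 0))// momentE.
by under eq_integral do rewrite expr0n /=; rewrite integral_cst_prob.
Qed.

Lemma momentZ k U a : measurable_fun setT U ->
  moment P k.*2 (fun w => a * U w) = ((a ^+ k.*2)%:E * moment P k.*2 U)%E.
Proof.
move=> mU; have pos x : 0 <= x ^+ k.*2 :> R by rewrite -mul2n exprM exprn_ge0 ?sqr_ge0.
rewrite !momentE; under eq_integral do rewrite exprMn EFinM.
rewrite ge0_integralZl//.
- exact/measurable_EFinP/measurable_funX.
- by move=> w _; rewrite lee_fin.
- by rewrite lee_fin.
Qed.

(** Integrate (U^2 - s)^2 >= 0, arranged so that only nonnegative functions are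
    integrated, as the fourth moment may be infinite. *)
Lemma sqr_moment2_le U s : measurable_fun setT U -> moment P 2 U = s%:E ->
  ((s ^+ 2)%:E <= moment P 4 U)%E.
Proof.
move=> mU; rewrite !momentE => U2.
have s0 : 0 <= s by rewrite -lee_fin -U2; apply: integral_ge0 => w _; rewrite lee_fin sqr_ge0.
have mk k : measurable_fun setT (fun w => (U w ^+ k)%:E).
  exact/measurable_EFinP/measurable_funX.
have : (\int[P]_w ((2 * s)%:E * (U w ^+ 2)%:E) <=
    \int[P]_w ((U w ^+ 4)%:E + (s ^+ 2)%:E))%E.
  apply: ge0_le_integral => //.
  - by move=> w _; rewrite -EFinM lee_fin mulr_ge0 ?sqr_ge0// mulr_ge0.
  - by apply: emeasurable_funM => //; exact: mk.
  - by apply: emeasurable_funD => //; exact: mk.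
  - move=> w _; rewrite -EFinM -EFinD lee_fin -subr_ge0.
    rewrite [leRHS](_ : _ = (U w ^+ 2 - s) ^+ 2); last by ring.
    exact: sqr_ge0.
have sc : (\int[P]_w ((2 * s)%:E * (U w ^+ 2)%:E) = (2 * s)%:E * s%:E)%E.
  rewrite -U2 ge0_integralZl ?lee_fin ?mulr_ge0//.
  by move=> w _; rewrite lee_fin sqr_ge0.
have ad : (\int[P]_w ((U w ^+ 4)%:E + (s ^+ 2)%:E) =
    \int[P]_w (U w ^+ 4)%:E + (s ^+ 2)%:E)%E.
  rewrite -[X in (_ + X)%E](integral_cst_prob P) ge0_integralD//.
  - by move=> w _; rewrite lee_fin exprn_even_ge0.
  - by move=> w _; rewrite lee_fin sqr_ge0.
rewrite sc ad -leeBlDr// -EFinM -EFinB.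
by apply: le_trans; rewrite lee_fin expr2; lra.
Qed.

(** Minkowski's inequality in L^4 followed by Cauchy-Schwarz would give this bound.
    Directly, [sqr_sum_weighted] is applied twice, with weights sqrt k1 and sqrt k2
    and then with weights s and t, which are optimal after integration; they have to
    be positive, so a variable with zero fourth moment is discarded first. *)
Lemma moment4_add U V (s t k1 k2 : R) :
  measurable_fun setT U -> measurable_fun setT V -> 0 <= k1 -> 0 <= k2 ->
  moment P 2 U = s%:E -> moment P 2 V = t%:E ->
  (moment P 4 U <= (k1 * s ^+ 2)%:E)%E -> (moment P 4 V <= (k2 * t ^+ 2)%:E)%E ->
  (moment P 4 (fun w => U w + V w)%R <= (kurt k1 k2 * (s + t) ^+ 2)%:E)%E.
Proof.
move=> mU mV k10 k20 U2 V2 U4 V4.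
have s0 : 0 <= s by rewrite -lee_fin -U2 (even_moment_ge0 1).
have t0 : 0 <= t by rewrite -lee_fin -V2 (even_moment_ge0 1).
set x := Num.sqrt k1; set y := Num.sqrt k2.
have x0 : 0 <= x by exact: sqrtr_ge0.
have y0 : 0 <= y by exact: sqrtr_ge0.
have xk : x ^+ 2 = k1 by rewrite sqr_sqrtr.
have yk : y ^+ 2 = k2 by rewrite sqr_sqrtr.
have mUV : measurable_fun setT (fun w => U w + V w) by exact: measurable_funD.
have [U40|U4n] := eqVneq (moment P 4 U) 0%E.
  have [E [mE PE sub]] := even_moment_eq0 (k := 1) mU U40.
  rewrite (@moment_ae_eq _ _ V)//; last first.
    exists E; split => // w /= h; apply: sub => /= h'; apply: h => _.
    by have /= -> := h' I; rewrite add0r.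
  apply: le_trans V4 _; rewrite lee_fin /kurt -/x -/y -yk -!exprMn.
  by apply: lerXn2r; rewrite ?nnegrE ?mulr_ge0 ?addr_ge0//; apply: ler_pM; rewrite ?lerDr.
have [V40|V4n] := eqVneq (moment P 4 V) 0%E.
  have [E [mE PE sub]] := even_moment_eq0 (k := 1) mV V40.
  rewrite (@moment_ae_eq _ _ U)//; last first.
    exists E; split => // w /= h; apply: sub => /= h'; apply: h => _.
    by have /= -> := h' I; rewrite addr0.
  apply: le_trans U4 _; rewrite lee_fin /kurt -/x -/y -xk -!exprMn.
  by apply: lerXn2r; rewrite ?nnegrE ?mulr_ge0 ?addr_ge0//; apply: ler_pM; rewrite ?lerDl.
have kp W k r : (0 <= moment P 4 W)%E -> moment P 4 W != 0%E ->
    (moment P 4 W <= (k * r ^+ 2)%:E)%E -> 0 <= k -> 0 <= r -> 0 < k /\ 0 < r.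
  move=> W0 Wn W4 k0 r0; have : 0 < k * r ^+ 2.
    by rewrite -lte_fin; apply: lt_le_trans W4; rewrite lt_def Wn.
  move=> h; split; rewrite lt_def ?k0 ?r0 andbT; apply/eqP => z; move: h.
    by rewrite z mul0r ltxx.
  by rewrite z expr0n mulr0 ltxx.
have [k1p sp] := kp U k1 s (even_moment_ge0 2 U) U4n U4 k10 s0.
have [k2p tp] := kp V k2 t (even_moment_ge0 2 V) V4n V4 k20 t0.
have xp : 0 < x by rewrite sqrtr_gt0.
have yp : 0 < y by rewrite sqrtr_gt0.
pose c := (x + y) ^+ 2 * (s + t).
have c0 : 0 <= c by rewrite mulr_ge0 ?sqr_ge0 ?addr_ge0.
pose a := c / (x ^+ 2 * s); pose b := c / (y ^+ 2 * t).
have a0 : 0 <= a by rewrite divr_ge0// mulr_ge0 ?sqr_ge0.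
have b0 : 0 <= b by rewrite divr_ge0// mulr_ge0 ?sqr_ge0.
have pw u v : (u + v) ^+ 4 <= a * u ^+ 4 + b * v ^+ 4.
  have h1 := sqr_sum_weighted u v xp yp.
  have h2 := sqr_sum_weighted (u ^+ 2 / x) (v ^+ 2 / y) sp tp.
  rewrite -[4%N]/(2 * 2)%N [(u + v) ^+ _]exprM.
  apply: (@le_trans _ _ (((x + y) * (u ^+ 2 / x + v ^+ 2 / y)) ^+ 2)).
    rewrite ler_sqr ?nnegrE ?sqr_ge0// mulr_ge0 ?addr_ge0//.
      by rewrite divr_ge0 ?sqr_ge0.
    by rewrite divr_ge0 ?sqr_ge0.
  rewrite exprMn; apply: le_trans (ler_wpM2l (sqr_ge0 _) h2) _.
  rewrite le_eqVlt; apply/orP; left; apply/eqP; rewrite /a /b /c.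
  by field; rewrite !gt_eqF.
rewrite !momentE in U4 V4 *.
have mk (W : T -> R) k : measurable_fun setT W -> measurable_fun setT (fun w => (W w ^+ k)%:E).
  by move=> mW; exact/measurable_EFinP/measurable_funX.
have W40 (W : T -> R) w : (0 <= (W w ^+ 4)%:E)%E by rewrite lee_fin exprn_even_ge0.
apply: (@le_trans _ _ (\int[P]_w (a%:E * (U w ^+ 4)%:E + b%:E * (V w ^+ 4)%:E))%E).
  apply: ge0_le_integral => //.
  - by move=> w _; rewrite lee_fin exprn_even_ge0.
  - exact: (mk (fun w => U w + V w)).
  - by apply: emeasurable_funD; apply: emeasurable_funM => //; exact: mk.
  - by move=> w _; rewrite -!EFinM -EFinD lee_fin; exact: pw.
have pos k (W : T -> R) w : 0 <= k -> (0 <= k%:E * (W w ^+ 4)%:E)%E.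
  by move=> k0; apply: mule_ge0; [rewrite lee_fin|exact: W40].
have mkc k (W : T -> R) : measurable_fun setT W ->
    measurable_fun setT (fun w => k%:E * (W w ^+ 4)%:E)%E.
  by move=> mW; apply: emeasurable_funM => //; exact: mk.
have sc k (W : T -> R) : measurable_fun setT W -> 0 <= k ->
    (\int[P]_w (k%:E * (W w ^+ 4)%:E) = k%:E * \int[P]_w (W w ^+ 4)%:E)%E.
  by move=> mW k0; apply: ge0_integralZl => //; exact: mk.
rewrite ge0_integralD//; [|by move=> w _; exact: pos|exact: mkc|by move=> w _; exact: pos|exact: mkc].
rewrite !sc//.
apply: (@le_trans _ _ (a%:E * (k1 * s ^+ 2)%:E + b%:E * (k2 * t ^+ 2)%:E)%E).
  by apply: leeD; apply: lee_wpmul2l; rewrite ?lee_fin.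
rewrite -!EFinM -EFinD lee_fin le_eqVlt; apply/orP; left; apply/eqP.
rewrite /a /b /c /kurt -/x -/y -xk -yk.
by field; rewrite !gt_eqF.
Qed.

End Moments.

(** * The PAC-Bayes inequality *)

Lemma jensen_expR (R : realType) d (T : measurableType d) (P : probability T R)
    (f : T -> R) (M : R) :
  P.-integrable setT (EFin \o f) ->
  (\int[P]_x (expR (f x))%:E <= M%:E)%E -> \int[P]_x f x <= ln M.
Proof.
move=> fi le; set c := \int[P]_x f x.
have mf : measurable_fun setT f by have /measurable_int/measurable_EFinP := fi.
have cE : (\int[P]_x (f x)%:E = c%:E)%E.
  by rewrite /c /Rintegral fineK//; exact: integrable_fin_num.
have i1 : P.-integrable setT (fun=> (expR c * (1 - c))%:E).
  exact: finite_measure_integrable_cst.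
have i2 : P.-integrable setT (fun x => (expR c)%:E * (f x)%:E)%E.
  exact: integrableZl.
have i3 := integrableD measurableT i1 i2.
have low : ((expR c)%:E <= \int[P]_x (expR (f x))%:E)%E.
  have -> : ((expR c)%:E =
      \int[P]_x ((expR c * (1 - c))%:E + (expR c)%:E * (f x)%:E))%E.
    rewrite integralD// integral_cst_prob integralZl// cE -EFinM -EFinD.
    by congr EFin; ring.
  have me : measurable_fun setT (fun x => (expR (f x))%:E).
    by apply/measurable_EFinP; apply: measurableT_comp.
  apply: le_integral => //.
    apply/integrableP; split => //.
    under eq_integral do rewrite gee0_abs ?lee_fin ?expR_ge0//.
    by apply: le_lt_trans le _; rewrite ltry.
  move=> x _; rewrite -EFinM -EFinD lee_fin.
  rewrite -[f x](subrK c) [in leRHS]expRD [leRHS]mulrC -mulrDr ler_pM2l ?expR_gt0//.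
  have := expR_ge1Dx (f x - c); lra.
have : expR c <= M by rewrite -lee_fin; exact: le_trans low le.
by move=> h; rewrite -[c]expRK ler_ln ?posrE ?expR_gt0// (lt_le_trans _ h)// expR_gt0.
Qed.

Lemma measurable_shift_tuple (R : realType) r (t : 'rV[R]_r) (b : R) :
  measurable_fun setT (fun v : r.-tuple R => tuple_of_row (t + b *: row_of_tuple v)).
Proof.
apply/measurable_fun_tuple_of_row => j.
under eq_fun do rewrite mxE [X in _ + X]mxE.
by apply: measurable_funD => //; apply: measurable_funM => //; exact: measurable_row_of_tuple.
Qed.

(** The function 1 + S^2 + S is nonnegative, so symmetrization applies to it, and its
    even part is 1 + S^2. *)
Lemma gaussian_dot_mean (R : realType) r (g : probability (r.-tuple R) R)
    (gg : standard_gaussian g) (y : 'rV[R]_r) :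
  g.-integrable setT (fun v => (dotv y (row_of_tuple v))%:E) /\
  \int[g]_v dotv y (row_of_tuple v) = 0.
Proof.
have mS := @measurable_gaussian_dot R r y.
set S := fun v : r.-tuple R => dotv y (row_of_tuple v).
have [i2 e2] := gaussian_even_poly gg y 1 1 0.
have iS : g.-integrable setT (EFin \o S).
  apply: le_integrable i2 => //; first exact/measurable_EFinP.
  move=> v _ /=; rewrite lee_fin mul0r addr0 mul1r -/(S v).
  rewrite [leRHS]ger0_norm; last by have := sqr_ge0 (S v); lra.
  have := sqr_ge0 (S v - 1); have := sqr_ge0 (S v + 1).
  by rewrite ler_norml; lra.
split => //.
have fS : (\int[g]_v (1 + S v ^+ 2 + S v)%:E = (1 + 1 * dotv y y + 0 * (3 * dotv y y ^+ 2))%:E)%E.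
  apply: (gaussian_even_part gg).
  - by apply: measurable_funD => //; apply: measurable_funD => //; exact: measurable_funX.
  - by move=> v; have := sqr_ge0 (S v + 1 / 2); lra.
  - by move=> v; rewrite /S tuple_of_rowK dotvNr; ring.
have e3 : (\int[g]_v (1 + S v ^+ 2 + S v)%:E =
   \int[g]_v (1 + 1 * S v ^+ 2 + 0 * S v ^+ 4)%:E + \int[g]_v (S v)%:E)%E.
  by rewrite -integralD//; apply: eq_integral => v _; rewrite -EFinD; congr EFin; ring.
rewrite fS e2 in e3.
rewrite /Rintegral; move: e3.
have : (\int[g]_v (S v)%:E)%E \is a fin_num by exact: integrable_fin_num.
case: (\int[g]_v (S v)%:E)%E => // z _; rewrite -EFinD => -[] /=; lra.
Qed.

Lemma Rintegral_sum (R : realType) d (T : measurableType d)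
    (m : {measure set T -> \bar R}) (I : Type) (s : seq I) (f : I -> T -> R) :
  (forall i, m.-integrable setT (EFin \o f i)) ->
  \int[m]_x (\sum_(i <- s) f i x) = \sum_(i <- s) \int[m]_x f i x.
Proof.
move=> fi; elim: s => [|i s ih].
  rewrite big_nil; under eq_Rintegral do rewrite big_nil.
  by rewrite Rintegral_cst// mul0r.
rewrite big_cons -ih -RintegralD//.
  by apply: eq_Rintegral => x _; rewrite big_cons.
have -> : EFin \o (fun x => \sum_(i <- s) f i x) =
    (fun x => (\sum_(i <- s) (f i x)%:E)%E).
  by apply/funext => x /=; rewrite sumEFin.
by apply: integrable_sum => // j _; exact: fi.
Qed.

Section PacBayes.
Context (R : realType) d d' (T : measurableType d) (V : measurableType d')
  (P : probability T R) (n : nat) (Y : 'I_n -> T -> V) (Y0 : T -> V).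
Hypothesis mY : forall i, measurable_fun setT (Y i).
Hypothesis mY0 : measurable_fun setT Y0.
Hypothesis indepY : forall B : 'I_n -> set V, (forall i, measurable (B i)) ->
  P (\bigcap_(i in [set: 'I_n]) (Y i @^-1` B i)) =
  (\prod_(i < n) P (Y i @^-1` B i))%E.
Hypothesis lawY : forall i B, measurable B -> P (Y i @^-1` B) = P (Y0 @^-1` B).
Context (r : nat) (g : probability (r.-tuple R) R) (gg : standard_gaussian g).
Context (W : r.-tuple R * V -> R) (beta : R).
Hypothesis mW : measurable_fun setT W.
Hypothesis W0 : forall z, 0 < W z.
Hypothesis beta0 : 0 < beta.
Hypothesis W_fin : forall t, (\int[P]_w (W (t, Y0 w))%:E < +oo)%E.

Let sb := Num.sqrt beta.
Let sb0 : 0 < sb. Proof. by rewrite sqrtr_gt0. Qed.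
Let sbK : sb ^+ 2 = beta. Proof. by rewrite sqr_sqrtr// ltW. Qed.

Let pt (t : 'rV[R]_r) (v : r.-tuple R) := tuple_of_row (t + sb^-1 *: row_of_tuple v).
Let A (t : r.-tuple R) : R := fine (\int[P]_w (W (t, Y0 w))%:E) - 1.

Let mWt t : measurable_fun setT (fun x => W (t, x)).
Proof. by apply: measurableT_comp => //; exact: measurable_pair1. Qed.

Let mWEY : measurable_fun setT (fun z : r.-tuple R * T => (W (z.1, Y0 z.2))%:E).
Proof.
apply/measurable_EFinP; apply: measurableT_comp => //.
by apply: measurable_fun_pair => //; exact: measurableT_comp.
Qed.

Let AE t : (\int[P]_w (W (t, Y0 w))%:E = (1 + A t)%:E)%E.
Proof.
rewrite /A addrC subrK fineK// ge0_fin_numE//.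
by apply: integral_ge0 => w _; rewrite lee_fin ltW.
Qed.

Let AEi i t : (\int[P]_w (W (t, Y i w))%:E = (1 + A t)%:E)%E.
Proof.
rewrite -AE.
apply: (ge0_integral_same_law (f := fun x => (W (t, x))%:E)) => //.
- exact: lawY.
- exact/measurable_EFinP.
- by move=> x; rewrite lee_fin ltW.
Qed.

Let A1 t : 0 <= 1 + A t.
Proof. by rewrite -lee_fin -AE; apply: integral_ge0 => w _; rewrite lee_fin ltW. Qed.

Let mA : measurable_fun setT A.
Proof.
apply: measurable_funB => //; apply: measurableT_comp; first exact: fine_measurable.
by apply: (measurable_fun_fubini_tonelli_F (m2 := P) _ mWEY) => z; rewrite lee_fin ltW.
Qed.

Let Q (z : r.-tuple R * T) : R :=
  \prod_(i < n) (W (pt 0 z.1, Y i z.2) * expR (- A (pt 0 z.1))).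

Let Q0 z : 0 <= Q z.
Proof. by apply: prodr_ge0 => i _; rewrite mulr_ge0 ?expR_ge0// ltW. Qed.

Let mpt t : measurable_fun setT (pt t).
Proof. exact: measurable_shift_tuple. Qed.

Let mQ : measurable_fun setT Q.
Proof.
apply: measurable_prod => i _; apply: measurable_funM.
  apply: measurableT_comp => //.
  by apply: measurable_fun_pair; apply: measurableT_comp.
apply: measurableT_comp => //; apply: measurableT_comp => //.
by apply: measurableT_comp => //; apply: measurableT_comp.
Qed.

Let J (w : T) := (\int[g]_v (Q (v, w))%:E)%E.

Let mQE : measurable_fun setT (EFin \o Q). Proof. exact/measurable_EFinP. Qed.

Let mJ : measurable_fun setT J.
Proof. exact: (measurable_fun_fubini_tonelli_G (m1 := g) _ mQE (fun z => Q0 z)). Qed.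

Let J0 w : (0 <= J w)%E.
Proof. by apply: integral_ge0 => v _; rewrite lee_fin. Qed.

Let EJ : (\int[P]_w J w <= 1)%E.
Proof.
have := fubini_tonelli (m1 := g) (m2 := P) _ mQE (fun z => Q0 z).
rewrite /J /= => <-.
apply: (@le_trans _ _ (\int[g]_v (1 : R)%:E)%E); last by rewrite integral_cst_prob.
apply: ge0_le_integral => //.
- by move=> v _; apply: integral_ge0 => w _; rewrite lee_fin.
- exact: (measurable_fun_fubini_tonelli_F (m2 := P) _ mQE (fun z => Q0 z)).
move=> v _; set t := pt 0 v.
have := @integral_prod_independent R _ _ T V P n Y mY indepY
  (fun _ x => W (t, x) * expR (- A t)) (fun=> (1 + A t) * expR (- A t)).
rewrite /Q /= => ->.
- rewrite lee_fin big_const_ord iter_mulr_1 exprn_ile1//.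
    by apply: mulr_ge0; [exact: A1|exact: expR_ge0].
  by rewrite expRN ler_pdivrMr ?expR_gt0// mul1r expR_ge1Dx.
- by move=> i; apply: measurable_funM.
- by move=> i x; rewrite mulr_ge0 ?expR_ge0// ltW.
- move=> i; rewrite EFinM -(AEi i) -ge0_integralZr//.
  + by apply/measurable_EFinP; exact: (measurableT_comp (mWt t) (mY i)).
  + by move=> w _; rewrite lee_fin ltW.
Qed.

(** With A(t) = E W(t, Y0) - 1, independence and (1 + A) exp (- A) <= 1 show that
    prod_i W(t, Y_i) exp (- A t) has expectation at most 1 for each t, hence also
    after averaging t over a centred Gaussian law of precision beta. Markov's
    inequality bounds the average on an event that does not depend on t. On this
    event, recentring the Gaussian law at t by the Cameron-Martin formula costs
    beta |t|^2 / 2, and Jensen's inequality takes the logarithm inside. *)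
Lemma pac_bayes (eps : R) : 0 < eps -> exists E : set T,
  [/\ measurable E, ((1 - eps)%:E <= P E)%E &
   forall w, E w -> forall (t : 'rV[R]_r) (a : R),
    (forall x, g.-integrable setT (fun v => (ln (W (pt t v, x)))%:E)) ->
    (\int[P]_w \int[g]_v (W (pt t v, Y0 w))%:E = (1 + a)%:E)%E ->
    \sum_(i < n) \int[g]_v ln (W (pt t v, Y i w)) <=
      n%:R * a + beta * dotv t t / 2 + ln eps^-1].
Proof.
move=> eps0.
pose E : set T := [set w | (J w <= (eps^-1)%:E)%E].
have mE : measurable E.
  rewrite -[E]setTI; exact: emeasurable_fun_infty_c.
exists E; split => //.
- have mEc : measurable (~` E) by exact: measurableC.
  have markov : ((eps^-1)%:E * P (~` E) <= 1)%E.
    apply: le_trans EJ.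
    rewrite -(integral_cst P mEc).
    apply: (@le_trans _ _ (\int[P]_(w in ~` E) J w)%E).
      apply: ge0_le_integral => //.
      + by move=> w _; rewrite lee_fin invr_ge0 ltW.
      + exact: measurable_funTS.
      + by move=> w /= /negP; rewrite -ltNge => /ltW.
    by apply: ge0_subset_integral.
  have PEc : (P (~` E) <= eps%:E)%E.
    have : (eps%:E * ((eps^-1)%:E * P (~` E)) <= eps%:E * 1)%E.
      by apply: lee_wpmul2l => //; rewrite lee_fin ltW.
    by rewrite muleA -EFinM divff ?gt_eqF// mul1e mule1.
  rewrite probability_setC// in PEc.
  have fE : P E \is a fin_num by exact: fin_num_measure.
  move: PEc; rewrite -(fineK fE) -EFinB !lee_fin; lra.
move=> w Ew t a iln aE.
have [shift _ _ _] := gg.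
have QE v : (Q (tuple_of_row (row_of_tuple v + sb *: t), w) *
    expR (- dotv (sb *: t) (row_of_tuple v) - dotv (sb *: t) (sb *: t) / 2) =
    expR (\sum_(i < n) (ln (W (pt t v, Y i w)) - A (pt t v))
          - sb * dotv t (row_of_tuple v) - beta * dotv t t / 2)).
  have -> : Q (tuple_of_row (row_of_tuple v + sb *: t), w) =
      \prod_(i < n) (W (pt t v, Y i w) * expR (- A (pt t v))).
    rewrite /Q /=; apply: eq_bigr => i _.
    suff -> : pt 0 (tuple_of_row (row_of_tuple v + sb *: t)) = pt t v by [].
    rewrite /pt tuple_of_rowK add0r scalerDr scalerA mulVf ?gt_eqF// scale1r.
    by rewrite addrC.
  rewrite -!addrA [in RHS]expRD expR_sum; congr (_ * _).
    by apply: eq_bigr => i _; rewrite expRD lnK// posrE.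
  by congr expR; rewrite !dotvZl dotvZr -sbK; ring.
have iA : g.-integrable setT (fun v => (A (pt t v))%:E) /\ \int[g]_v A (pt t v) = a.
  have mWp : measurable_fun setT (fun z : r.-tuple R * T => (W (pt t z.1, Y0 z.2))%:E).
    apply/measurable_EFinP; apply: measurableT_comp => //.
    by apply: measurable_fun_pair; apply: measurableT_comp.
  have Wp0 (z : r.-tuple R * T) : (0 <= (W (pt t z.1, Y0 z.2))%:E)%E by rewrite lee_fin ltW.
  have := fubini_tonelli (m1 := g) (m2 := P) _ mWp Wp0.
  rewrite /= aE; under eq_integral do rewrite AE.
  move=> e.
  have m1 : measurable_fun setT (fun v => (1 + A (pt t v))%:E).
    apply/measurable_EFinP; apply: measurable_funD => //.
    exact: measurableT_comp.
  have i1 : g.-integrable setT (fun v => (1 + A (pt t v))%:E).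
    apply/integrableP; split => //.
    under eq_integral do rewrite gee0_abs ?lee_fin//.
    by rewrite e ltry.
  have ic : g.-integrable setT (fun=> (- 1 : R)%:E) by exact: finite_measure_integrable_cst.
  have i2 := integrableD measurableT i1 ic.
  have fE : (fun v => (A (pt t v))%:E) = ((fun v => (1 + A (pt t v))%:E) \+ (fun=> (-1)%:E))%E.
    by apply/funext => v /=; rewrite -EFinD; congr EFin; ring.
  split; first by rewrite fE.
  by rewrite /Rintegral fE integralD// e integral_cst_prob -EFinD /=; ring.
have [iA1 eA] := iA.
have [iS eS] := gaussian_dot_mean gg t.
pose Psi v := \sum_(i < n) (ln (W (pt t v, Y i w)) - A (pt t v))
          - sb * dotv t (row_of_tuple v) - beta * dotv t t / 2.
have iterm i : g.-integrable setT (fun v => (ln (W (pt t v, Y i w)) - A (pt t v))%:E).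
  exact: (integrableB measurableT (iln _) iA1).
have isum : g.-integrable setT
    (fun v => (\sum_(i < n) (ln (W (pt t v, Y i w)) - A (pt t v)))%:E).
  under eq_fun do rewrite -sumEFin.
  exact: integrable_sum.
have isS : g.-integrable setT (fun v => (sb * dotv t (row_of_tuple v))%:E).
  exact: (integrableZl measurableT sb iS).
have ic : g.-integrable setT (fun=> (beta * dotv t t / 2)%:E).
  exact: finite_measure_integrable_cst.
have i12 := integrableB measurableT isum isS.
have iPsi : g.-integrable setT (EFin \o Psi) by exact: (integrableB measurableT i12 ic).
have : \int[g]_v Psi v <= ln eps^-1.
  have mQw : measurable_fun setT (fun v => (Q (v, w))%:E).
    exact: (measurable_fun_pair1 _ mQE).
  have Qw0 v : (0 <= (Q (v, w))%:E)%E by rewrite lee_fin.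
  have eJ : (\int[g]_v (expR (Psi v))%:E = J w)%E.
    apply: etrans (shift (sb *: t) _ mQw Qw0).
    by apply: eq_integral => v _; rewrite -EFinM QE.
  by apply: jensen_expR => //; rewrite eJ.
have -> : \int[g]_v Psi v = \sum_(i < n) \int[g]_v ln (W (pt t v, Y i w)) - n%:R * a
   - beta * dotv t t / 2.
  rewrite /Psi RintegralB// RintegralB// Rintegral_cst//.
  rewrite RintegralZl// eS mulr0 subr0 [P in fine P](@probability_setT _ _ _ g) /= mulr1.
  congr (_ - _); rewrite Rintegral_sum//.
  transitivity (\sum_(i < n) (\int[g]_v ln (W (pt t v, Y i w)) - a)).
    by apply: eq_bigr => i _; rewrite -eA -RintegralB//; exact: iln.
  by rewrite sumrB sumr_const card_ord mulr_natl.
lra.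
Qed.

End PacBayes.

(** * Quadratic forms, traces and nets *)

Lemma qformE (R : realType) D (G : 'M[R]_D) t : qform G t = dotv (t *m G) t.
Proof. by rewrite /qform mxE; apply: eq_bigr => j _; rewrite [t^T _ _]mxE. Qed.

Lemma dotvE (R : realType) D (u v : 'rV[R]_D) : dotv u v = (u *m v^T) 0 0.
Proof. by rewrite mxE; apply: eq_bigr => j _; rewrite [v^T _ _]mxE. Qed.

Lemma dotv_mulmx (R : realType) r D (A : 'M[R]_(r, D)) (c : 'rV[R]_r) (z : 'rV[R]_D) :
  dotv c (z *m A^T) = dotv (c *m A) z.
Proof. by rewrite !dotvE trmx_mul trmxK mulmxA. Qed.

Lemma discriminant_le (R : realFieldType) (a b c : R) : 0 <= c ->
  (forall x, 0 <= a + 2 * b * x + c * x ^+ 2) -> b ^+ 2 <= a * c.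
Proof.
move=> c0 h; have [cz|cn] := eqVneq c 0.
  have [->|bn] := eqVneq b 0; first by rewrite expr0n cz mulr0.
  have := h (- (a + 1) / (2 * b)).
  have -> : a + 2 * b * (- (a + 1) / (2 * b)) + c * (- (a + 1) / (2 * b)) ^+ 2 = -1.
    by rewrite cz; field; rewrite bn.
  lra.
have cp : 0 < c by rewrite lt_def cn.
have := h (- b / c).
have -> : a + 2 * b * (- b / c) + c * (- b / c) ^+ 2 = (a * c - b ^+ 2) / c.
  by field.
by rewrite pmulr_lge0 ?invr_gt0// subr_ge0.
Qed.

Section Forms.
Context (R : realType) (D : nat).
Implicit Types (G H : 'M[R]_D) (u v t : 'rV[R]_D).

Lemma dotv_mulmx_sym H u v : H^T = H -> dotv (v *m H) u = dotv (u *m H) v.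
Proof.
move=> HT; rewrite !dotvE; have -> : u *m H *m v^T = (v *m H *m u^T)^T.
  by rewrite !trmx_mul trmxK HT mulmxA.
by rewrite [RHS]mxE.
Qed.

Lemma qformD H u v : H^T = H ->
  qform H (u + v) = qform H u + 2 * dotv (u *m H) v + qform H v.
Proof.
move=> /(dotv_mulmx_sym u v) e; rewrite !qformE mulmxDl dotvDl !dotvDr e; ring.
Qed.

Lemma qformZ H a t : qform H (a *: t) = a ^+ 2 * qform H t.
Proof. by rewrite !qformE -scalemxAl dotvZl dotvZr mulrA. Qed.

Lemma qformB H u v : H^T = H ->
  qform H u - qform H v = dotv ((u - v) *m H) (u + v).
Proof.
move=> /(dotv_mulmx_sym u v) e; rewrite !qformE mulmxBl dotvDl dotvNl !dotvDr e; ring.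
Qed.

Lemma psd_cauchy_schwarz G u v : G^T = G -> (forall t, 0 <= qform G t) ->
  dotv (u *m G) v ^+ 2 <= qform G u * qform G v.
Proof.
move=> GT Gp; apply: discriminant_le => // x.
have := Gp (u + x *: v); rewrite qformD// qformZ dotvZr; lra.
Qed.

Lemma qform1 t : qform 1%:M t = dotv t t.
Proof. by rewrite qformE mulmx1. Qed.

Lemma dotv_cauchy_schwarz u v : dotv u v ^+ 2 <= dotv u u * dotv v v.
Proof.
have := @psd_cauchy_schwarz 1%:M u v (trmx1 _ _).
by rewrite !qform1 mulmx1; apply=> t; rewrite qform1 dotv_ge0.
Qed.

End Forms.

Lemma sqnorm_mulmx_le (R : realType) m D (A : 'M[R]_(m, D)) (c : 'rV[R]_m) :
  dotv (c *m A) (c *m A) <= (\sum_i \sum_j A i j ^+ 2) * dotv c c.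
Proof.
rewrite exchange_big /= mulr_suml; apply: ler_sum => j _.
have -> : (c *m A) 0 j * (c *m A) 0 j = dotv c (col j A)^T ^+ 2.
  by rewrite expr2 mxE; congr (_ * _); apply: eq_bigr => i _; rewrite !mxE.
apply: le_trans (dotv_cauchy_schwarz _ _) _; rewrite mulrC ler_wpM2r ?dotv_ge0//.
by rewrite le_eqVlt; apply/orP; left; apply/eqP; apply: eq_bigr => i _; rewrite !mxE expr2.
Qed.

Section FormBounds.
Context (R : realType) (D : nat).
Implicit Types (G H : 'M[R]_D) (u v t : 'rV[R]_D).

Lemma dotv_eq0 t : dotv t t = 0 -> t = 0.
Proof.
move=> /eqP; rewrite psumr_eq0 => [|j _]; last by rewrite -expr2 sqr_ge0.
move=> /allP a; apply/rowP => j; have := a j (mem_index_enum _).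
by rewrite /= mulf_eq0 orbb [RHS]mxE => /eqP.
Qed.

Definition frob H : R := \sum_i \sum_j H i j ^+ 2.

Lemma frob_ge0 H : 0 <= frob H.
Proof. by apply: sumr_ge0 => i _; apply: sumr_ge0 => j _; exact: sqr_ge0. Qed.

Lemma dotv_mulmx_le H u v : dotv (u *m H) v ^+ 2 <= frob H * (dotv u u * dotv v v).
Proof.
apply: le_trans (dotv_cauchy_schwarz _ _) _; rewrite mulrA ler_wpM2r ?dotv_ge0//.
exact: sqnorm_mulmx_le.
Qed.

Lemma qform_delta G i : qform G (delta_mx 0 i) = G i i.
Proof. by rewrite qformE dotv_delta -rowE mxE. Qed.

(** Cauchy-Schwarz for the form bounds each squared entry by the product of the two
    diagonal entries. *)
Lemma frob_le_trace G : G^T = G -> (forall t, 0 <= qform G t) ->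
  frob G <= (\tr G) ^+ 2.
Proof.
move=> GT Gp; rewrite expr2 mulr_suml; apply: ler_sum => i _.
rewrite mulr_sumr; apply: ler_sum => j _.
have := @psd_cauchy_schwarz _ _ G (delta_mx 0 i) (delta_mx 0 j) GT Gp.
by rewrite !qform_delta dotv_delta -rowE mxE.
Qed.

Lemma trace_orthonormal G (e : 'I_D -> 'rV[R]_D) : orthonormal_basis e ->
  \sum_i qform G (e i) = \tr G.
Proof.
move=> oe; pose E : 'M[R]_D := \matrix_(i < D) e i.
have EE : E *m E^T = 1%:M.
  apply/matrixP => i j; rewrite mxE [RHS]mxE -oe; apply: eq_bigr => k _.
  by rewrite !mxE.
have EE' : E^T *m E = 1%:M by apply: mulmx1C.
rewrite -[in RHS](mulmx1 G) -EE' mulmxA mxtrace_mulC mulmxA.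
apply: eq_bigr => i _; rewrite /qform !mxE; apply: eq_bigr => j _.
by rewrite !mxE; congr (_ * _); apply: eq_bigr => k _; rewrite !mxE.
Qed.

(** The kernel of Z^T is the orthogonal of the row space of Z, so the two meet only
    in 0, and their ranks add up to D. *)
Lemma row_space_decomposition n (Z : 'M[R]_(n, D)) t :
  exists p q, [/\ t = p + q, (p <= Z)%MS & q *m Z^T = 0].
Proof.
pose N := kermx Z^T.
have ort x : (x <= Z)%MS -> x *m Z^T = 0 -> x = 0 :> 'rV[R]_D.
  move=> /submxP[y ->] h.
  by apply: dotv_eq0; rewrite dotvE trmx_mul mulmxA h mul0mx mxE.
have cap0 : (Z :&: N)%MS = 0.
  apply/row_matrixP => i; rewrite row0; apply: ort.
    by apply: submx_trans (row_sub _ _) (capmxSl _ _).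
  by apply/sub_kermxP; apply: submx_trans (row_sub _ _) (capmxSr _ _).
have full : row_full (Z + N)%MS.
  have := mxrank_sum_cap Z N; rewrite cap0 mxrank0 addn0 mxrank_ker mxrank_tr.
  by rewrite subnKC ?rank_leq_col// => h; rewrite /row_full h.
have /sub_addsmxP[[a b] /= tE] := submx_full t full.
exists (a *m Z), (b *m N); split => //; first exact: submxMl.
by rewrite -mulmxA mulmx_ker mulmx0.
Qed.

Lemma perp_rows n (Z : 'M[R]_(n, D)) t :
  t *m Z^T = 0 <-> forall i, dotv t (row i Z) = 0.
Proof.
have e i : (t *m Z^T) 0 i = dotv t (row i Z).
  by rewrite mxE; apply: eq_bigr => j _; rewrite !mxE.
split=> [h i|h]; first by rewrite -e h mxE.
by apply/rowP => i; rewrite e h mxE.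
Qed.

End FormBounds.

(** Cut the cube [-1, 1]^D into cells of side rho / (D + 1) and keep one point of S in
    every cell that meets S. *)
Lemma finite_net (R : realType) D (S : set 'rV[R]_D) (rho : R) : 0 < rho ->
  (forall t, S t -> enorm t = 1) ->
  exists Theta : seq 'rV[R]_D, (forall t, t \in Theta -> S t) /\
   (forall t, S t -> exists2 s, s \in Theta & enorm (t - s) <= rho).
Proof.
move=> rho0 S1.
pose eta := rho / D.+1%:R.
have eta0 : 0 < eta by rewrite divr_gt0// ltr0n.
pose M := Num.truncn (2 / eta).
pose k (t : 'rV[R]_D) (j : 'I_D) := Num.truncn ((t 0 j + 1) / eta).
have tj t j : S t -> -1 <= t 0 j <= 1.
  move=> /S1 t1; rewrite -ler_norml -(ler_pXn2r (n := 2)) ?nnegrE//.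
  rewrite real_normK ?num_real// expr1n.
  have <- : dotv t t = 1 by rewrite -[LHS]sqr_sqrtr ?dotv_ge0// -/(enorm t) t1 expr1n.
  rewrite expr2 /dotv (bigD1 j)//= lerDl.
  by apply: sumr_ge0 => i _; rewrite -expr2 sqr_ge0.
have arg0 t j : S t -> 0 <= (t 0 j + 1) / eta.
  by move=> /(tj _ j) h; rewrite divr_ge0 ?(ltW eta0)//; lra.
have kM t j : S t -> (k t j < M.+1)%N.
  move=> St; rewrite ltnS /k /M truncn_ge_nat; last by rewrite divr_ge0// ltW.
  have /andP[h _] := truncn_itv (arg0 t j St); apply: le_trans h _.
  by rewrite ler_pM2r ?invr_gt0//; have := tj _ j St; lra.
pose cell t : {ffun 'I_D -> 'I_M.+1} := [ffun j => inord (k t j)].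
pose pick (f : {ffun 'I_D -> 'I_M.+1}) : option 'rV[R]_D :=
  match pselect (exists t, S t /\ cell t = f) with
  | left ex => Some (projT1 (cid ex)) | right _ => None end.
have pickP f t : pick f = Some t -> S t /\ cell t = f.
  by rewrite /pick; case: pselect => // ex [<-]; exact: (projT2 (cid ex)).
exists (pmap pick (enum {ffun 'I_D -> 'I_M.+1})); split.
  by move=> t; rewrite mem_pmap => /mapP[f _ /esym /pickP[]].
move=> t St; have [s ps] : exists s, pick (cell t) = Some s.
  rewrite /pick; case: pselect => [ex|]; first by eexists.
  by move=> h; exfalso; apply: h; exists t.
exists s; first by rewrite mem_pmap; apply/mapP; exists (cell t); rewrite ?mem_enum.
have [Ss cs] := pickP _ _ ps.
have kk j : k s j = k t j.
  have := congr1 (fun f : {ffun 'I_D -> 'I_M.+1} => val (f j)) cs.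
  by rewrite !ffunE /= !inordK// kM.
have dj j : (t 0 j - s 0 j) ^+ 2 <= eta ^+ 2.
  have /andP[h1 h2] := truncn_itv (arg0 t j St).
  have /andP[h3 h4] := truncn_itv (arg0 s j Ss).
  rewrite -/(k t j) in h1 h2; rewrite -/(k s j) kk in h3 h4.
  rewrite -natr1 in h2 h4.
  have e : (t 0 j - s 0 j) = ((t 0 j + 1) / eta - (s 0 j + 1) / eta) * eta.
    by field; rewrite gt_eqF.
  rewrite e exprMn -[leRHS]mul1r ler_wpM2r ?sqr_ge0//; nra.
rewrite /enorm -(ger0_norm (ltW rho0)) -sqrtr_sqr ler_wsqrtr//.
apply: (@le_trans _ _ (\sum_(j < D) eta ^+ 2)).
  by apply: ler_sum => j _; have := dj j; rewrite -expr2 !mxE.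
rewrite sumr_const card_ord -mulr_natl /eta expr_div_n mulrA ler_pdivrMr ?exprn_gt0 ?ltr0n//.
rewrite mulrC ler_pM2l ?exprn_gt0// -natr1.
have : 0 <= (D%:R : R) by []. by move=> h; nra.
Qed.

(** * Deviations of a whitened sample *)

Lemma sqr_sum_le (R : realType) k (f : 'I_k -> R) :
  (\sum_(j < k) f j) ^+ 2 <= k%:R * \sum_(j < k) f j ^+ 2.
Proof.
have := dotv_cauchy_schwarz (\row_(j < k) (1 : R)) (\row_j f j); rewrite /dotv.
rewrite (eq_bigr f) => [|j _]; last by rewrite !mxE mul1r.
rewrite [X in _ <= X * _](eq_bigr (fun=> 1)) => [|j _]; last by rewrite !mxE mul1r.
rewrite [X in _ <= _ * X](eq_bigr (fun j => f j ^+ 2)) => [|j _]; last by rewrite !mxE expr2.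
by rewrite sumr_const card_ord.
Qed.

Section WhitenedDeviation.
Context (R : realType) d (T : measurableType d) (P : probability T R)
  (n r : nat) (U : 'I_n -> T -> 'rV[R]_r) (U0 : T -> 'rV[R]_r) (K : R).
Hypothesis mU : forall i j, measurable_fun setT (fun w => U i w 0 j).
Hypothesis mU0 : forall j, measurable_fun setT (fun w => U0 w 0 j).
Hypothesis indepU : forall B : 'I_n -> set (r.-tuple R), (forall i, measurable (B i)) ->
  P (\bigcap_(i in [set: 'I_n]) ((fun w => tuple_of_row (U i w)) @^-1` B i)) =
  (\prod_(i < n) P ((fun w => tuple_of_row (U i w)) @^-1` B i))%E.
Hypothesis lawU : forall i B, measurable B ->
  P ((fun w => tuple_of_row (U i w)) @^-1` B) = P ((fun w => tuple_of_row (U0 w)) @^-1` B).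
Hypothesis U2 : forall c, (\int[P]_w (dotv c (U0 w) ^+ 2)%:E = (dotv c c)%:E)%E.
Hypothesis U4 : forall c, (\int[P]_w (dotv c (U0 w) ^+ 4)%:E <= (K * dotv c c ^+ 2)%:E)%E.
Context (sg lam beta : R).
Hypothesis sg2 : sg ^+ 2 = 1.
Hypothesis beta0 : 0 < beta.

Let mdot c k : measurable_fun setT (fun w => dotv c (U0 w) ^+ k).
Proof. by apply: measurable_funX; exact: measurable_dotv. Qed.

Let i2 c : P.-integrable setT (EFin \o (fun w => dotv c (U0 w) ^+ 2)).
Proof.
apply/integrableP; split; first exact/measurable_EFinP.
by under eq_integral do rewrite gee0_abs ?lee_fin ?sqr_ge0//; rewrite U2 ltry.
Qed.

Let i4 c : P.-integrable setT (EFin \o (fun w => dotv c (U0 w) ^+ 4)).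
Proof.
apply/integrableP; split; first exact/measurable_EFinP.
under eq_integral do rewrite gee0_abs ?lee_fin ?exprn_even_ge0//.
by apply: le_lt_trans (U4 c) _; rewrite ltry.
Qed.

Let E2 c : \int[P]_w (dotv c (U0 w) ^+ 2) = dotv c c.
Proof. by rewrite /Rintegral U2. Qed.

Let E4 c : \int[P]_w (dotv c (U0 w) ^+ 4) <= K * dotv c c ^+ 2.
Proof.
rewrite -lee_fin /Rintegral fineK; last exact: (integrable_fin_num _ (i4 c)).
exact: U4.
Qed.

Let ej (j : 'I_r) : 'rV[R]_r := delta_mx 0 j.

Let dot_ej j v : dotv (ej j) v = v 0 j.
Proof. by rewrite dotvC dotv_delta. Qed.

Let S4 (w : T) : R := \sum_(j < r) dotv (ej j) (U0 w) ^+ 4.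

Let iS4 : P.-integrable setT (EFin \o S4).
Proof.
have -> : EFin \o S4 = (fun w => (\sum_(j < r) (dotv (ej j) (U0 w) ^+ 4)%:E)%E).
  by apply/funext => w /=; rewrite sumEFin.
by apply: integrable_sum => // j _; exact: i4.
Qed.

Let ES4 : \int[P]_w S4 w <= K * r%:R.
Proof.
rewrite /S4 Rintegral_sum; last by move=> j; exact: i4.
apply: (@le_trans _ _ (\sum_(j < r) K)); last by rewrite sumr_const card_ord mulr_natr.
apply: ler_sum => j _; have := E4 (ej j).
by rewrite dot_ej mxE !eqxx expr1n mulr1.
Qed.

(* The fourth power of the norm and the mixed moment are reduced to the fourth
   moments of linear forms, the only ones that are controlled, at the price
   of a factor r. *)
Let norm4_le w : dotv (U0 w) (U0 w) ^+ 2 <= r%:R * S4 w.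
Proof.
have sE : dotv (U0 w) (U0 w) = \sum_(j < r) dotv (ej j) (U0 w) ^+ 2.
  by apply: eq_bigr => j _; rewrite dot_ej expr2.
rewrite sE; set f := fun j => dotv (ej j) (U0 w) ^+ 2.
have -> : S4 w = \sum_(j < r) f j ^+ 2.
  by apply: eq_bigr => j _; rewrite /f -exprM.
exact: sqr_sum_le.
Qed.

Let mix_le c w : 0 < dotv c c ->
  dotv c (U0 w) ^+ 2 * dotv (U0 w) (U0 w) <=
  (r%:R / dotv c c * dotv c (U0 w) ^+ 4 + dotv c c * S4 w) / 2.
Proof.
move=> a0; set a := dotv c c in a0 *; set m := dotv c (U0 w).
have sE : dotv (U0 w) (U0 w) = \sum_(j < r) dotv (ej j) (U0 w) ^+ 2.
  by apply: eq_bigr => j _; rewrite dot_ej expr2.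
rewrite sE mulr_sumr.
have -> : (r%:R / a * m ^+ 4 + a * S4 w) / 2 =
    \sum_(j < r) (m ^+ 4 / a + a * dotv (ej j) (U0 w) ^+ 4) / 2.
  rewrite -mulr_suml big_split /= sumr_const card_ord -mulr_sumr.
  by rewrite -[m ^+ 4 / a *+ r]mulr_natl; congr ((_ + _) / 2); rewrite mulrAC mulrA.
apply: ler_sum => j _; set x := dotv (ej j) (U0 w).
have a1 : a != 0 by rewrite gt_eqF.
rewrite -subr_ge0.
have -> : (m ^+ 4 / a + a * x ^+ 4) / 2 - m ^+ 2 * x ^+ 2 =
   (m ^+ 2 - a * x ^+ 2) ^+ 2 / (2 * a) by field; rewrite a1.
by rewrite divr_ge0 ?sqr_ge0// mulr_ge0// ltW.
Qed.

Let Wt (z : r.-tuple R * r.-tuple R) : R :=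
  let u := row_of_tuple z.2 in
  smooth_weight sg lam (dotv u u / beta) (dotv (row_of_tuple z.1) u).

Let mWt : measurable_fun setT Wt.
Proof.
have m1 j : measurable_fun setT
    (fun z : r.-tuple R * r.-tuple R => row_of_tuple z.1 0 j).
  by apply: (measurableT_comp (measurable_row_of_tuple j)).
have m2 j : measurable_fun setT
    (fun z : r.-tuple R * r.-tuple R => row_of_tuple z.2 0 j).
  by apply: (measurableT_comp (measurable_row_of_tuple j)).
have mu : measurable_fun setT (fun z : r.-tuple R * r.-tuple R =>
    dotv (row_of_tuple z.2) (row_of_tuple z.2) / beta).
  by apply: measurable_funM => //; exact: measurable_dotv.
have mw : measurable_fun setT (fun z : r.-tuple R * r.-tuple R =>
    dotv (row_of_tuple z.1) (row_of_tuple z.2)) by exact: measurable_dotv.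
exact: measurable_smooth_weight.
Qed.

Let s2_ge0 (u : 'rV[R]_r) : 0 <= dotv u u / beta.
Proof. by rewrite divr_ge0 ?dotv_ge0// ltW. Qed.

Let Wt_gt0 z : 0 < Wt z.
Proof. by apply: lt_le_trans (smooth_weight_ge _ _ _ (s2_ge0 _)). Qed.

Let smooth_weight_le (s2 w : R) : 0 <= s2 -> smooth_weight sg lam s2 w <=
  3 / 2 + 3 * lam ^+ 2 + 22 * lam ^+ 2 * w ^+ 4 + 41 * lam ^+ 2 * s2 ^+ 2.
Proof.
move=> s20; rewrite /smooth_weight.
set z := centred_score _ _ _ _.
have zE : z ^+ 2 = lam ^+ 2 * (w ^+ 2 - s2 - 1) ^+ 2 by rewrite !exprMn sg2 mul1r.
have h1 : cat_exp z <= 3 / 2 + z ^+ 2 by have := sqr_ge0 (z - 1); lra.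
have h2 : (w ^+ 2 - s2 - 1) ^+ 2 <= 3 * (w ^+ 4 + s2 ^+ 2 + 1).
  have := sqr_ge0 (w ^+ 2 + s2); have := sqr_ge0 (w ^+ 2 + 1); have := sqr_ge0 (s2 - 1).
  lra.
have h3 : s2 * (w ^+ 2 + s2 / 2) <= w ^+ 4 / 2 + s2 ^+ 2.
  have := sqr_ge0 (w ^+ 2 - s2); lra.
have l2 := sqr_ge0 lam.
have := ler_wpM2l l2 h2; have := ler_wpM2l l2 h3.
have w4 : 0 <= lam ^+ 2 * w ^+ 4 by rewrite mulr_ge0// exprn_even_ge0.
have s4 : 0 <= lam ^+ 2 * s2 ^+ 2 by rewrite mulr_ge0// sqr_ge0.
rewrite /excess; lra.
Qed.

Let EWt_fin t : (\int[P]_w (Wt (t, tuple_of_row (U0 w)))%:E < +oo)%E.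
Proof.
set c := row_of_tuple t.
pose G w := 3 / 2 + 3 * lam ^+ 2 + 22 * lam ^+ 2 * dotv c (U0 w) ^+ 4
   + 41 * lam ^+ 2 / beta ^+ 2 * r%:R * S4 w.
have iG : P.-integrable setT (EFin \o G).
  have ia : P.-integrable setT (fun=> (3 / 2 + 3 * lam ^+ 2)%:E).
    exact: finite_measure_integrable_cst.
  have ib := integrableZl measurableT (22 * lam ^+ 2) (i4 c).
  have ic := integrableZl measurableT (41 * lam ^+ 2 / beta ^+ 2 * r%:R) iS4.
  have := integrableD measurableT (integrableD measurableT ia ib) ic.
  by congr (_.-integrable _ _); apply/funext => w /=; rewrite -!EFinM -!EFinD.
have Gl : (\int[P]_w (G w)%:E < +oo)%E by exact: integrable_lty.
apply: le_lt_trans Gl.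
apply: ge0_le_integral => //.
- by move=> w _; rewrite lee_fin ltW.
- apply/measurable_EFinP; apply: measurableT_comp => //.
  by apply: measurable_fun_pair => //; apply/measurable_fun_tuple_of_row.
- by have /measurable_int := iG.
move=> w _; rewrite lee_fin /Wt /= tuple_of_rowK.
apply: le_trans (smooth_weight_le _ (s2_ge0 _)) _.
have h : 0 <= 41 * lam ^+ 2 / beta ^+ 2.
  by apply: divr_ge0; [apply: mulr_ge0 => //|]; exact: sqr_ge0.
have := ler_wpM2l h (norm4_le w); rewrite /G lerD2l -subr_ge0 => h1.
rewrite -subr_ge0; move: h1; congr (0 <= _).
by field; rewrite gt_eqF.
Qed.

Let bound a := sg * lam * (a - 1) + lam ^+ 2 / 2 * (K * a ^+ 2 - 2 * a + 1) +
   79 / 2 * lam ^+ 2 * K * a * r%:R / beta +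
   229 / 4 * lam ^+ 2 * K * r%:R ^+ 2 / beta ^+ 2.

(** [pac_bayes] for the weight [smooth_weight], at a parameter c perturbed by noise of
    variance 1 / beta: the score of an observation u is then perturbed by noise of
    variance |u|^2 / beta. [psi_le_integral_ln] bounds psi by what [pac_bayes]
    controls, and the moment hypotheses bound the mean of the weight. *)
Lemma whitened_deviation (eps : R) : 0 < eps -> exists E : set T,
  [/\ measurable E, ((1 - eps)%:E <= P E)%E &
   forall w, E w -> forall c, 0 < dotv c c ->
    \sum_(i < n) psi (sg * lam * (dotv c (U i w) ^+ 2 - 1)) <=
      n%:R * bound (dotv c c) + beta * dotv c c / 2 + ln eps^-1].
Proof.
move=> eps0; have [g gg] := exists_standard_gaussian R r.
have mtU i : measurable_fun setT (fun w => tuple_of_row (U i w)).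
  exact/measurable_fun_tuple_of_row.
have mtU0 : measurable_fun setT (fun w => tuple_of_row (U0 w)).
  exact/measurable_fun_tuple_of_row.
have [E [mE PE HE]] := pac_bayes mtU mtU0 indepU lawU gg mWt Wt_gt0 beta0 EWt_fin eps0.
exists E; split => // w Ew c c0.
set a := dotv c c in c0 *.
have sb0 : 0 < Num.sqrt beta by rewrite sqrtr_gt0.
have sbK : (Num.sqrt beta)^-1 ^+ 2 = beta^-1 by rewrite exprVn sqr_sqrtr// ltW.
(* The inner product of u with the noise v / sqrt beta is read as that of
   u / sqrt beta with v, which is the form that the smoothing lemmas take. *)
have WE u v : Wt (tuple_of_row (c + (Num.sqrt beta)^-1 *: row_of_tuple v), tuple_of_row u) =
    smooth_weight sg lam (dotv ((Num.sqrt beta)^-1 *: u) ((Num.sqrt beta)^-1 *: u))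
      (dotv c u + dotv ((Num.sqrt beta)^-1 *: u) (row_of_tuple v)).
  rewrite /Wt /= !tuple_of_rowK; congr smooth_weight.
    by rewrite dotvZl dotvZr mulrA -expr2 sbK mulrC.
  by rewrite dotvDl !dotvZl [dotv u _]dotvC.
have sE u : dotv ((Num.sqrt beta)^-1 *: u) ((Num.sqrt beta)^-1 *: u) = dotv u u / beta :> R.
  by rewrite dotvZl dotvZr mulrA -expr2 sbK mulrC.
pose G w := 1 + sg * lam * (dotv c (U0 w) ^+ 2 - 1) +
   lam ^+ 2 * (dotv c (U0 w) ^+ 2 - 1) ^+ 2 / 2 +
   79 / 2 * (lam ^+ 2 * (dotv c (U0 w) ^+ 2 * (dotv (U0 w) (U0 w) / beta))) +
   229 / 4 * (lam ^+ 2 * (dotv (U0 w) (U0 w) / beta) ^+ 2).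
have GE x : (\int[g]_v (Wt (tuple_of_row (c + (Num.sqrt beta)^-1 *: row_of_tuple v),
     tuple_of_row (U0 x)))%:E = (G x)%:E)%E.
  under eq_integral do rewrite WE.
  by rewrite (integral_smooth_weight gg)// sE.
have G0 x : 0 <= G x.
  by rewrite -lee_fin -GE; apply: integral_ge0 => v _; rewrite lee_fin ltW.
have mG : measurable_fun setT G.
  have mm := mdot c 2.
  have mu : measurable_fun setT (fun x => dotv (U0 x) (U0 x) / beta).
    by apply: measurable_funM => //; exact: measurable_dotv.
  have mm1 : measurable_fun setT (fun w => dotv c (U0 w) ^+ 2 - 1) by exact: measurable_funB.
  apply: measurable_funD; [apply: measurable_funD; [apply: measurable_funD|]|].
  - by apply: measurable_funD => //; exact: measurable_funM.
  - apply: measurable_funM => //; apply: measurable_funM => //; exact: measurable_funX.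
  - by apply: measurable_funM => //; apply: measurable_funM => //; exact: measurable_funM.
  - by apply: measurable_funM => //; apply: measurable_funM => //; exact: measurable_funX.
pose H1 x := dotv c (U0 x) ^+ 2; pose H2 x := dotv c (U0 x) ^+ 4.
pose k1 := sg * lam - lam ^+ 2.
pose k2 := lam ^+ 2 / 2 + 79 / 2 * lam ^+ 2 / beta * (r%:R / a / 2).
pose k3 := 79 / 2 * lam ^+ 2 / beta * (a / 2) + 229 / 4 * lam ^+ 2 / beta ^+ 2 * r%:R.
pose k0 := 1 - sg * lam + lam ^+ 2 / 2.
have l2 := sqr_ge0 lam.
have a00 := ltW c0.
have b0 : 0 <= 79 / 2 * lam ^+ 2 / beta.
  by apply: divr_ge0; [exact: mulr_ge0 | exact: ltW].
have b1 : 0 <= 229 / 4 * lam ^+ 2 / beta ^+ 2.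
  by apply: divr_ge0; [exact: mulr_ge0 | exact: sqr_ge0].
have k20 : 0 <= k2.
  apply: addr_ge0; first exact: divr_ge0.
  by apply: mulr_ge0 => //; apply: divr_ge0 => //; exact: divr_ge0.
have k30 : 0 <= k3.
  apply: addr_ge0; first by apply: mulr_ge0 => //; exact: divr_ge0.
  exact: mulr_ge0.
have GH x : G x <= k0 + k1 * H1 x + k2 * H2 x + k3 * S4 x.
  have := ler_wpM2l b0 (mix_le x c0); have := ler_wpM2l b1 (norm4_le x).
  rewrite /G /k0 /k1 /k2 /k3 /H1 /H2 -/a.
  set m := dotv c (U0 x); set nn := dotv (U0 x) (U0 x); set s4 := S4 x.
  have a1 : a != 0 by rewrite gt_eqF.
  have be : beta != 0 by rewrite gt_eqF.
  rewrite -subr_ge0 => h1; rewrite -subr_ge0 => h2; rewrite -subr_ge0.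
  have := addr_ge0 h1 h2; congr (0 <= _).
  by field; rewrite a1 be.
have [iH EH] : P.-integrable setT (fun x => (k0 + k1 * H1 x + k2 * H2 x + k3 * S4 x)%:E) /\
    \int[P]_x (k0 + k1 * H1 x + k2 * H2 x + k3 * S4 x) =
      k0 + k1 * a + k2 * \int[P]_x H2 x + k3 * \int[P]_x S4 x.
  have ia : P.-integrable setT (fun=> k0%:E) by exact: finite_measure_integrable_cst.
  have ib := integrableZl measurableT k1 (i2 c).
  have ic := integrableZl measurableT k2 (i4 c).
  have id' := integrableZl measurableT k3 iS4.
  have iab := integrableD measurableT ia ib.
  have iabc := integrableD measurableT iab ic.
  have iH1 : P.-integrable setT (EFin \o H1) by exact: i2.
  have iH2 : P.-integrable setT (EFin \o H2) by exact: i4.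
  split.
    have := integrableD measurableT iabc id'.
    by congr (_.-integrable _ _); apply/funext => x /=; rewrite -!EFinM -!EFinD.
  rewrite RintegralD// RintegralD// RintegralD// !RintegralZl//.
  congr (_ + k1 * _ + _ + _); last exact: E2.
  by rewrite /Rintegral integral_cst_prob.
have iG : P.-integrable setT (EFin \o G).
  apply: le_integrable iH => //; first exact/measurable_EFinP.
  move=> x _; rewrite lee_fin !ger0_norm//; exact: le_trans (G0 x) (GH x).
have EG : \int[P]_x G x <= 1 + bound a.
  apply: le_trans (le_Rintegral measurableT iG iH (fun x _ => GH x)) _.
  rewrite EH; have h2 := ler_wpM2l k20 (E4 c); have h3 := ler_wpM2l k30 ES4.
  apply: (@le_trans _ _ (k0 + k1 * a + k2 * (K * a ^+ 2) + k3 * (K * r%:R))).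
    by rewrite -!addrA !lerD2l lerD.
  rewrite le_eqVlt; apply/orP; left; apply/eqP.
  rewrite /k0 /k1 /k2 /k3 /bound.
  by field; rewrite !gt_eqF.
apply: (@le_trans _ _ (\sum_(i < n) \int[g]_v ln (Wt
    (tuple_of_row (c + (Num.sqrt beta)^-1 *: row_of_tuple v), tuple_of_row (U i w))))).
  apply: ler_sum => i _.
  under eq_Rintegral do rewrite WE.
  exact: (psi_le_integral_ln gg).
apply: (@le_trans _ _ (n%:R * (\int[P]_x G x - 1) + beta * dotv c c / 2 + ln eps^-1)); last first.
  by rewrite -!addrA lerD2r ler_wpM2l//; lra.
apply: HE => //.
- move=> x; have -> : x = tuple_of_row (row_of_tuple x) by rewrite row_of_tupleK.
  under eq_fun do rewrite WE.
  exact: (integrable_ln_smooth_weight gg).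
under eq_integral do rewrite GE.
rewrite addrC subrK /Rintegral fineK//; exact: integrable_fin_num.
Qed.

End WhitenedDeviation.

(** * Calibration of the constants *)

(** After division by n lambda this is all that the deviation bound has to satisfy.
    Here s and b are the two summands of mu, a is the normalized second moment, and
    delta0 (1 - 2 mu) = mu leaves 2 mu delta0 for the terms of second order. *)
Lemma error_balance (R : realFieldType) (sg s b lam mu d0 a : R) :
  (sg = 1) \/ (sg = -1) -> 0 <= s -> 0 < b -> 0 <= lam ->
  mu = s + b -> 4 * mu < 1 -> d0 * (1 - 2 * mu) = mu ->
  lam / 2 <= 1 - 5 / 2 * s - 2 * b ->
  a = 1 - sg * d0 ->
  s / 2 * (1 + a ^+ 2) + lam / 2 * d0 ^+ 2 + a * b <= d0.
Proof.
move=> hsg s0 b0 lam0 muE mu4 d0E hl aE.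
have mu0 : 0 < mu by lra.
have d00 : 0 < d0.
  have : 0 < d0 * (1 - 2 * mu) by rewrite d0E.
  by rewrite pmulr_lgt0//; lra.
have d0h : d0 < 1 / 2.
  have : 0 < (1 / 2 - d0) * (1 - 2 * mu) by lra.
  by rewrite pmulr_lgt0; lra.
have d2 : 0 <= d0 ^+ 2 by exact: sqr_ge0.
have l1 : lam / 2 * d0 ^+ 2 <= (1 - 5 / 2 * s - 2 * b) * d0 ^+ 2 by rewrite ler_wpM2r.
have dd : d0 ^+ 2 * (1 - 2 * mu) = mu * d0 by rewrite expr2 -mulrA d0E mulrC.
have sd : 0 <= s * d0 by rewrite mulr_ge0// ltW.
have bd : 0 <= b * d0 by rewrite mulr_ge0// ltW.
have sdd : 0 <= s * d0 * (1 - d0) by rewrite mulr_ge0//; lra.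
rewrite muE in dd d0E.
have bd2 : 0 <= b * d0 ^+ 2 by rewrite mulr_ge0// ltW.
have sd2 : 0 <= s * d0 ^+ 2 by rewrite mulr_ge0.
by rewrite aE; case: hsg => ->; lra.
Qed.

(** The noise precision beta = lambda n b makes the term linear in r at most
    n lambda a b / 2, so that with beta a / 2 it amounts to n lambda a b, and makes
    the term quadratic in r at most 0.73 D, which the confidence absorbs. Both hold
    for c at least 79 / 2, where b^2 n = 2 c K D; the constant 6.81 gives c = 6.81^2. *)
Lemma calibration_arith (R : realFieldType)
    (K lam n b c D r s d0 sg a beta l : R) :
  0 < K -> 0 < lam -> 0 < n -> 0 < b -> 0 < c -> 0 < D -> 0 <= r <= D -> 0 < a ->
  sg ^+ 2 = 1 -> a = 1 - sg * d0 -> s = (K - 1) * lam -> beta = lam * n * b ->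
  K * D = b ^+ 2 * n / (2 * c) ->
  79 / 2 / (2 * c) <= 1 / 2 -> 229 / 4 / (2 * c) < 73 / 100 ->
  l = n * lam * (s / 2) - 73 / 100 * D ->
  s / 2 * (1 + a ^+ 2) + lam / 2 * d0 ^+ 2 + a * b <= d0 ->
  n * (sg * lam * (a - 1) + lam ^+ 2 / 2 * (K * a ^+ 2 - 2 * a + 1) +
     79 / 2 * lam ^+ 2 * K * a * r / beta +
     229 / 4 * lam ^+ 2 * K * r ^+ 2 / beta ^+ 2)
   + beta * a / 2 + l < 0.
Proof.
move=> K0 lam0 n0 b0 c0 D0 /andP[r0 rD] a0 sg2 aE sE betaE KD c1 c2 lE led.
have KDb : K / (n * b ^+ 2) * D = 1 / (2 * c).
  have -> : K / (n * b ^+ 2) * D = K * D / (n * b ^+ 2) by field; rewrite !gt_eqF.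
  by rewrite KD; field; rewrite !gt_eqF.
have t1 : n * (79 / 2 * lam ^+ 2 * K * a * r / beta) <=
    n * lam * (a * b) * (79 / 2 / (2 * c)).
  have -> : n * lam * (a * b) * (79 / 2 / (2 * c)) =
     79 / 2 * (lam * a / b) * (K * D) by rewrite KD; field; rewrite !gt_eqF.
  have -> : n * (79 / 2 * lam ^+ 2 * K * a * r / beta) =
     79 / 2 * (lam * a / b) * (K * r).
    by rewrite betaE; field; rewrite !gt_eqF.
  rewrite ler_wpM2l//; last by rewrite ler_wpM2l// ltW.
  have h : 0 < lam * a / b by rewrite divr_gt0// mulr_gt0.
  lra.
have t2 : n * (229 / 4 * lam ^+ 2 * K * r ^+ 2 / beta ^+ 2) <=
    229 / 4 / (2 * c) * D.
  have -> : 229 / 4 / (2 * c) * D = 229 / 4 * (K / (n * b ^+ 2)) * D ^+ 2.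
    have -> : 229 / 4 / (2 * c) = 229 / 4 * (1 / (2 * c)) by field; rewrite gt_eqF.
    by rewrite -KDb; ring.
  have -> : n * (229 / 4 * lam ^+ 2 * K * r ^+ 2 / beta ^+ 2) =
      229 / 4 * (K / (n * b ^+ 2)) * r ^+ 2.
    by rewrite betaE; field; rewrite !gt_eqF.
  rewrite ler_wpM2l//; last by rewrite lerXn2r ?nnegrE// ltW.
  have h : 0 < K / (n * b ^+ 2) by rewrite divr_gt0// mulr_gt0// exprn_gt0.
  lra.
have nl0 : 0 < n * lam by rewrite mulr_gt0.
have ab0 : 0 < a * b by rewrite mulr_gt0.
have t3 : n * lam * (a * b) * (79 / 2 / (2 * c)) <= n * lam * (a * b) * (1 / 2).
  by rewrite ler_wpM2l// ltW// mulr_gt0.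
have t4 : 229 / 4 / (2 * c) * D < 73 / 100 * D by rewrite ltr_pM2r.
have t5 := ler_wpM2l (ltW nl0) led.
have e1 : n * (sg * lam * (a - 1)) + n * (lam ^+ 2 / 2 * (K * a ^+ 2 - 2 * a + 1)) =
   n * lam * (- d0 + s / 2 * a ^+ 2 + lam / 2 * d0 ^+ 2).
  have -> : sg * lam * (a - 1) = - (lam * d0) * sg ^+ 2 by rewrite aE; ring.
  have -> : K * a ^+ 2 - 2 * a + 1 = (K - 1) * a ^+ 2 + sg ^+ 2 * d0 ^+ 2.
    by rewrite aE; ring.
  by rewrite sg2 sE; field.
have e2 : beta * a / 2 = n * lam * (a * b) * (1 / 2) by rewrite betaE; field.
rewrite 3!(mulrDr n) e1 e2 lE.
move: t1 t2 t3 t4 t5.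
set A := n * (79 / 2 * _ * _ * _ * _ / _).
set B := n * (229 / 4 * _ * _ * _ / _).
lra.
Qed.

Section Calibration.
Context (R : realType) (K eps : R) (n D r : nat).
Hypothesis K1 : 1 < K.
Hypothesis eps0 : 0 < eps.
Hypothesis eps1 : eps <= 1.
Hypothesis D0 : (0 < D)%N.
Hypothesis rD : (r <= D)%N.
Hypothesis hn : sample_threshold K eps D < n%:R.
Hypothesis mu4 : 4 * mu_bound K eps n D < 1.

Let L := confidence eps D.
Let lam := scale K eps n D.
Let mu := mu_bound K eps n D.
Let d0 := delta0 K eps n D.
Let b := 681 / 100 * Num.sqrt K * Num.sqrt (2 * D%:R / n%:R).
Let s := (K - 1) * lam.

Let D0R : 0 < (D%:R : R). Proof. by rewrite ltr0n. Qed.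
Let n0R : 0 < (n%:R : R).
Proof. by apply: le_lt_trans hn; exact: sqr_ge0. Qed.
Let Km : 0 < K - 1. Proof. by rewrite subr_gt0. Qed.
Let K0 : 0 < K. Proof. exact: lt_trans ltr01 K1. Qed.

Lemma confidence_gt0 : 0 < L.
Proof.
rewrite /L /confidence; have : 0 <= ln eps^-1 by rewrite ln_ge0// invf_ge1.
have := D0R; lra.
Qed.
Let L0 := confidence_gt0.

Lemma scale_gt0 : 0 < lam.
Proof. by rewrite sqrtr_gt0 mulr_gt0// divr_gt0// mulr_gt0. Qed.
Let lam0 := scale_gt0.

Let lamK : lam ^+ 2 * ((K - 1) * n%:R) = 2 * L.
Proof.
rewrite sqr_sqrtr; last by rewrite ltW// mulr_gt0// divr_gt0// mulr_gt0.
by rewrite -/L; field; rewrite !gt_eqF.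
Qed.

Let sE : Num.sqrt (2 * (K - 1) * L / n%:R) = s.
Proof.
rewrite -[RHS]ger0_norm; last by rewrite mulr_ge0// ltW.
rewrite -sqrtr_sqr; congr Num.sqrt.
have -> : s ^+ 2 = (K - 1) * (lam ^+ 2 * ((K - 1) * n%:R)) / n%:R.
  by rewrite /s; field; rewrite gt_eqF.
by rewrite lamK; field; rewrite gt_eqF.
Qed.

Let muE : mu = s + b. Proof. by rewrite /mu /mu_bound -/L sE. Qed.

Let b0 : 0 < b.
Proof.
have h : 0 < 2 * D%:R / (n%:R : R) by rewrite divr_gt0// mulr_gt0.
apply: mulr_gt0; last by rewrite sqrtr_gt0.
by apply: mulr_gt0; [lra | rewrite sqrtr_gt0].
Qed.

Let bK : b ^+ 2 * n%:R = (681 / 100) ^+ 2 * (2 * K * D%:R).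
Proof.
rewrite !exprMn sqr_sqrtr; last exact: ltW.
rewrite sqr_sqrtr; last by rewrite divr_ge0// mulr_ge0// ltW.
by field; rewrite gt_eqF.
Qed.

Let s0 : 0 < s. Proof. by rewrite mulr_gt0. Qed.

Let m2 : 0 < 1 - 2 * mu.
Proof. have := mu4; rewrite -/mu; lra. Qed.

Lemma delta0_gt0 : 0 < d0.
Proof. by rewrite /d0 /delta0 -/mu divr_gt0// muE addr_gt0. Qed.

Let d0E : d0 * (1 - 2 * mu) = mu.
Proof. by rewrite /d0 /delta0 -/mu divfK// gt_eqF. Qed.

Lemma delta0_lt_half : d0 < 1 / 2.
Proof. by rewrite /d0 /delta0 -/mu ltr_pdivrMr//; have := mu4; rewrite -/mu; lra. Qed.

(* The sample size condition divided by sqrt n; the constant 20 exceeds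
   2 * 6.81 * sqrt 2. *)
Let lam_le : lam / 2 <= 1 - 5 / 2 * s - 2 * b.
Proof.
have sn0 : 0 < Num.sqrt (n%:R : R) by rewrite sqrtr_gt0.
have snK : Num.sqrt (n%:R : R) ^+ 2 = n%:R by rewrite sqr_sqrtr// ltW.
have sL : Num.sqrt (2 * (K - 1) * L) = s * Num.sqrt n%:R.
  rewrite -sE -sqrtrM; last by rewrite divr_ge0// ?mulr_ge0 ?ltW.
  by rewrite divfK// gt_eqF.
have bE : b * Num.sqrt n%:R = 681 / 100 * Num.sqrt 2 * (Num.sqrt K * Num.sqrt D%:R).
  rewrite /b; have -> : Num.sqrt (2 * D%:R / n%:R : R) = Num.sqrt 2 * Num.sqrt D%:R / Num.sqrt n%:R.
    rewrite -[_ / Num.sqrt n%:R]ger0_norm ?divr_ge0 ?mulr_ge0//.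
    rewrite -sqrtr_sqr; congr Num.sqrt.
    by rewrite expr_div_n exprMn !sqr_sqrtr// ltW.
  by field; rewrite gt_eqF.
have s2 : Num.sqrt (2 : R) <= 29 / 20.
  have h : 0 <= 29 / 20 :> R by lra.
  rewrite -(ger0_norm h) -sqrtr_sqr ler_wsqrtr//; lra.
have : 20 * Num.sqrt K * Num.sqrt D%:R + (5 / 2 + 1 / (2 * (K - 1))) * (s * Num.sqrt n%:R)
   < Num.sqrt n%:R.
  rewrite -sL; set A := _ + _.
  have A0 : 0 <= A.
    rewrite addr_ge0 ?mulr_ge0// addr_ge0// divr_ge0// mulr_ge0// ltW//.
  rewrite -(ger0_norm A0) -sqrtr_sqr ltr_sqrt//.
move=> h.
have kd : 0 <= Num.sqrt K * Num.sqrt D%:R by rewrite mulr_ge0.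
have h2 : 2 * b * Num.sqrt n%:R <= 20 * Num.sqrt K * Num.sqrt D%:R.
  rewrite -mulrA bE; have := ler_wpM2r kd s2; lra.
have h3 : (5 / 2 + 1 / (2 * (K - 1))) * (s * Num.sqrt n%:R) =
    (5 / 2 * s + lam / 2) * Num.sqrt n%:R.
  by rewrite /s; field; rewrite gt_eqF.
rewrite h3 in h.
have : (2 * b + (5 / 2 * s + lam / 2)) * Num.sqrt n%:R < 1 * Num.sqrt n%:R by lra.
rewrite ltr_pM2r//; lra.
Qed.

(** The inverse variance of the perturbation; it balances its entropy cost against the
    error that it creates. *)
Definition noise_precision : R := lam * n%:R * b.

Lemma noise_precision_gt0 : 0 < noise_precision.
Proof. exact: (mulr_gt0 (mulr_gt0 lam0 n0R) b0). Qed.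

Lemma calibrated_bound (sg : R) : sg = 1 \/ sg = -1 ->
  forall beta a, beta = noise_precision -> a = 1 - sg * d0 ->
  n%:R * (sg * lam * (a - 1) + lam ^+ 2 / 2 * (K * a ^+ 2 - 2 * a + 1) +
     79 / 2 * lam ^+ 2 * K * a * r%:R / beta +
     229 / 4 * lam ^+ 2 * K * r%:R ^+ 2 / beta ^+ 2)
   + beta * a / 2 + ln eps^-1 < 0.
Proof.
move=> hsg beta a betaE aE.
have led := error_balance hsg (ltW s0) b0 (ltW lam0) muE mu4 d0E lam_le aE.
have sg2 : sg ^+ 2 = 1 by case: hsg => ->; rewrite ?expr1n// sqrrN expr1n.
have a0 : 0 < a.
  by have := delta0_gt0; have := delta0_lt_half; rewrite aE; case: hsg => ->; lra.
have rD' : 0 <= (r%:R : R) <= D%:R by rewrite ler0n ler_nat.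
have [c [c0 cK c1 c2]] : exists c : R, [/\ 0 < c, b ^+ 2 * n%:R = c * (2 * K * D%:R),
    79 / 2 / (2 * c) <= 1 / 2 & 229 / 4 / (2 * c) < 73 / 100].
  have c0 : 0 < (681 / 100 : R) ^+ 2 by apply: exprn_gt0; lra.
  have c20 : 0 < 2 * (681 / 100 : R) ^+ 2 by lra.
  exists ((681 / 100) ^+ 2); split => //.
  - by rewrite ler_pdivrMr//; lra.
  - by rewrite ltr_pdivrMr//; lra.
apply: (calibration_arith K0 lam0 n0R b0 c0 D0R rD' a0 sg2 aE erefl betaE _ c1 c2 _ led).
  by rewrite cK; field; rewrite gt_eqF.
have -> : n%:R * lam * ((K - 1) * lam / 2) = L by have := lamK; lra.
by rewrite /L /confidence; ring.
Qed.

End Calibration.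

(** * The two-sided bound on the Gram form *)

(** Every positive rho is admissible, as the sum is that of n nonpositive terms. *)
Lemma Nhat_perp (R : realType) (K eps : R) (n D : nat) (Z : 'M[R]_(n, D))
    (t : 'rV[R]_D) : 0 < scale K eps n D ->
  (forall i, dotv t (row i Z) = 0) -> Nhat K eps Z t = 0.
Proof.
move=> lam0 h; rewrite /Nhat; set A := [set rho | _].
have inA x : 0 < x -> A x.
  move=> x0; split => //; apply: sumr_le0 => i _.
  rewrite h expr0n mulr0 sub0r mulrN1 psi_opp oppr_le0.
  by rewrite -(@psi0 R); apply: psi_nondecreasing; exact: ltW.
have lbA : lbound A 0 by move=> x [/ltW].
have hA : has_lbound A by exists 0.
apply/eqP; rewrite eq_le; apply/andP; split; last first.
  by apply: lb_le_inf => //; exists 1; exact: inA.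
apply/ler_addgt0Pl => e e0; rewrite addr0; apply: ge_inf => //; exact: inA.
Qed.

(** The sum is nondecreasing in 1 / rho, so its sign at two points brackets the infimum
    that defines [Nhat]. *)
Lemma Nhat_bounds (R : realType) (K eps : R) (n D : nat) (Z : 'M[R]_(n, D))
    (t : 'rV[R]_D) (N d0 : R) :
  let S x := \sum_(i < n) psi (scale K eps n D * (x * dotv t (row i Z) ^+ 2 - 1)) in
  0 < scale K eps n D -> 0 < d0 < 1 -> 0 <= N ->
  (N = 0 -> forall i, dotv t (row i Z) = 0) ->
  (forall x, 0 < x -> x * N = 1 - d0 -> S x <= 0) ->
  (forall x, 0 < x -> x * N = 1 + d0 -> 0 < S x) ->
  (1 - d0) * Nhat K eps Z t <= N <= (1 + d0) * Nhat K eps Z t.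
Proof.
move=> S lam0 /andP[d00 d01] N0 Nz Sle Sgt.
have [Nz0|NN0] := eqVneq N 0; first by rewrite Nz0 (Nhat_perp lam0 (Nz Nz0)) !mulr0 lexx.
rewrite /Nhat; set A := [set rho | _].
have SA rho : A rho <-> 0 < rho /\ S rho^-1 <= 0 by [].
have lbA : lbound A 0 by move=> x [/ltW].
have hA : has_lbound A by exists 0.
have Smono x y : x <= y -> S x <= S y.
  move=> xy; apply: ler_sum => i _; apply: psi_nondecreasing.
  by rewrite ler_pM2l// lerD2r ler_wpM2r// sqr_ge0.
have Np : 0 < N by rewrite lt_def NN0.
have d1 : 0 < 1 - d0 by rewrite subr_gt0.
have d2 : 0 < 1 + d0 by rewrite addr_gt0.
have inA : A (N / (1 - d0)).
  apply/SA; split; first exact: divr_gt0.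
  by rewrite invf_div; apply: Sle; [exact: divr_gt0 | rewrite divfK// gt_eqF].
apply/andP; split.
  by rewrite mulrC -ler_pdivlMr//; exact: ge_inf.
rewrite mulrC -ler_pdivrMr//; apply: lb_le_inf; first by exists (N / (1 - d0)).
move=> rho [rho0 Srho]; rewrite leNgt; apply/negP => lt.
have : 0 < S ((1 + d0) / N) by apply: Sgt; [exact: divr_gt0 | rewrite divfK// gt_eqF].
apply/negP; rewrite -leNgt; apply: le_trans Srho; apply: Smono.
rewrite -[leLHS]invf_div lef_pV2 ?posrE//; last exact: divr_gt0.
exact: ltW.
Qed.

(** Take the rows of A to be a maximal G-orthonormal family: the residual of any t is
    G-orthogonal to it, so if it had a positive norm it could be added. This yields
    a square root of G of full rank r without diagonalization. *)
Lemma whitening (R : realType) D (G : 'M[R]_D) :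
  G^T = G -> (forall t, 0 <= qform G t) ->
  exists (r : nat) (A : 'M[R]_(r, D)), [/\ (r <= D)%N,
    A *m G *m A^T = 1%:M,
    (forall t, qform G t = dotv (t *m G *m A^T) (t *m G *m A^T))
  & (forall t, qform G (t - t *m G *m A^T *m A) = 0)].
Proof.
move=> Gs Gp.
pose Pr r := `[< exists A : 'M[R]_(r, D), A *m G *m A^T = 1%:M >].
have P0 : exists r, Pr r.
  by exists 0%N; apply/asboolP; exists 0; apply/matrixP => -[].
have Pb r : Pr r -> (r <= D)%N.
  move=> /asboolP[A AG].
  have : \rank (A *m G *m A^T) = r by rewrite AG mxrank1.
  move=> <-; rewrite -mulmxA; apply: leq_trans (mxrankM_maxl _ _) _.
  exact: rank_leq_col.
case: (ex_maxnP P0 Pb) => r /asboolP[A AG] rmax.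
exists r, A; have vz t : qform G (t - t *m G *m A^T *m A) = 0.
  set v := t - _.
  have vA : v *m G *m A^T = 0.
    by rewrite /v !mulmxBl -!mulmxA [A *m (G *m A^T)]mulmxA AG mulmx1 subrr.
  have Av : A *m G *m v^T = 0.
    have -> : A *m G *m v^T = (v *m G *m A^T)^T by rewrite !trmx_mul trmxK Gs mulmxA.
    by rewrite vA trmx0.
  apply/eqP; apply/negP => /negP qn0.
  have q0 : 0 < qform G v by rewrite lt_def qn0 Gp.
  pose e := (Num.sqrt (qform G v))^-1.
  have : Pr (r + 1)%N.
    apply/asboolP; exists (col_mx A (e *: v)).
    rewrite mul_col_mx tr_col_mx mul_col_row AG linearZ /= -!scalemxAr -!scalemxAl.
    rewrite vA Av !scaler0 (mx11_scalar (v *m G *m v^T)).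
    rewrite -[(v *m G *m v^T) 0 0]/(qform G v) !scale_scalar_mx mulrA.
    have -> : e * e * qform G v = 1.
      by rewrite -expr2 exprVn sqr_sqrtr ?mulVf ?gt_eqF// ltW.
    by rewrite -scalar_mx_block.
  by move=> /rmax; rewrite addn1 ltnn.
split => //; first by apply: Pb; apply/asboolP; exists A.
move=> t; set c := t *m G *m A^T; set v := t - c *m A.
have vA : v *m G *m A^T = 0.
  by rewrite /v /c !mulmxBl -!mulmxA [A *m (G *m A^T)]mulmxA AG mulmx1 subrr.
have -> : t = v + c *m A by rewrite subrK.
have v0 : qform G v = 0 by rewrite /v /c vz.
rewrite qformD// v0 add0r dotvC -dotv_mulmx vA dotvC dotv0l mulr0 add0r.
by rewrite qformE dotvC -dotv_mulmx -(mulmxA c) -(mulmxA c) AG mulmx1.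
Qed.

Lemma probability_setI_ge (R : realType) d (T : measurableType d)
    (P : probability T R) (A B : set T) (a b : R) :
  measurable A -> measurable B -> (a%:E <= P A)%E -> (b%:E <= P B)%E ->
  ((a + b - 1)%:E <= P (A `&` B))%E.
Proof.
move=> mA mB aA bB; have mAB : measurable (A `&` B) by exact: measurableI.
have : (P (~` (A `&` B)) <= P (~` A) + P (~` B))%E.
  by rewrite setCI; apply: measureU2; exact: measurableC.
rewrite !probability_setC//; move: aA bB.
rewrite -(fineK (fin_num_measure P _ mA)) -(fineK (fin_num_measure P _ mB)).
by rewrite -(fineK (fin_num_measure P _ mAB)) -!EFinB -EFinD !lee_fin; lra.
Qed.

Lemma bigsetI_sub (T : Type) (I : finType) (F : I -> set T) i :
  \big[setI/setT]_(j : I) F j `<=` F i.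
Proof. by rewrite (bigD1 i)//= => x []. Qed.

Section GramDeviation.
Context (R : realType) d (T : measurableType d) (P : probability T R)
  (n D : nat) (Zs : 'I_n -> T -> 'rV[R]_D) (Z0 : T -> 'rV[R]_D)
  (G : 'M[R]_D) (K eps : R).
Hypothesis mZs : forall i j, measurable_fun setT (fun w => Zs i w 0 j).
Hypothesis mZ0 : forall j, measurable_fun setT (fun w => Z0 w 0 j).
Hypothesis indepZ : independent P Zs.
Hypothesis lawZ : forall i, same_law P (Zs i) Z0.
Hypothesis GT : G^T = G.
Hypothesis Z2 : forall t, (\int[P]_w (dotv t (Z0 w) ^+ 2)%:E = (qform G t)%:E)%E.
Hypothesis Z4 : forall t,
  (\int[P]_w (dotv t (Z0 w) ^+ 4)%:E <= (K * qform G t ^+ 2)%:E)%E.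
Hypothesis K1 : 1 < K.
Hypothesis eps0 : 0 < eps.
Hypothesis eps1 : eps <= 1.
Hypothesis D0 : (0 < D)%N.
Hypothesis hn : sample_threshold K eps D < n%:R.
Hypothesis mu4 : 4 * mu_bound K eps n D < 1.

Let Zmx w : 'M[R]_(n, D) := \matrix_(i < n) Zs i w.
Let d0 := delta0 K eps n D.

Let Gp t : 0 <= qform G t.
Proof. by rewrite -lee_fin -Z2; apply: integral_ge0 => w _; rewrite lee_fin sqr_ge0. Qed.

Lemma null_direction (v : 'rV[R]_D) (i : 'I_n) : qform G v = 0 ->
  measurable [set w | dotv v (Zs i w) = 0] /\
  P [set w | dotv v (Zs i w) = 0] = 1%E.
Proof.
move=> qv.
have md : measurable_fun setT (fun w => dotv v (Zs i w)) by exact: measurable_dotv.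
have md0 : measurable_fun setT (fun w => dotv v (Z0 w)) by exact: measurable_dotv.
have mB : measurable [set w | dotv v (Zs i w) = 0].
  by rewrite -[X in measurable X]setTI; exact: (md measurableT [set 0]).
split => //.
have e : moment P 2 (fun w => dotv v (Zs i w)) = 0%E.
  rewrite momentE; transitivity (\int[P]_w (dotv v (Z0 w) ^+ 2)%:E)%E; last by rewrite Z2 qv.
  have red (Z : T -> 'rV[R]_D) : (fun w => (dotv v (Z w) ^+ 2)%:E) =
      (fun w => (dotv v (row_of_tuple (tuple_of_row (Z w))) ^+ 2)%:E).
    by apply/funext => w; rewrite tuple_of_rowK.
  rewrite (red (Zs i)) (red Z0); apply: (ge0_integral_same_law (P := P) (Y := fun w => tuple_of_row (Zs i w))
    (Y' := fun w => tuple_of_row (Z0 w))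
    (f := fun x => (dotv v (row_of_tuple x) ^+ 2)%:E)).
  - exact/measurable_fun_tuple_of_row.
  - exact/measurable_fun_tuple_of_row.
  - exact: lawZ.
  - apply/measurable_EFinP/measurable_funX; apply: measurable_dotv => // j.
    exact: measurable_row_of_tuple.
  - by move=> x; rewrite lee_fin sqr_ge0.
have [N [mN PN sub]] := even_moment_eq0 (k := 0) md e.
have mC : measurable (~` [set w | dotv v (Zs i w) = 0]) by exact: measurableC.
have PC : P (~` [set w | dotv v (Zs i w) = 0]) = 0%E.
  by apply: (subset_measure0 mC mN _ PN) => w /= h; apply: sub => /= /(_ I).
have := probability_setC P mC; rewrite setCK PC sube0 => ->; rewrite //.
Qed.

(** [whitened_deviation] for both signs on the whitened sample, intersected with the
    event of probability one on which the sample is orthogonal to the kernel of G.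
    The kernel is spanned by the residuals of the D basis vectors, so finitely many
    directions suffice. *)
Lemma gram_two_sided : exists E : set T,
  [/\ measurable E, ((1 - 2 * eps)%:E <= P E)%E
    & forall w, E w ->
      (forall t, (1 - d0) * Nhat K eps (Zmx w) t <= qform G t
                   <= (1 + d0) * Nhat K eps (Zmx w) t) /\
      (forall t i, qform G t = 0 -> dotv t (Zs i w) = 0)].
Proof.
have [r [A [rD AG qE vE]]] := whitening GT Gp.
pose U i w := Zs i w *m A^T; pose U0 w := Z0 w *m A^T.
have mmx (Z : T -> 'rV[R]_D) : (forall j, measurable_fun setT (fun w => Z w 0 j)) ->
    forall j, measurable_fun setT (fun w => (Z w *m A^T) 0 j).
  move=> mZ j; under eq_fun do rewrite mxE.
  by apply: measurable_sum => k; exact: measurable_funM.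
have mU i j : measurable_fun setT (fun w => U i w 0 j) by exact: mmx.
have mU0 j : measurable_fun setT (fun w => U0 w 0 j) by exact: mmx.
pose phi (v : D.-tuple R) : r.-tuple R := tuple_of_row (row_of_tuple v *m A^T).
have mphi : measurable_fun setT phi.
  apply/measurable_fun_tuple_of_row => j; under eq_fun do rewrite mxE.
  apply: measurable_sum => k; apply: measurable_funM => //.
  exact: measurable_row_of_tuple.
have phiE (Z : T -> 'rV[R]_D) B :
    (fun w => tuple_of_row (Z w *m A^T)) @^-1` B = coords Z @^-1` (phi @^-1` B).
  apply/seteqP; split => w; rewrite /preimage /= /phi;
    by rewrite (_ : coords Z w = tuple_of_row (Z w))// tuple_of_rowK.
have mpre B : measurable B -> measurable (phi @^-1` B).
  by move=> mB; rewrite -[X in measurable X]setTI; exact: mphi.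
have indepU : forall B : 'I_n -> set (r.-tuple R), (forall i, measurable (B i)) ->
  P (\bigcap_(i in [set: 'I_n]) ((fun w => tuple_of_row (U i w)) @^-1` B i)) =
  (\prod_(i < n) P ((fun w => tuple_of_row (U i w)) @^-1` B i))%E.
  move=> B mB; rewrite /U.
  under eq_bigr do rewrite phiE.
  rewrite -indepZ; last by move=> i; exact: mpre.
  by congr (P _); apply: eq_bigcapr => i _; rewrite phiE.
have lawU i B : measurable B ->
    P ((fun w => tuple_of_row (U i w)) @^-1` B) = P ((fun w => tuple_of_row (U0 w)) @^-1` B).
  by move=> mB; rewrite /U /U0 !phiE; apply: lawZ; exact: mpre.
have qcA c : qform G (c *m A) = dotv c c.
  rewrite /qform trmx_mul !mulmxA -(mulmxA c A) -(mulmxA c) AG mulmx1.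
  by rewrite dotvE.
have U2 c : (\int[P]_w (dotv c (U0 w) ^+ 2)%:E = (dotv c c)%:E)%E.
  by under eq_integral do rewrite dotv_mulmx; rewrite Z2 qcA.
have U4 c : (\int[P]_w (dotv c (U0 w) ^+ 4)%:E <= (K * dotv c c ^+ 2)%:E)%E.
  by under eq_integral do rewrite dotv_mulmx; rewrite -qcA.
have lam0 := scale_gt0 K1 eps0 eps1 D0 hn.
have d00 : 0 < d0 := delta0_gt0 K1 eps0 eps1 D0 hn mu4.
have d01 : d0 < 1 / 2 := delta0_lt_half mu4.
have beta0 := noise_precision_gt0 K1 eps0 eps1 D0 hn.
have sg1 : (1 : R) ^+ 2 = 1 by rewrite expr1n.
have [E1 [mE1 PE1 HE1]] := whitened_deviation mU mU0 indepU lawU U2 U4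
  (scale K eps n D) (sg1 : (1 : R) ^+ 2 = 1) beta0 eps0.
have sgN : (- 1 : R) ^+ 2 = 1 by rewrite sqrrN expr1n.
have [E2 [mE2 PE2 HE2]] := whitened_deviation mU mU0 indepU lawU U2 U4
  (scale K eps n D) sgN beta0 eps0.
pose vk (k : 'I_D) : 'rV[R]_D := delta_mx 0 k - delta_mx 0 k *m G *m A^T *m A.
pose F (p : 'I_n * 'I_D) := [set w | dotv (vk p.2) (Zs p.1 w) = 0].
pose E3 := \big[setI/setT]_(p : 'I_n * 'I_D) F p.
have [mE3 PE3] : measurable E3 /\ (1%:E <= P E3)%E.
  rewrite /E3; elim/big_ind: _ => [|X Y [mX PX] [mY PY]|p _].
  - by split => //; rewrite probability_setT.
  - split; first exact: measurableI.
    by have := probability_setI_ge mX mY PX PY; rewrite addrK.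
  - have [mF PF] := null_direction p.1 (vE (delta_mx 0 p.2)).
    by split => //; rewrite /F /vk PF.
exists ((E1 `&` E2) `&` E3).
have mE12 : measurable (E1 `&` E2) by exact: measurableI.
split; first exact: measurableI.
  have h12 := probability_setI_ge mE1 mE2 PE1 PE2.
  have := probability_setI_ge mE12 mE3 h12 PE3.
  by apply: le_trans; rewrite lee_fin; lra.
move=> w [[E1w E2w] E3w].
have vperp t i : dotv (t - t *m G *m A^T *m A) (Zs i w) = 0.
  have -> : t - t *m G *m A^T *m A = \sum_k t 0 k *: vk k.
    rewrite {1 2}(row_sum_delta t) !mulmx_suml -sumrB; apply: eq_bigr => k _.
    by rewrite -!scalemxAl -scalerBr.
  rewrite /dotv; under eq_bigr do rewrite summxE mulr_suml.
  rewrite exchange_big big1// => k _ /=.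
  under eq_bigr do rewrite mxE -mulrA.
  have h : dotv (vk k) (Zs i w) = 0 := @bigsetI_sub _ _ F (i, k) w E3w.
  by rewrite -mulr_sumr -/(dotv (vk k) (Zs i w)) h mulr0.
have dotE t i : dotv t (Zs i w) = dotv (t *m G *m A^T) (U i w).
  rewrite dotv_mulmx; have := vperp t i; rewrite dotvDl dotvNl => /eqP.
  by rewrite subr_eq0 => /eqP.
have rowE i : row i (Zmx w) = Zs i w by rewrite /Zmx rowK.
have dotz t : qform G t = 0 -> forall i, dotv t (row i (Zmx w)) = 0.
  by rewrite qE => /dotv_eq0 c0 i; rewrite rowE dotE c0 dotv0l.
split; last by move=> t i /dotz; rewrite -rowE.
move=> t; set c := t *m G *m A^T.
have scaled (sg : R) (x : R) : sg = 1 \/ sg = -1 -> 0 < x ->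
   (forall c, 0 < dotv c c ->
    \sum_(i < n) psi (sg * scale K eps n D * (dotv c (U i w) ^+ 2 - 1)) <=
      n%:R * (sg * scale K eps n D * (dotv c c - 1)
       + scale K eps n D ^+ 2 / 2 * (K * dotv c c ^+ 2 - 2 * dotv c c + 1) +
     79 / 2 * scale K eps n D ^+ 2 * K * dotv c c * r%:R / noise_precision K eps n D +
     229 / 4 * scale K eps n D ^+ 2 * K * r%:R ^+ 2 / noise_precision K eps n D ^+ 2)
     + noise_precision K eps n D * dotv c c / 2 + ln eps^-1) ->
    x * qform G t = 1 - sg * d0 ->
   \sum_(i < n) psi (sg * (scale K eps n D * (x * dotv t (row i (Zmx w)) ^+ 2 - 1))) < 0.
  move=> hsg x0 dev xN.
  have cc : dotv (Num.sqrt x *: c) (Num.sqrt x *: c) = 1 - sg * d0.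
    by rewrite dotvZl dotvZr mulrA -expr2 sqr_sqrtr ?ltW// -qE.
  have cc0 : 0 < dotv (Num.sqrt x *: c) (Num.sqrt x *: c).
    by rewrite cc; case: hsg => ->; lra.
  have := dev _ cc0; rewrite cc => h.
  have := calibrated_bound K1 eps0 eps1 D0 rD hn mu4 hsg erefl erefl.
  move=> /(le_lt_trans h); congr (_ < 0); apply: eq_bigr => i _.
  by rewrite rowE dotE dotvZl exprMn sqr_sqrtr ?mulrA ?(ltW x0).
have nb := @Nhat_bounds R K eps n D (Zmx w) t (qform G t) d0; cbv zeta in nb.
apply: nb => //.
- by rewrite d00 /=; lra.
- exact: dotz.
- move=> x x0 xN; apply: ltW.
  have := @scaled 1 x (or_introl erefl) x0 (HE1 _ E1w).
  rewrite mul1r => /(_ xN); congr (_ < 0); apply: eq_bigr => i _; by rewrite mul1r.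
- move=> x x0 xN.
  have := @scaled (-1) x (or_intror erefl) x0 (HE2 _ E2w).
  rewrite mulN1r opprK => /(_ xN).
  under eq_bigr do rewrite mulN1r psi_opp.
  by rewrite sumrN oppr_lt0.
Qed.

End GramDeviation.

(** * Existence of the robust Gram matrix *)

Lemma continuous_bigsum (R : realType) (T : topologicalType) (I : Type) (s : seq I)
    (f : I -> T -> R) : (forall i, continuous (f i)) ->
  continuous (fun x => \sum_(i <- s) f i x).
Proof.
move=> cf; elim: s => [|i s ih] x.
  under eq_fun do rewrite big_nil; exact: cvg_cst.
under eq_fun do rewrite big_cons.
by apply: cvgD; [exact: cf | exact: ih].
Qed.

Section MinimalGram.
Context (R : realType) (K eps : R) (n D : nat) (Z : 'M[R]_(n, D)).
Implicit Types H : 'M[R]_D.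

Lemma trace_sym_sqr H : H^T = H -> \tr (H *m H) = \sum_i \sum_j H i j ^+ 2.
Proof.
move=> HT; apply: eq_bigr => i _; rewrite mxE; apply: eq_bigr => j _.
by rewrite -{2}HT mxE expr2.
Qed.

(** The candidates that do at least as well as H0 form a closed set, bounded because
    tr (H^2) is the squared Frobenius norm of a symmetric H, and tr (H^2) is
    continuous. *)
Lemma exists_minimal_gram (Theta : seq 'rV[R]_D) H0 :
  gram_candidate K eps Z Theta H0 -> exists G,
   gram_candidate K eps Z Theta G /\
   forall H, gram_candidate K eps Z Theta H -> \tr (G *m G) <= \tr (H *m H).
Proof.
move=> cH0.
pose h (x : 'rV[R]_(D * D)) : 'M[R]_D := vec_mx x.
have ch i j : continuous (fun x => h x i j).
  move=> x; rewrite /h; under eq_fun do rewrite mxE.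
  exact: (@coord_continuous R 1 (D * D) 0 (mxvec_index i j)).
have ctr : continuous (fun x => \tr (h x *m h x)).
  have -> : (fun x => \tr (h x *m h x)) = (fun x => \sum_i \sum_j h x i j * h x j i).
    by apply/funext => x; apply: eq_bigr => i _; rewrite mxE.
  apply: continuous_bigsum => i; apply: continuous_bigsum => j x.
  by apply: continuousM; [exact: (ch i j) | exact: (ch j i)].
have cq t : continuous (fun x => qform (h x) t).
  have -> : (fun x => qform (h x) t) = (fun x => \sum_j (\sum_i t 0 i * h x i j) * t 0 j).
    by apply/funext => x; rewrite qformE; apply: eq_bigr => j _; rewrite [(t *m h x) 0 j]mxE.
  apply: continuous_bigsum => j x; apply: continuousM; last exact: cst_continuous.
  move: x; apply: continuous_bigsum => i x.
  by apply: continuousM; [exact: cst_continuous | exact: ch].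
have cc i j : continuous (fun x => ((h x)^T *m cokermx Z) i j).
  have -> : (fun x => ((h x)^T *m cokermx Z) i j) =
      (fun x => \sum_k h x k i * cokermx Z k j).
    by apply/funext => x; rewrite mxE; apply: eq_bigr => k _; rewrite [_^T _ _]mxE.
  apply: continuous_bigsum => k x; apply: continuousM; last exact: cst_continuous.
  exact: ch.
have cl_le (f : 'rV[R]_(D * D) -> R) b : continuous f -> closed [set x | f x <= b].
  by move=> /continuous_closedP cf; exact: (cf _ (@closed_le R b)).
have cl_eq (f : 'rV[R]_(D * D) -> R) b : continuous f -> closed [set x | f x = b].
  by move=> /continuous_closedP cf; exact: (cf _ (@closed_eq R b)).
have cl_ge (f : 'rV[R]_(D * D) -> R) b : continuous f -> closed [set x | b <= f x].
  by move=> /continuous_closedP cf; exact: (cf _ (@closed_ge R b)).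
pose A := [set x | gram_candidate K eps Z Theta (h x) /\
   \tr (h x *m h x) <= \tr (H0 *m H0)].
(* The membership in the row space is written as the vanishing of the
   entries of a product, which makes it a closed condition. *)
have AE : A = (\bigcap_(p in [set: 'I_D * 'I_D]) [set x | h x p.1 p.2 - h x p.2 p.1 = 0])
   `&` ((\bigcap_(p in [set: 'I_D * 'I_D]) [set x | ((h x)^T *m cokermx Z) p.1 p.2 = 0])
   `&` ((\bigcap_(t in [set t | t \in Theta])
      [set x | (1 - delta0 K eps n D) * Nhat K eps Z t <= qform (h x) t])
   `&` ((\bigcap_(t in [set t | t \in Theta])
      [set x | qform (h x) t <= (1 + delta0 K eps n D) * Nhat K eps Z t])
   `&` [set x | \tr (h x *m h x) <= \tr (H0 *m H0)]))).
  apply/seteqP; split => x.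
    move=> [[hT hZ hq] ht]; split; [|split; [|split; [|split]]] => //.
    - by move=> [i j] _ /=; rewrite -{1}hT mxE subrr.
    - by move=> [i j] _ /=; move: hZ; rewrite submxE => /eqP ->; rewrite mxE.
    - by move=> t /hq /andP[].
    - by move=> t /hq /andP[].
  move=> [h1 [h2 [h3 [h4 h5]]]]; split => //; split.
  - apply/matrixP => i j; rewrite mxE.
    by have /eqP := h1 (j, i) I; rewrite subr_eq0 => /eqP.
  - by rewrite submxE; apply/eqP/matrixP => i j; rewrite [RHS]mxE; exact: (h2 (i, j) I).
  - by move=> t tT; rewrite (h3 t tT) (h4 t tT).
have clA : closed A.
  rewrite AE; apply: closedI; first apply: closed_bigI => p _.
    apply: cl_eq => x; apply: continuousB; exact: ch.
  apply: closedI; first by apply: closed_bigI => p _; apply: cl_eq.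
  apply: closedI; first by apply: closed_bigI => t _; apply: cl_ge.
  apply: closedI; first by apply: closed_bigI => t _; apply: cl_le.
  exact: cl_le.
have bA : bounded_set A.
  exists (\tr (H0 *m H0) + 1); split; first exact: num_real.
  move=> M hM x [[hT _ _] ht] /=.
  have t0 : 0 <= \tr (h x *m h x).
    by rewrite trace_sym_sqr//; apply: sumr_ge0 => i _; apply: sumr_ge0 => j _; exact: sqr_ge0.
  have M0 : 0 <= M by lra.
  rewrite [leLHS]/Num.norm /= mx_normrE; apply/bigmax_leP; split => // -[i0 k] _ /=.
  case/mxvec_indexP: k => i j; rewrite (ord1 i0).
  have -> : x 0 (mxvec_index i j) = h x i j by rewrite mxE.
  have : h x i j ^+ 2 <= \tr (h x *m h x).
    rewrite trace_sym_sqr// (bigD1 i)//= (bigD1 j)//= -addrA lerDl addr_ge0//.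
      by apply: sumr_ge0 => k _; exact: sqr_ge0.
    by apply: sumr_ge0 => k _; apply: sumr_ge0 => l _; exact: sqr_ge0.
  rewrite -real_normK ?num_real//.
  have := sqr_ge0 (`|h x i j| - 1); nra.
have A0 : A !=set0.
  by exists (mxvec H0); rewrite /A /= /h mxvecK.
have [x] := compact_EVT_min A0 (bounded_closed_compact bA clA)
  (continuous_subspaceT ctr).
rewrite inE => -[cx tx] xmin; exists (h x); split => // H cH.
have [le|lt] := leP (\tr (H *m H)) (\tr (H0 *m H0)); last by rewrite (le_trans tx)// ltW.
have := xmin (mxvec H); rewrite inE /A /= /h mxvecK; exact.
Qed.

End MinimalGram.

(** * Accuracy of the robust Gram matrix *)

Lemma enorm_sqr (R : realType) D (t : 'rV[R]_D) : enorm t ^+ 2 = dotv t t.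
Proof. by rewrite sqr_sqrtr ?dotv_ge0. Qed.

Lemma submx_perp (F : fieldType) m n D (H : 'M[F]_(m, D)) (Z : 'M[F]_(n, D)) :
  (H <= Z)%MS <-> forall t : 'rV[F]_D, t *m Z^T = 0 -> t *m H^T = 0.
Proof.
split=> [/submxP[B ->] t tZ|h]; first by rewrite trmx_mul mulmxA tZ mul0mx.
rewrite submxE; apply/eqP/trmx_inj; rewrite trmx_mul trmx0.
apply/row_matrixP => i; rewrite row_mul row0; apply: h.
by rewrite -row_mul -trmx_mul mulmx_coker trmx0 row0.
Qed.

Lemma enorm_gt0 (R : realType) D (t : 'rV[R]_D) : dotv t t != 0 -> 0 < enorm t.
Proof. by move=> tn; rewrite sqrtr_gt0 lt_def tn dotv_ge0. Qed.

Lemma span_sphere_normalize (R : realType) n D (Z : 'M[R]_(n, D)) (p : 'rV[R]_D) :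
  (p <= Z)%MS -> dotv p p != 0 -> span_sphere Z ((enorm p)^-1 *: p).
Proof.
move=> pZ /enorm_gt0 np; split; first exact: scalemx_sub.
rewrite /enorm dotvZl dotvZr mulrA -expr2 sqrtrM ?sqr_ge0// sqrtr_sqr.
by rewrite -/(enorm p) ger0_norm ?invr_ge0 ?(ltW np)// mulVf// gt_eqF.
Qed.

Lemma span_sphere_eq0 (R : realType) n D (Z : 'M[R]_(n, D)) :
  ~ (span_sphere Z !=set0) -> Z = 0.
Proof.
move=> no; apply/row_matrixP => i; rewrite row0.
have [/dotv_eq0//|rn] := eqVneq (dotv (row i Z) (row i Z)) 0.
by exfalso; apply: no; exists ((enorm (row i Z))^-1 *: row i Z);
  apply: span_sphere_normalize => //; exact: row_sub.
Qed.

(** Here g, h are the values of the two forms at t, and gs, hs their values at a point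
    of the net within distance rho of t. The common oscillation e is of order
    delta0^2 g, as l is at most Nhat t, so the total relative error is 2 delta0 to
    first order, and 2 delta0 / (1 - 2 delta0) covers the higher orders. *)
Lemma accuracy_arith (R : realFieldType) (d g gs e N Nt h hs l : R) :
  0 < d -> d < 1 / 4 -> 0 <= l -> l <= Nt -> (1 - d) * Nt <= g ->
  e <= (1 + d) * d ^+ 2 * l -> `|g - gs| <= e -> `|h - hs| <= e ->
  (1 - d) * N <= gs <= (1 + d) * N -> (1 - d) * N <= hs <= (1 + d) * N ->
  `|h - g| <= 2 * d / (1 - 2 * d) * g.
Proof.
move=> d0 d4 l0 lN Ng eb /ler_normlP[a1 a2] /ler_normlP[b1 b2] /andP[c1 c2] /andP[c3 c4].
have lg : (1 - d) * l <= g by apply: le_trans Ng; rewrite ler_wpM2l//; lra.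
have d1 : 0 < 1 - d by lra.
have d2 : 0 < 1 + d by lra.
have d3 : 0 < 1 - 2 * d by lra.
have eg : (1 - d) * e <= (1 + d) * d ^+ 2 * g.
  apply: (@le_trans _ _ ((1 + d) * d ^+ 2 * ((1 - d) * l))).
    by rewrite [leRHS]mulrCA ler_pM2l.
  by rewrite ler_wpM2l// mulr_ge0 ?sqr_ge0 ?ltW.
have g0 : 0 <= g by apply: le_trans lg; rewrite mulr_ge0// ltW.
have u1 : (1 - d) * (h - e) <= (1 + d) * (g + e).
  apply: (@le_trans _ _ ((1 - d) * ((1 + d) * N))); first by rewrite ler_pM2l//; lra.
  by rewrite mulrCA ler_pM2l//; lra.
have u2 : (1 - d) * (g - e) <= (1 + d) * (h + e).
  apply: (@le_trans _ _ ((1 - d) * ((1 + d) * N))); first by rewrite ler_pM2l//; lra.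
  by rewrite mulrCA ler_pM2l//; lra.
have u3 : (1 - d) ^+ 2 * h <= (1 + d ^+ 2 + 2 * d ^+ 3) * g.
  have : (1 - d) * ((1 - d) * h) <= (1 - d) * ((1 + d) * g + 2 * e) by rewrite ler_pM2l//; lra.
  move=> H; have -> : (1 + d ^+ 2 + 2 * d ^+ 3) * g = (1 - d) * ((1 + d) * g) + 2 * ((1 + d) * d ^+ 2 * g).
    by ring.
  by rewrite expr2 -mulrA; lra.
have u4 : ((1 - d) ^+ 2 - 2 * ((1 + d) * d ^+ 2)) * g <= (1 - d) * (1 + d) * h.
  have : (1 - d) * ((1 - d) * g) <= (1 - d) * ((1 + d) * h + 2 * e) by rewrite ler_pM2l//; lra.
  by move=> H; rewrite mulrBl expr2 -!mulrA; lra.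
rewrite -[2 * d / _ * g]mulrAC ler_pdivlMr// -{1}(gtr0_norm d3) -normrM ler_norml; apply/andP; split.
- have : (1 - 4 * d) * ((1 - d) * (1 + d)) * g <=
     (1 - 2 * d) * ((1 - d) * (1 + d) * h).
    apply: le_trans (_ : (1 - 2 * d) * (((1 - d) ^+ 2 - 2 * ((1 + d) * d ^+ 2)) * g) <= _).
      rewrite [leRHS]mulrA ler_wpM2r//.
      have : 0 <= d ^+ 2 * (1 - 4 * d) by rewrite mulr_ge0 ?sqr_ge0//; lra.
      nra.
    by rewrite ler_pM2l.
  rewrite -subr_ge0 => H.
  have : 0 <= (1 - d) * (1 + d) * ((h - g) * (1 - 2 * d) + 2 * d * g).
    by apply: le_trans H _; rewrite le_eqVlt; apply/orP; left; apply/eqP; ring.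
  by rewrite pmulr_rge0 ?mulr_gt0//; lra.
- have : (1 - 2 * d) * ((1 - d) ^+ 2 * h) <= (1 - d) ^+ 2 * g.
    apply: le_trans (_ : (1 - 2 * d) * ((1 + d ^+ 2 + 2 * d ^+ 3) * g) <= _).
      by rewrite ler_pM2l.
    rewrite mulrA ler_wpM2r//.
    have : 0 <= d ^+ 4 by rewrite exprn_even_ge0.
    lra.
  rewrite -subr_ge0 => H.
  have : 0 <= (1 - d) ^+ 2 * (2 * d * g - (h - g) * (1 - 2 * d)).
    by apply: le_trans H _; rewrite le_eqVlt; apply/orP; left; apply/eqP; ring.
  by rewrite pmulr_rge0 ?exprn_gt0//; lra.
Qed.

Section RobustGramAccuracy.
Context (R : realType) (K eps : R) (n D : nat) (Z : 'M[R]_(n, D)) (G : 'M[R]_D).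
Let N t := Nhat K eps Z t.
Let d0 := delta0 K eps n D.
Hypothesis lam0 : 0 < scale K eps n D.
Hypothesis d0_gt0 : 0 < d0.
Hypothesis d0_lt : d0 < 1 / 4.
Hypothesis GT : G^T = G.
Hypothesis Gp : forall t, 0 <= qform G t.
Hypothesis GN : forall t, (1 - d0) * N t <= qform G t <= (1 + d0) * N t.
Hypothesis Gnull : forall t i, qform G t = 0 -> dotv t (row i Z) = 0.

Lemma qform_eq0_perp t : qform G t = 0 <-> t *m Z^T = 0.
Proof.
split=> [h|h]; first by apply/perp_rows => i; exact: Gnull.
apply/eqP; rewrite eq_le Gp andbT.
have /andP[_] := GN t; rewrite /N Nhat_perp// ?mulr0//; exact/perp_rows.
Qed.

Lemma mulmx_perp (t : 'rV[R]_D) : t *m Z^T = 0 -> t *m G = 0.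
Proof.
move=> /qform_eq0_perp h; apply/rowP => j; rewrite [RHS]mxE.
have := @psd_cauchy_schwarz _ _ G t (delta_mx 0 j) GT Gp.
rewrite h mul0r dotv_delta => le0.
by apply/eqP; rewrite -sqrf_eq0 eq_le le0 sqr_ge0.
Qed.

Lemma gram_is_candidate Theta : gram_candidate K eps Z Theta G.
Proof.
split=> //.
by rewrite GT; apply/submx_perp => t tZ; rewrite GT mulmx_perp.
Qed.

Lemma span_sphere_perp (t : 'rV[R]_D) : span_sphere Z t -> t *m Z^T = 0 -> False.
Proof.
move=> [/submxP[y tE] t1] tZ; have : dotv t t = 0.
  by rewrite dotvE [in X in _ *m X]tE trmx_mul mulmxA tZ mul0mx mxE.
by rewrite -enorm_sqr t1 expr1n => /eqP; rewrite oner_eq0.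
Qed.

Lemma Nhat_ge0 t : 0 <= N t.
Proof.
have /andP[_ h] := GN t; have := le_trans (Gp t) h.
by rewrite pmulr_rge0// addr_gt0.
Qed.

Lemma lambda_min_lower t : span_sphere Z t -> lambda_min_hat K eps Z <= N t.
Proof.
move=> St; apply: ge_inf; last by exists t.
by exists 0 => x [s _ <-]; exact: Nhat_ge0.
Qed.

(** Whitening supplies the lower bound: for t on the unit sphere of V, the
    residual of t is orthogonal to V, hence to t, so that
    1 <= |A|^2 qform G t, where |A| is the Frobenius norm. *)
Lemma lambda_min_gt0 : span_sphere Z !=set0 -> 0 < lambda_min_hat K eps Z.
Proof.
move=> [t0 St0].
have [r [A [_ _ Aq A0]]] := whitening GT Gp.
pose F := \sum_(i < r) \sum_(j < D) A i j ^+ 2.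
have F0 : 0 <= F by apply: sumr_ge0 => i _; apply: sumr_ge0 => j _; exact: sqr_ge0.
have key t : span_sphere Z t -> 1 <= F * qform G t.
  move=> St; have [/submxP[y tE] t1] := St.
  have tt : dotv t t = 1 by rewrite -enorm_sqr t1 expr1n.
  set c := t *m G *m A^T; have vZ := A0 t.
  move/qform_eq0_perp: vZ; rewrite -/c => vZ.
  have e : dotv t (c *m A) = 1.
    have : dotv t (t - c *m A) = 0.
      by rewrite dotvC dotvE {2}tE trmx_mul mulmxA vZ mul0mx mxE.
    by rewrite dotvDr dotvNr tt => h; apply/eqP; rewrite eq_sym -subr_eq0 h.
  have := dotv_cauchy_schwarz t (c *m A); rewrite e expr1n tt mul1r => h.
  by apply: le_trans h _; rewrite Aq; exact: sqnorm_mulmx_le.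
have Fp : 0 < F.
  rewrite lt_def F0 andbT; apply/eqP => Fz.
  by have := key _ St0; rewrite Fz mul0r ler10.
apply: (@lt_le_trans _ _ ((1 + d0)^-1 / F)).
  by rewrite divr_gt0// invr_gt0 addr_gt0.
apply: lb_le_inf; first by exists (N t0); exists t0.
move=> _ [t St <-]; rewrite ler_pdivrMr// -[leLHS]mulr1 ler_pdivrMl ?addr_gt0//.
apply: le_trans (key t St) _; rewrite mulrC [leRHS]mulrA ler_pM2r//.
by have /andP[] := GN t.
Qed.

Lemma trace_le_Nhat e : orthonormal_basis e -> \tr G <= (1 + d0) * \sum_(i < D) N (e i).
Proof.
move=> oe; rewrite -(trace_orthonormal G oe) mulr_sumr.
by apply: ler_sum => i _; have /andP[] := GN (e i).
Qed.

Lemma trace_gt0 : span_sphere Z !=set0 -> 0 < \tr G.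
Proof.
move=> [t St]; rewrite lt_def; apply/andP; split; last first.
  by apply: sumr_ge0 => i _; rewrite -qform_delta.
apply/eqP => tr0; have := frob_le_trace GT Gp; rewrite tr0 expr0n => f0.
apply: (span_sphere_perp St); apply/qform_eq0_perp; rewrite qformE.
have := dotv_mulmx_le G t t => h; apply/eqP; rewrite -sqrf_eq0 eq_le sqr_ge0 andbT.
apply: le_trans h _; apply: mulr_le0_ge0 => //.
by rewrite mulr_ge0 ?dotv_ge0.
Qed.

(** G itself is a candidate, so the minimization problem is feasible; the standard
    basis and the largest admissible mesh serve as witnesses. *)
Lemma exists_robust_gram : span_sphere Z !=set0 -> exists H, robust_gram K eps Z H.
Proof.
move=> ne; pose e (i : 'I_D) : 'rV[R]_D := delta_mx 0 i.
have oe : orthonormal_basis e.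
  by move=> i j; rewrite dotv_delta mxE eqxx eq_sym.
have s0 : 0 < \sum_(i < D) N (e i).
  have := lt_le_trans (trace_gt0 ne) (trace_le_Nhat oe).
  by rewrite pmulr_rgt0// addr_gt0.
pose rho := d0 ^+ 2 * lambda_min_hat K eps Z / (2 * \sum_(i < D) N (e i)).
have rho0 : 0 < rho.
  apply: divr_gt0; apply: mulr_gt0 => //; first exact: exprn_gt0.
  exact: lambda_min_gt0.
have S1 t : span_sphere Z t -> enorm t = 1 by case.
have [Th [Th1 Th2]] := finite_net rho0 S1.
have [H Hm] := exists_minimal_gram (gram_is_candidate Th).
by exists H, e, rho, Th; split; rewrite ?rho0 ?lexx.
Qed.

Lemma dotv_sphere (u v : 'rV[R]_D) : dotv u u = 1 -> dotv v v = 1 -> dotv (u + v) (u + v) <= 4.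
Proof.
move=> u1 v1; have := dotv_cauchy_schwarz u v; rewrite u1 v1 mulr1 => h.
rewrite dotvDl !dotvDr u1 v1 (dotvC v u).
have : dotv u v <= 1 by nra.
lra.
Qed.

(** On the unit sphere of V, the variation of either form over a distance rho is at
    most 2 rho times its Frobenius norm, which minimality bounds by
    (1 + delta0) sum_i Nhat e_i; the choice of rho turns this into
    (1 + delta0) delta0^2 lambda_min_hat. Homogeneity extends the estimate to V, and
    both forms vanish on the orthogonal of V. *)
Lemma robust_gram_accuracy H : robust_gram K eps Z H ->
  H^T = H /\ forall t, `|qform H t - qform G t| <= 2 * d0 / (1 - 2 * d0) * qform G t.
Proof.
move=> [e [rho [Th [oe /andP[rho0 rho_le] ThS Thnet [[HT HZ HN] Hmin]]]]].
split=> //.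
have lp : 0 <= d0 ^+ 2 * lambda_min_hat K eps Z / (2 * \sum_(i < D) N (e i)).
  exact: le_trans (ltW rho0) rho_le.
have S0 : 0 < \sum_(i < D) N (e i).
  rewrite lt_def sumr_ge0 ?andbT => [|i _]; last exact: Nhat_ge0.
  apply/eqP => z; have := lt_le_trans rho0 rho_le.
  by rewrite -/(N _) z mulr0 invr0 mulr0 ltxx.
have fG : frob G <= ((1 + d0) * \sum_(i < D) N (e i)) ^+ 2.
  apply: le_trans (frob_le_trace GT Gp) _.
  rewrite ler_sqr ?nnegrE ?(trace_le_Nhat oe)//; first last.
  - by rewrite mulr_ge0 ?(ltW S0)// addr_ge0// ltW.
  - by apply: sumr_ge0 => i _; rewrite -qform_delta.
have fH : frob H <= ((1 + d0) * \sum_(i < D) N (e i)) ^+ 2.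
  apply: le_trans fG; rewrite /frob -!trace_sym_sqr//.
  exact: Hmin (gram_is_candidate Th).
have l0 : 0 < lambda_min_hat K eps Z.
  have w : 0 < (2 * \sum_(i < D) N (e i))^-1 by rewrite invr_gt0 mulr_gt0.
  have := lt_le_trans rho0 rho_le; rewrite pmulr_lgt0//.
  by rewrite pmulr_rgt0// exprn_gt0.
have rhoS : 2 * rho * ((1 + d0) * \sum_(i < D) N (e i)) <=
    (1 + d0) * d0 ^+ 2 * lambda_min_hat K eps Z.
  move: rho_le; rewrite ler_pdivlMr ?mulr_gt0// => h.
  rewrite [leLHS](_ : _ = (1 + d0) * (rho * (2 * \sum_(i < D) N (e i)))); last by ring.
  by rewrite -mulrA ler_pM2l ?addr_gt0.
have close (M : 'M[R]_D) t s : M^T = M ->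
    frob M <= ((1 + d0) * \sum_(i < D) N (e i)) ^+ 2 ->
    dotv t t = 1 -> dotv s s = 1 -> enorm (t - s) <= rho ->
    `|qform M t - qform M s| <= 2 * rho * ((1 + d0) * \sum_(i < D) N (e i)).
  move=> MT fM t1 s1 ts; rewrite qformB//.
  have b0 : 0 <= 2 * rho * ((1 + d0) * \sum_(i < D) N (e i)).
    by rewrite !mulr_ge0 ?(ltW rho0) ?(ltW S0)// addr_ge0// ltW.
  rewrite -(ler_pXn2r (n := 2)) ?nnegrE// real_normK ?num_real//.
  apply: le_trans (dotv_mulmx_le _ _ _) _; rewrite exprMn mulrC.
  apply: ler_pM => //; rewrite ?frob_ge0 ?mulr_ge0 ?dotv_ge0//.
  rewrite exprMn mulrC; apply: ler_pM; rewrite ?dotv_ge0//.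
    by have := dotv_sphere t1 s1; rewrite -[leRHS]/(4%:R) expr2 -natrM.
  by rewrite -enorm_sqr ler_sqr ?nnegrE ?sqrtr_ge0// ltW.
have sphere t : span_sphere Z t ->
    `|qform H t - qform G t| <= 2 * d0 / (1 - 2 * d0) * qform G t.
  move=> St; have [s sT ts] := Thnet t St; have Ss := ThS s sT.
  have t1 : dotv t t = 1 by rewrite -enorm_sqr (proj2 St) expr1n.
  have s1 : dotv s s = 1 by rewrite -enorm_sqr (proj2 Ss) expr1n.
  have /andP[tl _] := GN t.
  exact: (accuracy_arith d0_gt0 d0_lt (ltW l0) (lambda_min_lower St) tl rhoS
    (close _ _ _ GT fG t1 s1 ts) (close _ _ _ HT fH t1 s1 ts) (GN s) (HN s sT)).
move=> t; have [p [q [-> pZ qZ]]] := row_space_decomposition Z t.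
have qG := mulmx_perp qZ.
have qH : q *m H = 0.
  by rewrite -[H]trmxK; move/submx_perp: HZ; apply.
have red (M : 'M[R]_D) : M^T = M -> q *m M = 0 -> qform M (p + q) = qform M p.
  by move=> MT qM; rewrite addrC qformD// qM dotv0l mulr0 addr0 qformE qM dotv0l add0r.
rewrite !red//.
have [p0|pn] := eqVneq (dotv p p) 0.
  rewrite (dotv_eq0 p0).
  by rewrite !qformE !mul0mx !dotv0l subrr normr0 mulr0.
have np := enorm_gt0 pn.
have pE : p = enorm p *: ((enorm p)^-1 *: p).
  by rewrite scalerA divff ?scale1r// gt_eqF.
have Sp := span_sphere_normalize pZ pn.
rewrite pE !(qformZ _ (enorm p)) -mulrBr normrM ger0_norm ?sqr_ge0// [leRHS]mulrCA.
by rewrite ler_pM2l ?exprn_gt0//; exact: sphere.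
Qed.

End RobustGramAccuracy.

(** * Least squares for two nearby quadratic forms *)

Lemma join_vecD (R : realType) d (u v : 'rV[R]_d) a b :
  join_vec (u + v) (a + b) = join_vec u a + join_vec v b.
Proof. by rewrite /join_vec add_row_mx raddfD. Qed.

Lemma join_vecZ (R : realType) d (a b : R) (u : 'rV[R]_d) :
  join_vec (a *: u) (a * b) = a *: join_vec u b.
Proof. by rewrite /join_vec scale_row_mx scale_scalar_mx. Qed.

Section QuadraticRegression.
Context (R : realType) (d : nat).
Implicit Types (G H : 'M[R]_(d + 1)) (theta u : 'rV[R]_d).

(** The increase of the form along x u is 2 b x + c x^2 with b the left-hand side, so
    its nonnegativity forces b = 0. *)
Lemma normal_equations H theta : H^T = H -> (forall t, 0 <= qform H t) ->
  argmin (fun x => qform H (join_vec x 1)) theta ->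
  forall u, dotv (join_vec u 0 *m H) (join_vec theta 1) = 0.
Proof.
move=> HT Hp am u; apply/eqP; rewrite -sqrf_eq0 eq_le sqr_ge0 andbT.
have := @discriminant_le R 0 (dotv (join_vec u 0 *m H) (join_vec theta 1)) _ (Hp (join_vec u 0)).
rewrite mul0r; apply=> x; have := am (x *: u + theta).
rewrite -{2}[1]add0r join_vecD -{1}(mulr0 x) join_vecZ qformD// qformZ.
by rewrite -scalemxAl dotvZl; lra.
Qed.

Lemma normal_equations_argmin H theta : H^T = H -> (forall t, 0 <= qform H t) ->
  (forall u, dotv (join_vec u 0 *m H) (join_vec theta 1) = 0) ->
  forall u, qform H (join_vec (theta + u) 1) =
    qform H (join_vec theta 1) + qform H (join_vec u 0).
Proof.
move=> HT Hp ne u.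
by rewrite -[in LHS](addr0 1) join_vecD addrC qformD// ne mulr0 addr0 addrC.
Qed.

(** The normal equations are solvable although H may be singular: a vector that
    annihilates the matrix of the system is isotropic for H, hence also
    annihilates its right-hand side. *)
Lemma argmin_nonempty H : H^T = H -> (forall t, 0 <= qform H t) ->
  argmin (fun x => qform H (join_vec x 1)) !=set0.
Proof.
move=> HT Hp; pose E : 'M[R]_(d, d + 1) := row_mx 1%:M 0.
have EE u : join_vec u 0 = u *m E.
  by rewrite /E mul_mx_row mulmx1 mulmx0 /join_vec raddf0.
pose M := E *m H *m E^T; pose b := join_vec 0 1 *m H *m E^T.
have MT : M^T = M by rewrite /M !trmx_mul trmxK HT mulmxA.
have : (- b <= M)%MS.
  apply/submx_perp => t; rewrite MT => tM.
  have q0 : qform H (t *m E) = 0.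
    rewrite /qform trmx_mul !mulmxA -(mulmxA t) -(mulmxA t); rewrite -/M; by rewrite tM mul0mx mxE.
  have tEH : t *m E *m H = 0.
    apply/rowP => j; rewrite [RHS]mxE.
    have := @psd_cauchy_schwarz _ _ H (t *m E) (delta_mx 0 j) HT Hp.
    rewrite q0 mul0r dotv_delta => le0.
    by apply/eqP; rewrite -sqrf_eq0 eq_le le0 sqr_ge0.
  rewrite /b linearN /= !trmx_mul trmxK HT mulmxN !mulmxA tEH mul0mx oppr0 //.
move=> /submxP[th0 th0E]; exists th0 => theta.
have ne u : dotv (join_vec u 0 *m H) (join_vec th0 1) = 0.
  rewrite dotvE -[th0]addr0 -[1]add0r join_vecD !EE linearD /= mulmxDr.
  have -> : u *m E *m H *m (join_vec 0 1)^T = (b *m u^T)^T.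
    by rewrite /b !trmx_mul !trmxK HT !mulmxA.
  have -> : u *m E *m H *m (th0 *m E)^T = (th0 *m M *m u^T)^T.
    by rewrite [in RHS]trmx_mul [(_ *m M)^T]trmx_mul MT trmxK trmx_mul /M !mulmxA.
  by rewrite -linearD /= -mulmxDl -th0E addNr mul0mx trmx0 mxE.
rewrite -[theta](subrKC th0) normal_equations_argmin//.
by rewrite lerDl.
Qed.

(** Polarization: 4 x (B - B')(u, v) is the difference of the errors at v + x u and at
    v - x u, each at most del times the value of G, and the cross terms of G cancel
    in the sum. The discriminant in x gives the product form. *)
Lemma form_perturbation G H (del : R) (u v : 'rV[R]_(d + 1)) : G^T = G -> H^T = H ->
  0 <= del -> (forall t, 0 <= qform G t) ->
  (forall t, `|qform H t - qform G t| <= del * qform G t) ->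
  (dotv (u *m G) v - dotv (u *m H) v) ^+ 2 <= del ^+ 2 * (qform G u * qform G v).
Proof.
move=> GT HT del0 Gp HG.
rewrite [leRHS](_ : _ = del * qform G v * (del * qform G u)); last by ring.
apply: discriminant_le => [|x]; first exact: mulr_ge0.
have /ler_normlP[_ h1] := HG (v + x *: u); have /ler_normlP[h2 _] := HG (v - x *: u).
have e (M : 'M[R]_(d + 1)) : M^T = M -> qform M (v + x *: u) =
    qform M v + 2 * x * dotv (u *m M) v + x ^+ 2 * qform M u.
  by move=> MT; rewrite addrC qformD// qformZ -scalemxAl dotvZl; ring.
have e' (M : 'M[R]_(d + 1)) : M^T = M -> qform M (v - x *: u) =
    qform M v - 2 * x * dotv (u *m M) v + x ^+ 2 * qform M u.
  by move=> MT; rewrite addrC -scaleNr qformD// qformZ -scalemxAl dotvZl; ring.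
rewrite !e// in h1; rewrite !e'// in h2.
lra.
Qed.

(** With u the difference of the two minimizers, both normal equations express the
    excess risk N(u) as the value at (u, theta1) of the difference of the bilinear
    forms, so [form_perturbation] gives N(u) <= del^2 (N(u) + r), where r is the
    least risk. *)
Lemma regression_excess_risk G H (del : R) theta0 theta1 : G^T = G -> H^T = H ->
  0 <= del -> del < 1 -> (forall t, 0 <= qform G t) ->
  (forall t, `|qform H t - qform G t| <= del * qform G t) ->
  argmin (fun x => qform G (join_vec x 1)) theta0 ->
  argmin (fun x => qform H (join_vec x 1)) theta1 ->
  qform G (join_vec theta1 1) - qform G (join_vec theta0 1) <=
    del ^+ 2 / (1 - del) ^+ 2 * qform G (join_vec theta0 1).
Proof.
move=> GT HT del0 del1 Gp HG a0 a1.
have Hp t : 0 <= qform H t.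
  have /ler_normlP[h _] := HG t; have : del * qform G t <= 1 * qform G t.
    by rewrite ler_wpM2r// ltW.
  lra.
pose u := theta1 - theta0; have tE : theta1 = theta0 + u by rewrite addrC subrK.
have n0 := normal_equations GT Gp a0; have n1 := normal_equations HT Hp a1 u.
have exc : qform G (join_vec theta1 1) =
   qform G (join_vec theta0 1) + qform G (join_vec u 0).
  by rewrite tE normal_equations_argmin.
have Bu : dotv (join_vec u 0 *m G) (join_vec theta1 1) = qform G (join_vec u 0).
  have -> : join_vec theta1 1 = join_vec theta0 1 + join_vec u 0.
    by rewrite -join_vecD addr0 -tE.
  by rewrite dotvDr n0 add0r qformE.
have := @form_perturbation G H del (join_vec u 0) (join_vec theta1 1) GT HT del0 Gp HG.
rewrite n1 subr0 Bu exc.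
move: (Gp (join_vec u 0)) (Gp (join_vec theta0 1)).
move: (qform G (join_vec u 0)) (qform G (join_vec theta0 1)) => N r N0 r0 h.
rewrite addrAC subrr add0r mulrAC ler_pdivlMr ?exprn_gt0 ?subr_gt0//.
have [->|Nn] := eqVneq N 0; first by rewrite mul0r mulr_ge0 ?sqr_ge0.
have Np : 0 < N by rewrite lt_def Nn.
have : N <= del ^+ 2 * (r + N).
  by rewrite -(ler_pM2l Np) -expr2 [leRHS]mulrCA.
have : 0 <= del * (1 - del) * N by rewrite !mulr_ge0// subr_ge0 ltW.
nra.
Qed.

End QuadraticRegression.

(** * Moments in the regression model *)

Section SecondMoments.
Context (R : realType) (d : measure_display) (T : measurableType d).
Context (P : probability T R) (D : nat) (Z : T -> 'rV[R]_D).
Hypothesis mZ : forall j, measurable_fun setT (fun w => Z w 0 j).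
Hypothesis Z2 : forall j, (moment P 2 (fun w => Z w 0%R j) < +oo)%E.

Definition gram : 'M[R]_D := \matrix_(i, j) \int[P]_w (Z w 0 i * Z w 0 j).

Lemma gram_sym : gram^T = gram.
Proof.
by apply/matrixP => i j; rewrite !mxE; apply: eq_Rintegral => w _; rewrite mulrC.
Qed.

Let iZ i j : P.-integrable setT (EFin \o (fun w => Z w 0 i * Z w 0 j)).
Proof.
have sq k : P.-integrable setT (EFin \o (fun w => Z w 0 k ^+ 2)).
  apply/integrableP; split; first exact/measurable_EFinP/measurable_funX.
  under eq_integral do rewrite gee0_abs ?lee_fin ?sqr_ge0//.
  by have := Z2 k; rewrite momentE.
apply: (@le_integrable _ _ _ _ _ _ _ (EFin \o (fun w => Z w 0 i ^+ 2 + Z w 0 j ^+ 2))) => //.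
- by apply/measurable_EFinP; exact: measurable_funM.
- move=> w _ /=; rewrite lee_fin [leRHS]ger0_norm ?addr_ge0 ?sqr_ge0//.
  have := sqr_ge0 (Z w 0 i - Z w 0 j); have := sqr_ge0 (Z w 0 i + Z w 0 j).
  have := sqr_ge0 (Z w 0 i); have := sqr_ge0 (Z w 0 j).
  by rewrite ler_norml; nra.
- exact: integrableD (sq i) (sq j).
Qed.

Lemma gramE t : moment P 2 (fun w => dotv t (Z w)) = (qform gram t)%:E.
Proof.
pose F (p : 'I_D * 'I_D) w := t 0 p.1 * t 0 p.2 * (Z w 0 p.1 * Z w 0 p.2).
have iF p : P.-integrable setT (EFin \o F p).
  have -> : EFin \o F p =
    (fun w => ((t 0 p.1 * t 0 p.2)%:E * (EFin \o (fun w => Z w 0 p.1 * Z w 0 p.2)%R) w)%E).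
    by apply/funext => w /=; rewrite -EFinM.
  exact: integrableZl.
have sE w : dotv t (Z w) ^+ 2 = \sum_p F p w.
  rewrite expr2 /dotv mulr_suml.
  rewrite -(pair_bigA _ (fun i j => F (i, j) w)) /=; apply: eq_bigr => i _.
  by rewrite mulr_sumr; apply: eq_bigr => j _; rewrite /F /=; ring.
have qE : qform gram t = \sum_p \int[P]_w F p w.
  rewrite qformE /dotv -(pair_bigA _ (fun i j => \int[P]_w F (i, j) w)) exchange_big /=.
  apply: eq_bigr => j _; rewrite mxE mulr_suml; apply: eq_bigr => i _.
  by rewrite mxE /F /= RintegralZl//; ring.
rewrite momentE qE -Rintegral_sum// /Rintegral fineK.
  by apply: eq_integral => w _; rewrite sE.
apply: integrable_fin_num => //.
have -> : (fun w => (\sum_p F p w)%:E) = (fun w => (\sum_p (F p w)%:E)%E).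
  by apply/funext => w /=; rewrite sumEFin.
by apply: integrable_sum => // p _; exact: iF.
Qed.

End SecondMoments.

Lemma dotv_join (R : realType) d (theta x : 'rV[R]_d) (xi y : R) :
  dotv (join_vec theta xi) (join_vec x y) = dotv theta x + xi * y.
Proof.
rewrite !dotvE /join_vec tr_row_mx mul_row_col tr_scalar_mx -scalar_mxM mxE.
by congr (_ + _); rewrite mxE eqxx mulr1n.
Qed.

Section LeastSquares.
Context (R : realType) (dsp : measure_display) (T : measurableType dsp).
Context (P : probability T R) (d : nat) (X : T -> 'rV[R]_d) (Y : T -> R).
Context (thetastar : 'rV[R]_d) (k1 k2 : R).
Hypothesis mXY : random_vector (obs X Y).
Hypothesis finXY : finite_second_moments P X Y.
Hypothesis minXY : argmin (risk P X Y) thetastar.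
Hypothesis k1E : kappa1 P X = k1%:E.
Hypothesis k2E : kappa2 P X Y thetastar = k2%:E.

Let Z := obs X Y.
Let G := gram P Z.

Lemma measurable_obs j : measurable_fun setT (fun w => Z w 0 j).
Proof. by apply: (measurable_fun_tuple_of_row Z).1. Qed.

Lemma obs_second_moment j : (moment P 2 (fun w => Z w 0%R j) < +oo)%E.
Proof.
have [fX fY] := finXY; rewrite -(fintype.splitK j); case: (fintype.split j) => k /=.
  rewrite (_ : (fun w => Z w 0 _) = (fun w => X w 0 k)) ?fX//.
  by apply/funext => w; rewrite /Z /obs /join_vec row_mxEl.
rewrite (_ : moment P 2 _ = moment P 2 Y) ?fY// !momentE.
apply: eq_integral => w _; congr (EFin _).
by rewrite /Z /obs /join_vec row_mxEr ord1 mxE eqxx mulr1n sqrrN.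
Qed.

Lemma obs_gram t : moment P 2 (fun w => dotv t (Z w)) = (qform G t)%:E.
Proof. exact: gramE measurable_obs obs_second_moment t. Qed.

Lemma obs_gram_ge0 t : 0 <= qform G t.
Proof. by rewrite -lee_fin -obs_gram (even_moment_ge0 P 1). Qed.

Let mdot t : measurable_fun setT (fun w => dotv t (Z w)).
Proof. by apply: measurable_dotv => // j; exact: measurable_obs. Qed.

Lemma moment_residual k theta : moment P k.*2 (residual X Y theta) =
  moment P k.*2 (fun w => dotv (join_vec theta 1) (Z w)).
Proof.
rewrite !momentE; apply: eq_integral => w _; congr (EFin _).
rewrite -mul2n !exprM /Z /obs dotv_join /residual mul1r.
by congr (_ ^+ _); rewrite -sqrrN; congr (_ ^+ _); ring.
Qed.

Lemma risk_gram theta : risk P X Y theta = qform G (join_vec theta 1).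
Proof. by rewrite /risk (moment_residual 1) obs_gram. Qed.

Lemma obs_argmin : argmin (fun x => qform G (join_vec x 1)) thetastar.
Proof. by move=> x /=; rewrite -!risk_gram; exact: minXY. Qed.

Lemma kappa1_ge0 : 0 <= k1.
Proof.
rewrite -lee_fin -k1E; apply: (@le_trans _ _ (moment P 4 (fun w => dotv 0 (X w)))).
  exact: (even_moment_ge0 P 2).
apply: ereal_sup_ubound; exists 0 => //=.
rewrite momentE; under eq_integral do rewrite dotv0l expr0n /=.
by rewrite integral_cst_prob lee_fin.
Qed.

(** Homogeneity reduces to a linear form with unit second moment; a linear form with
    zero second moment vanishes almost surely. *)
Lemma moment4_direction theta :
  (moment P 4 (fun w => dotv (join_vec theta 0) (Z w)) <=
    (k1 * qform G (join_vec theta 0) ^+ 2)%:E)%E.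
Proof.
have e x w : dotv (join_vec x 0) (Z w) = dotv x (X w).
  by rewrite /Z /obs dotv_join mul0r addr0.
have s0 := obs_gram_ge0 (join_vec theta 0).
have := obs_gram (join_vec theta 0); move: s0.
move: (qform G (join_vec theta 0)) => s s0 sE.
have [sz|sn] := eqVneq s 0.
  rewrite sz in sE; rewrite (@even_moment0 _ _ _ _ 3)//; last first.
    exact: (@even_moment_eq0 _ _ _ _ 0).
  by rewrite sz expr0n mulr0.
have sp : 0 < s by rewrite lt_def sn.
pose r := (Num.sqrt s)^-1.
have r2 : r ^+ 2 = s^-1 by rewrite exprVn sqr_sqrtr.
have rE w : dotv (r *: theta) (X w) = r * dotv (join_vec theta 0) (Z w).
  by rewrite dotvZl e.
have le2 : (moment P 2 (fun w => dotv (r *: theta) (X w)) <= 1)%E.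
  rewrite (_ : (fun w => dotv (r *: theta) (X w)) =
    (fun w => r * dotv (join_vec theta 0) (Z w))); last by apply/funext.
  by rewrite (@momentZ _ _ _ _ 1)// sE -EFinM lee_fin r2 mulVf.
have : (moment P 4 (fun w => dotv (r *: theta) (X w)) <= k1%:E)%E.
  by rewrite -k1E; apply: ereal_sup_ubound; exists (r *: theta).
rewrite (_ : (fun w => dotv (r *: theta) (X w)) =
    (fun w => r * dotv (join_vec theta 0) (Z w))); last by apply/funext.
rewrite (@momentZ _ _ _ _ 2)//.
have -> : r ^+ 2.*2 = (s ^+ 2)^-1 by rewrite -[2.*2]/(2 * 2)%N exprM r2 exprVn.
rewrite -lee_pdivlMl ?invr_gt0 ?exprn_gt0// invrK.
by rewrite -EFinM mulrC.
Qed.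

Lemma kappa2_gt0 : 0 < k2 ->
  [/\ 0 < qform G (join_vec thetastar 1) &
   moment P 4 (fun w => dotv (join_vec thetastar 1) (Z w)) =
    (k2 * qform G (join_vec thetastar 1) ^+ 2)%:E].
Proof.
move: k2E; rewrite /kappa2 (moment_residual 1) (moment_residual 2) obs_gram lte_fin.
case: ifPn => [s0 e _|_ [<-]]; last by rewrite ltxx.
split => //; set m4 := moment P _ _ in e *.
have s2 : (qform G (join_vec thetastar 1) ^+ 2 != 0) by rewrite expf_neq0// gt_eqF.
move: e; rewrite -EFin_expe inver (negbTE s2) => e.
have : m4 \is a fin_num.
  rewrite fin_numE; apply/andP; split; apply/eqP => h; move: e; rewrite h.
    by rewrite gt0_mulNye// lte_fin invr_gt0 exprn_gt0.
  by rewrite gt0_mulye// lte_fin invr_gt0 exprn_gt0.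
case: m4 e => // r e _; move: e; rewrite -EFinM => -[<-].
by rewrite divfK.
Qed.

Lemma kappa2_ge0 : 0 <= k2.
Proof.
rewrite -lee_fin -k2E /kappa2; case: ifPn => // h.
rewrite mule_ge0 ?(even_moment_ge0 P 2)// inve_ge0.
by rewrite expe_ge0// (even_moment_ge0 P 1).
Qed.

Lemma moment4_residual :
  (moment P 4 (fun w => dotv (join_vec thetastar 1) (Z w)) <=
    (k2 * qform G (join_vec thetastar 1) ^+ 2)%:E)%E.
Proof.
have [k20|k2n] := eqVneq k2 0; last first.
  by have [|_ ->] := kappa2_gt0; rewrite // lt_def k2n kappa2_ge0.
have s0 := obs_gram_ge0 (join_vec thetastar 1).
have [s1|sn] := eqVneq (qform G (join_vec thetastar 1)) 0.
  rewrite (@even_moment0 _ _ _ _ 3)//; last first.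
    by apply: (@even_moment_eq0 _ _ _ _ 0) => //; rewrite obs_gram s1.
  by rewrite lee_fin s1 expr0n mulr0.
have sp : 0 < qform G (join_vec thetastar 1) by rewrite lt_def sn.
move: k2E; rewrite /kappa2 (moment_residual 1) (moment_residual 2) obs_gram lte_fin sp k20.
have s2 : (qform G (join_vec thetastar 1) ^+ 2 != 0) by rewrite expf_neq0.
rewrite -EFin_expe inver (negbTE s2) => /eqP; rewrite mule_eq0 => /orP[/eqP ->|].
  by rewrite mul0r.
by rewrite eqe invr_eq0 (negbTE s2).
Qed.

(** At (thetastar, 1) the linear form is minus the residual. Subtracting xi times it
    from the form at (theta, xi) leaves a linear form in X, orthogonal to the
    residual by the normal equations; so the second moments add up, and
    [moment4_add] applies. *)
Lemma obs_kurtosis t :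
  (moment P 4 (fun w => dotv t (Z w)) <= (kurt k1 k2 * qform G t ^+ 2)%:E)%E.
Proof.
have [theta [xi ->]] : exists theta xi, t = join_vec theta xi.
  exists (lsubmx t), (rsubmx t 0 0); rewrite /join_vec -mx11_scalar.
  by rewrite hsubmxK.
pose u := theta - xi *: thetastar.
have tE : join_vec theta xi = join_vec u 0 + xi *: join_vec thetastar 1.
  by rewrite -join_vecZ mulr1 -join_vecD subrK add0r.
have -> : (fun w => dotv (join_vec theta xi) (Z w)) =
    (fun w => dotv (join_vec u 0) (Z w) + xi * dotv (join_vec thetastar 1) (Z w)).
  by apply/funext => w; rewrite tE dotvDl dotvZl.
have -> : qform G (join_vec theta xi) =
    qform G (join_vec u 0) + xi ^+ 2 * qform G (join_vec thetastar 1).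
  rewrite tE qformD ?gram_sym// qformZ dotvZr.
  by rewrite (normal_equations (gram_sym P Z) obs_gram_ge0 obs_argmin) !mulr0 addr0.
apply: moment4_add => //.
- exact: measurable_funM.
- exact: kappa1_ge0.
- exact: kappa2_ge0.
- exact: obs_gram.
- by rewrite (@momentZ _ _ _ _ 1)// obs_gram.
- exact: moment4_direction.
- rewrite (@momentZ _ _ _ _ 2)//.
  apply: le_trans (lee_wpmul2l _ moment4_residual) _.
    by rewrite lee_fin exprn_even_ge0.
  rewrite -EFinM lee_fin le_eqVlt; apply/orP; left; apply/eqP.
  by rewrite -[2.*2]/(2 * 2)%N exprM; ring.
Qed.

(** A kurtosis is at least 1 by [sqr_moment2_le]; positivity of k1 provides a
    direction in which the linear form does not vanish. *)
Lemma kappa1_ge1 : 0 < k1 -> 1 <= k1.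
Proof.
move=> k10; have [theta hs] : exists theta, 0 < qform G (join_vec theta 0).
  apply: contrapT => no; have z theta : qform G (join_vec theta 0) = 0.
    apply/eqP; rewrite eq_le obs_gram_ge0 andbT leNgt; apply/negP => h.
    by apply: no; exists theta.
  have : (kappa1 P X <= 0)%E.
    apply: ge_ereal_sup => _ [theta _ <-].
    rewrite (_ : (fun w => dotv theta (X w)) = (fun w => dotv (join_vec theta 0) (Z w))).
      by apply: le_trans (moment4_direction _) _; rewrite z expr0n mulr0.
    by apply/funext => w; rewrite /Z /obs dotv_join mul0r addr0.
  by rewrite k1E lee_fin leNgt k10.
have := sqr_moment2_le (mdot _) (obs_gram (join_vec theta 0)).
move=> /le_trans/(_ (moment4_direction theta)); rewrite lee_fin.
by rewrite -[leLHS]mul1r ler_pM2r// exprn_gt0.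
Qed.

Lemma kappa2_ge1 : 0 < k2 -> 1 <= k2.
Proof.
move=> /kappa2_gt0[s0 m4].
have := sqr_moment2_le (mdot _) (obs_gram (join_vec thetastar 1)).
by rewrite m4 lee_fin -[leLHS]mul1r ler_pM2r// exprn_gt0.
Qed.

End LeastSquares.

(** * Rates, and the oracle inequality *)

Lemma sqr_add_le (R : realDomainType) (a b : R) : (a + b) ^+ 2 <= 2 * a ^+ 2 + 2 * b ^+ 2.
Proof. by have := sqr_ge0 (a - b); rewrite sqrrB sqrrD; lra. Qed.

Lemma kurt_le (R : realType) (k1 k2 : R) : 0 <= k1 -> 0 <= k2 ->
  kurt k1 k2 <= 2 * (k1 + k2).
Proof.
by move=> k10 k20; apply: le_trans (sqr_add_le _ _) _; rewrite !sqr_sqrtr// mulrDr.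
Qed.

Lemma kurt_ge2 (R : realType) (k1 k2 : R) : 1 <= k1 -> 1 <= k2 -> 2 <= kurt k1 k2.
Proof.
move=> h1 h2; have s1 : 1 <= Num.sqrt k1 by rewrite -[leLHS]sqrtr1 ler_wsqrtr.
have s2 : 1 <= Num.sqrt k2 by rewrite -[leLHS]sqrtr1 ler_wsqrtr.
by rewrite /kurt; nra.
Qed.

(** Turns a bound in terms of K and D into the announced order of magnitude,
    using K <= 2 (k1 + k2) and D = d + 1 <= 2 d. *)
Lemma rate_arith (R : realFieldType) (a b c K k D x l : R) :
  0 <= a -> 0 <= b -> 4 * (a + b) <= c -> 0 <= K -> K <= 2 * k -> D <= 2 * x -> 0 <= x -> 0 <= l ->
  K * (a * D + b * (l + 73 / 100 * D)) <= c * (k * (x + l)).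
Proof.
move=> a0 b0 abc K0 Kk Dx x0 l0.
apply: (@le_trans _ _ (K * (2 * (a + b) * (x + l)))).
  by rewrite ler_wpM2l//; nra.
apply: (@le_trans _ _ (2 * k * (2 * (a + b) * (x + l)))).
  by rewrite ler_wpM2r// !mulr_ge0 ?addr_ge0.
rewrite (_ : 2 * k * _ = (4 * (a + b)) * (k * (x + l))); last by ring.
by rewrite ler_wpM2r// mulr_ge0 ?addr_ge0//; lra.
Qed.

Lemma mu_sqr_le (R : realType) (K L D n b : R) : 1 <= K -> 0 <= L -> 0 <= D -> 0 < n ->
  b ^+ 2 <= 50 ->
  (Num.sqrt (2 * (K - 1) * L / n) + b * Num.sqrt K * Num.sqrt (2 * D / n)) ^+ 2 <=
  K * (200 * D + 4 * L) / n.
Proof.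
move=> K1 L0 D0 n0 b2; have K0 : 0 <= K by apply: le_trans K1.
have Km : 0 <= K - 1 by rewrite subr_ge0.
apply: le_trans (sqr_add_le _ _) _.
have Dn : 0 <= 2 * D / n by rewrite divr_ge0 ?mulr_ge0// ltW.
have Ln : 0 <= 2 * (K - 1) * L / n by rewrite divr_ge0 ?(ltW n0)// mulr_ge0// mulr_ge0.
rewrite !exprMn !sqr_sqrtr//.
have e : (2 * (2 * (K - 1) * L / n) + 2 * (b ^+ 2 * K * (2 * D / n))) =
   (4 * ((K - 1) * L) + b ^+ 2 * (4 * (K * D))) / n by field; rewrite gt_eqF.
rewrite e ler_pM2r ?invr_gt0//.
have KD : 0 <= K * D by rewrite mulr_ge0.
have : b ^+ 2 * (4 * (K * D)) <= 50 * (4 * (K * D)) by rewrite ler_wpM2r// mulr_ge0.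
lra.
Qed.

Lemma mu_bound_ge0 (R : realType) (K eps : R) n D : 0 <= mu_bound K eps n D.
Proof.
have b0 : 0 <= 681 / 100 :> R by lra.
rewrite /mu_bound; move: (681 / 100) b0 => b b0.
by rewrite addr_ge0 ?sqrtr_ge0// mulr_ge0 ?sqrtr_ge0// mulr_ge0 ?sqrtr_ge0.
Qed.

Section Rates.
Context (R : realType) (k1 k2 eps : R) (d : nat).
Hypothesis k10 : 0 <= k1.
Hypothesis k20 : 0 <= k2.
Hypothesis eps0 : 0 < eps.
Hypothesis eps1 : eps <= 1.
Hypothesis d0 : (0 < d)%N.
Let K := kurt k1 k2.

Let K0 : 0 <= K. Proof. exact: sqr_ge0. Qed.

Let l0 : 0 <= ln eps^-1.
Proof. by rewrite ln_ge0// invf_ge1. Qed.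

Let D2 : (d + 1)%:R <= 2 * d%:R :> R.
Proof.
have : 1 <= d%:R :> R by rewrite ler1n.
by rewrite addn1 -natr1; lra.
Qed.

Let L0 : 0 <= confidence eps (d + 1).
Proof. by rewrite addr_ge0 ?l0// mulr_ge0 ?ler0n// divr_ge0. Qed.

(** For K at least 2 the factor 1 / (2 (K - 1)) is bounded, so that all terms are of
    order K. *)
Lemma sample_threshold_rate : 2 <= K ->
  sample_threshold K eps (d + 1) <= 3600 * ((k1 + k2) * (d%:R + ln eps^-1)).
Proof.
move=> K2; have K1 : 0 < K - 1 by lra.
apply: (@le_trans _ _ (K * (800 * (d + 1)%:R + 36 * confidence eps (d + 1)))); last first.
  by apply: (rate_arith _ _ _ K0 (kurt_le k10 k20) D2 (ler0n _ _) l0); lra.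
apply: le_trans (sqr_add_le _ _) _.
rewrite !exprMn !sqr_sqrtr ?ler0n// ?mulr_ge0// ?(ltW K1)//.
set c := 5 / 2 + _; have c3 : c ^+ 2 <= 9.
  have r0 : 0 <= 1 / (2 * (K - 1)) by rewrite divr_ge0// mulr_ge0// ltW.
  have c0 : 0 <= c by rewrite /c; lra.
  have : c <= 3.
    have : 1 / (2 * (K - 1)) <= 1 / 2.
      by rewrite ler_pdivrMr ?mulr_gt0//; lra.
    by rewrite /c; lra.
  by move=> h; nra.
have : c ^+ 2 * ((K - 1) * confidence eps (d + 1)) <= 9 * (K * confidence eps (d + 1)).
  apply: ler_pM; rewrite ?sqr_ge0 ?mulr_ge0 ?(ltW K1)//.
  by rewrite ler_wpM2r//; lra.
lra.
Qed.

(** Since delta < 1 forces mu < 1/6, delta is at most 6 mu. *)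
Lemma delta_rate n : 1 < K -> (0 < n)%N ->
  4 * mu_bound K eps n (d + 1) < 1 -> delta_bound K eps n (d + 1) < 1 ->
  delta_bound K eps n (d + 1) ^+ 2 <=
    36 * 816 * ((k1 + k2) * (d%:R + ln eps^-1) / n%:R).
Proof.
move=> K1 n0; have n0R : 0 < n%:R :> R by rewrite ltr0n.
have mu2 : mu_bound K eps n (d + 1) ^+ 2 <=
    K * (200 * (d + 1)%:R + 4 * confidence eps (d + 1)) / n%:R.
  have b2 : (681 / 100 : R) ^+ 2 <= 50 by lra.
  exact: (mu_sqr_le (ltW K1) L0 (ler0n _ _) n0R b2).
have mu0 := mu_bound_ge0 K eps n (d + 1).
rewrite /delta_bound; move: mu0 mu2; set mu := mu_bound _ _ _ _ => mu0 mu2 mu4.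
have m1 : 0 < 1 - 4 * mu by lra.
rewrite ltr_pdivrMr// => h.
have dl : 2 * mu / (1 - 4 * mu) <= 6 * mu.
  by rewrite ler_pdivrMr//; nra.
apply: (@le_trans _ _ ((6 * mu) ^+ 2)).
  by rewrite ler_sqr ?nnegrE ?divr_ge0 ?mulr_ge0// ltW.
apply: (@le_trans _ _ (36 * (K * (200 * (d + 1)%:R + 4 * confidence eps (d + 1)) / n%:R))).
  by rewrite exprMn; lra.
rewrite -[leRHS]mulrA ler_pM2l// [leRHS]mulrA ler_pM2r ?invr_gt0//.
by apply: (rate_arith _ _ _ K0 (kurt_le k10 k20) D2 (ler0n _ _) l0); lra.
Qed.

End Rates.

Section GramEstimator.
Context (R : realType) (K eps : R) (n D : nat).

Definition gram_estimator (Z : 'M[R]_(n, D)) : 'M[R]_D :=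
  if pselect (exists G, robust_gram K eps Z G) is left ex
  then projT1 (cid ex) else 0.

Lemma gram_estimatorP : robust_gram_estimator K eps gram_estimator.
Proof.
move=> Z ex; rewrite /gram_estimator; case: pselect => // ex'.
exact: (projT2 (cid ex')).
Qed.

End GramEstimator.

Lemma with_probability_trivial (R : realType) dsp (T : measurableType dsp)
    (P : probability T R) (p : R) (Q : T -> Prop) : p <= 0 ->
  with_probability_at_least P p Q.
Proof. by move=> p0; exists set0; split => //; rewrite measure0 lee_fin. Qed.

Lemma delta_bound_delta0 (R : realType) (K eps : R) n D :
  4 * mu_bound K eps n D < 1 -> delta_bound K eps n D < 1 ->
  0 <= mu_bound K eps n D ->
  delta0 K eps n D < 1 / 4 /\
  delta_bound K eps n D = 2 * delta0 K eps n D / (1 - 2 * delta0 K eps n D).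
Proof.
rewrite /delta_bound /delta0; move: (mu_bound K eps n D) => mu h4.
have m1 : 0 < 1 - 4 * mu by lra.
rewrite ltr_pdivrMr// => h mu0.
have m2 : 0 < 1 - 2 * mu by lra.
split; first by rewrite ltr_pdivrMr//; lra.
by field; rewrite !gt_eqF//=; lra.
Qed.

Theorem proposition4p4 (R : realType) :
  exists c : R, 0 < c /\
  forall (d : nat) (k1 k2 : R), (0 < d)%N ->
  let K := kurt k1 k2 in
  1 < K ->
  exists Ghat : forall (eps : R) (n : nat), 'M[R]_(n, d + 1) -> 'M[R]_(d + 1),
  (forall eps n, robust_gram_estimator K eps (Ghat eps n)) /\
  forall (dsp : measure_display) (T : measurableType dsp)
    (P : probability T R) (X : T -> 'rV[R]_d) (Y : T -> R)
    (thetastar : 'rV[R]_d),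
  random_vector (obs X Y) ->
  finite_second_moments P X Y ->
  argmin (risk P X Y) thetastar ->
  kappa1 P X = k1%:E ->
  kappa2 P X Y thetastar = k2%:E ->
  forall eps : R, 0 < eps ->
  (eps <= 1 -> (0 < k1 /\ 0 < k2) \/ 2 <= K ->
    sample_threshold K eps (d + 1) <= c * ((k1 + k2) * (d%:R + ln eps^-1))) /\
  forall (n : nat) (Xs : 'I_n -> T -> 'rV[R]_d) (Ys : 'I_n -> T -> R),
  iid_copies P X Y Xs Ys ->
  sample_threshold K eps (d + 1) < n%:R ->
  let delta := delta_bound K eps n (d + 1) in
  4 * mu_bound K eps n (d + 1) < 1 ->
  delta < 1 ->
  (eps <= 1 ->
    delta ^+ 2 <= c * ((k1 + k2) * (d%:R + ln eps^-1) / n%:R)) /\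
  forall thetahat : T -> 'rV[R]_d,
  (forall w, argmin (fun theta => Nbreve (Ghat eps n (sample Xs Ys w)) theta 1)
               !=set0 ->
     argmin (fun theta => Nbreve (Ghat eps n (sample Xs Ys w)) theta 1)
       (thetahat w)) ->
  with_probability_at_least P (1 - 2 * eps)
    (fun w => risk P X Y (thetahat w) - risk P X Y thetastar <=
              delta ^+ 2 / (1 - delta) ^+ 2 * risk P X Y thetastar).
Proof.
(* The factor 36 comes from delta <= 6 mu, and 816 = 4 (200 + 4) from the
   bound on mu^2. *)
exists (36 * 816); split; first by lra.
move=> d k1 k2 d0 K K1.
exists (fun eps n => @gram_estimator R K eps n (d + 1)).
split=> [eps n|]; first exact: gram_estimatorP.
move=> dsp T P X Y thetastar mXY fXY am k1E k2E eps eps0.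
have k10 := kappa1_ge0 k1E; have k20 := kappa2_ge0 k2E.
split=> [eps1 hK|n Xs Ys [mXYs lawXYs indXYs] hn delta mu4 del1].
  have K2 : 2 <= K.
    case: hK => // -[k1p k2p]; apply: kurt_ge2.
      exact: (kappa1_ge1 mXY fXY k1E).
    exact: (kappa2_ge1 mXY fXY k2E).
  apply: le_trans (sample_threshold_rate k10 k20 eps0 eps1 d0 K2) _.
  apply: ler_wpM2r; last by lra.
  by rewrite mulr_ge0 ?addr_ge0// ln_ge0// invf_ge1.
split=> [eps1|thetahat hth].
  apply: delta_rate => //; have := le_lt_trans (sqr_ge0 _) hn.
  by rewrite ltr0n.
have [eps1|eps1] := leP eps 1; last first.
  by apply: with_probability_trivial; lra.
have D0 : (0 < d + 1)%N by rewrite addn1.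
have mZs i j : measurable_fun setT (fun w => obs (Xs i) (Ys i) w 0 j).
  exact: measurable_obs.
have mZ0 := measurable_obs mXY.
pose G := gram P (obs X Y).
have GT : G^T = G := gram_sym P (obs X Y).
have Gp := obs_gram_ge0 mXY fXY.
have Z2 t : (\int[P]_w (dotv t (obs X Y w) ^+ 2)%:E = (qform G t)%:E)%E.
  by rewrite -momentE; exact: obs_gram.
have Z4 t : (\int[P]_w (dotv t (obs X Y w) ^+ 4)%:E <= (K * qform G t ^+ 2)%:E)%E.
  by rewrite -momentE; exact: (obs_kurtosis mXY fXY am k1E k2E).
have [E [mE PE Eok]] := gram_two_sided mZs mZ0 indXYs lawXYs GT Z2 Z4 K1 eps0 eps1 D0 hn mu4.
exists E; split=> // w /Eok[GN Gnull0].
have Gnull t i : qform G t = 0 -> dotv t (row i (sample Xs Ys w)) = 0.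
  by move=> /(Gnull0 _ i); rewrite rowK.
have lam0 := scale_gt0 K1 eps0 eps1 D0 hn.
have dp := delta0_gt0 K1 eps0 eps1 D0 hn mu4.
have [d4 dE] := delta_bound_delta0 mu4 del1 (mu_bound_ge0 _ _ _ _).
have del0 : 0 <= delta.
  rewrite /delta dE; move: (delta0 _ _ _ _) dp d4 => x x0 x4.
  by rewrite divr_ge0//; lra.
rewrite !(risk_gram mXY fXY).
(* If the whole sample is zero, then so is the Gram form on the event, and the
   risk vanishes identically. *)
have [ne|no] := pselect (span_sphere (sample Xs Ys w) !=set0); last first.
  have z t : qform G t = 0.
    have tZ : t *m (sample Xs Ys w)^T = 0 by rewrite (span_sphere_eq0 no) trmx0 mulmx0.
    exact: (qform_eq0_perp lam0 Gp GN Gnull t).2 tZ.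
  by rewrite !z subrr mulr0.
have ex := exists_robust_gram lam0 dp GT Gp GN Gnull ne.
have rob := gram_estimatorP ex.
have [HT HG] := robust_gram_accuracy lam0 dp d4 GT Gp GN Gnull rob.
rewrite -dE -/delta in HG.
have Hp t : 0 <= qform (gram_estimator K eps (sample Xs Ys w)) t.
  have /ler_normlP[h _] := HG t; have : delta * qform G t <= 1 * qform G t.
    by rewrite ler_wpM2r// ltW.
  by move=> h2; move: h h2; rewrite mul1r; lra.
apply: (regression_excess_risk GT HT del0 del1 Gp HG).
- exact: (obs_argmin mXY fXY am).
- exact: hth (argmin_nonempty HT Hp).
Qed.
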